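(* Let $\alpha,\beta\in\mathbb{R}$ with $\alpha+\beta<1$, let $x,y>0$ and $\tau\in\mathbb{R}$. Then $$W_{\alpha,i\tau}(x)W_{\beta,i\tau}(y)=\frac{(xy)^{\alpha}e^{-(x+y)/2}}{\Gamma(1-\alpha-\beta)}\int_0^\infty e^{-t}t^{-\alpha-\beta}(t+y)^{\beta-\alpha}\,{}_2F_1\left(\tfrac12-\alpha+i\tau,\ \tfrac12-\alpha-i\tau;\ 1-\alpha-\beta;\ -t\left(\tfrac1x+\tfrac1y\right)-\tfrac{t^2}{xy}\right)dt$$ $$=\frac{(xy)^{\beta}e^{-(x+y)/2}}{\Gamma(1-\alpha-\beta)}\int_0^\infty e^{-t}t^{-\alpha-\beta}(t+x)^{\alpha-\beta}\,{}_2F_1\left(\tfrac12-\beta+i\tau,\ \tfrac12-\beta-i\tau;\ 1-\alpha-\beta;\ -t\left(\tfrac1x+\tfrac1y\right)-\tfrac{t^2}{xy}\right)dt.$$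
   Context: $W_{\mu,\kappa}(x)$ is the Whittaker function of the second kind, the standard solution of $u''+\left(\frac{\mu}{x}-\frac14+\frac{1/4-\kappa^2}{x^2}\right)u=0$ which decays like $x^{\mu}e^{-x/2}$ as $x\to+\infty$. $\Gamma$ is the Euler gamma function and ${}_2F_1$ is the Gauss hypergeometric function (analytically continued to the negative real axis). *)

(* Defs.v *)
From Stdlib Require Import Arith Reals ClassicalEpsilon.
From Coquelicot Require Import Coquelicot.

Open Scope R_scope.

(* Complex-valued functions of a real variable are differentiated and
   integrated in [C] seen as a real normed space. *)
Definition is_derive_RC (f : R -> C) (x : R) (l : C) : Prop :=
  @is_derive R_AbsRing C_R_NormedModule f x l.

Definition ex_int_0_infty (f : R -> C) : Prop :=
  @ex_RInt_gen C_R_NormedModule f (at_right 0) (Rbar_locally p_infty).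

Definition int_0_infty (f : R -> C) : C :=
  @RInt_gen C_R_CompleteNormedModule f (at_right 0) (Rbar_locally p_infty).

(* Euler's integral; meaningful for 0 < s only. *)
Definition Gamma (s : R) : R :=
  RInt_gen (fun t : R => Rpower t (s - 1) * exp (- t))
    (at_right 0) (Rbar_locally p_infty).

(* u'' + (mu/x - 1/4 + (1/4 - kappa^2)/x^2) u = 0 on (0, +oo), normalised by
   u(x) ~ x^mu e^(-x/2) as x -> +oo.  The asymptotics single out the recessive
   solution, since the independent solutions grow like x^(-mu) e^(x/2). *)
Definition is_WhittakerW (mu : R) (kappa : C) (u : R -> C) : Prop :=
  (exists du ddu : R -> C,
     forall x : R, 0 < x ->
       is_derive_RC u x (du x) /\
       is_derive_RC du x (ddu x) /\
       (ddu x + (mu / x - 1 / 4 + (1 / 4 - kappa * kappa) / (x * x)) * u x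
        = 0)%C) /\
  filterlim (fun x : R => (u x / RtoC (Rpower x mu * exp (- x / 2)))%C)
    (Rbar_locally p_infty) (locally (RtoC 1)).

(* The values at x <= 0 are unspecified. *)
Definition WhittakerW (mu : R) (kappa : C) : R -> C :=
  epsilon (inhabits (fun _ : R => RtoC 0)) (is_WhittakerW mu kappa).

Fixpoint pochhammer (a : C) (n : nat) : C :=
  match n with
  | O => RtoC 1
  | S m => (pochhammer a m * (a + RtoC (INR m)))%C
  end.

Definition Gauss_coeff (a b c : C) (n : nat) : C :=
  (pochhammer a n * pochhammer b n
   / (pochhammer c n * RtoC (INR (fact n))))%C.

Definition has_pseries_at (f : R -> C) (x0 x : R) (a : nat -> C) : Prop :=
  @is_pseries R_AbsRing C_R_NormedModule a (x - x0) (f x).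

Definition analytic_at (f : R -> C) (x0 : R) : Prop :=
  exists a : nat -> C, locally x0 (fun x : R => has_pseries_at f x0 x a).

(* Analytic continuation of the Gauss series from (-1, 1) along the negative
   real axis; it is unique because (-oo, 1) is connected. *)
Definition is_hyp2F1 (a b c : C) (F : R -> C) : Prop :=
  (forall x : R, -1 < x < 1 -> has_pseries_at F 0 x (Gauss_coeff a b c)) /\
  (forall x : R, x < 1 -> analytic_at F x).

(* Meaningful for real arguments x < 1 and c not in {0, -1, -2, ...}. *)
Definition hyp2F1 (a b c : C) : R -> C :=
  epsilon (inhabits (fun _ : R => RtoC 0)) (is_hyp2F1 a b c).

(* Main.v *)
Require Import Defs.
From Stdlib Require Import Arith Reals Lra Lia ClassicalEpsilon.
From Coquelicot Require Import Coquelicot.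
Open Scope R_scope.

(** Everything reduces to real functions.  Put [c = 1 - alpha - beta], [a] and [b] the two
    conjugate parameters, [A = a + b = 1 - 2 alpha] and
    [B = a b = (1/2 - alpha)^2 + tau^2]; then [F (s) = 2F1 (a, b; c; - s)] is real and
    solves a real hypergeometric equation on [s > -1].  For [eps >= 0] consider
[[
  V_eps (w) = int_0^oo exp (- t) t^(c-1) (1 + eps t)^(beta - alpha)
                F ((1 + t w) (1 + eps t) - 1) dt.
]]
    With [w = 1 / x] and [eps = 1 / y] this is, up to elementary factors, the integral of
    the first formula.

    Combining the equation of [F] with one integration by parts gives
    [w^2 V'' + ((A + 1) w + 1) V' + B V = 0] for every [eps] (lemma
    [conf_int_equation]), which says that [x^alpha exp (- x / 2) V_eps (1 / x)] solves
    Whittaker's equation in [x].  Its leading coefficient at infinity is [V_eps (0)].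
    A solution which is recessive at infinity is determined by this coefficient
    ([wh_recessive_unique]), so that

    - for [eps = 0], where [V_0 (0) = Gamma (c)], one obtains the Whittaker function
      itself, whatever the value of [c > 0];
    - for [eps = 1 / y] one obtains [V_eps (0)] times the Whittaker function.

    Finally Euler's transformation [F = (1 + s)^(alpha - beta) F*], where [F*] is
    built from [beta] with the same [c], turns [V_eps (0)] into the integral [V*_0 (eps)]
    attached to [beta] ([conf_int_euler]), which is the Whittaker function in [y] up to the
    factor [Gamma (c)] and elementary ones.  The second formula is the first one with
    the roles of [(alpha, x)] and [(beta, y)] exchanged.

    The functions named in the statement are pinned down as follows.  [F] is the Gauss
    series for [|s| < 1] and a power series in [s / (1 + s)] for [s > 0]; the two agree
    because a solution which is regular at [0] is determined by its value there
    ([regular_unique]), a fact that also yields Euler's transformation.  The equation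
    bounds all derivatives factorially, so [F] is analytic, and the identity theorem
    identifies it with the analytic continuation ([hyp2F1_conjugate]).  An energy estimate
    shows that [F] and its derivatives grow polynomially, which justifies all
    manipulations of the improper integrals by domination. *)

(** * Monotonicity and comparison of functions of a real variable *)

Lemma mvt_is_derive (f df : R -> R) (a b : R) :
  (forall x, Rmin a b <= x <= Rmax a b -> is_derive f x (df x)) ->
  exists c, Rmin a b <= c <= Rmax a b /\ f b - f a = df c * (b - a).
Proof.
  intros H. apply (MVT_gen f a b df).
  - intros x Hx. apply H. lra.
  - intros x Hx. apply continuity_pt_filterlim.
    apply (ex_derive_continuous f). exists (df x). now apply H.
Qed.

Lemma derive_ge0_le (f df : R -> R) (a b : R) :
  a <= b ->
  (forall x, a <= x <= b -> is_derive f x (df x)) ->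
  (forall x, a <= x <= b -> 0 <= df x) -> f a <= f b.
Proof.
  intros Hab Hd Hp.
  destruct (mvt_is_derive f df a b) as [c [Hc E]].
  - intros x. rewrite Rmin_left, Rmax_right by lra. apply Hd.
  - rewrite Rmin_left, Rmax_right in Hc by lra.
    generalize (Hp c Hc); intros. nra.
Qed.

Lemma derive_le0_ge (f df : R -> R) (a b : R) :
  a <= b ->
  (forall x, a <= x <= b -> is_derive f x (df x)) ->
  (forall x, a <= x <= b -> df x <= 0) -> f b <= f a.
Proof.
  intros Hab Hd Hp.
  destruct (mvt_is_derive f df a b) as [c [Hc E]].
  - intros x. rewrite Rmin_left, Rmax_right by lra. apply Hd.
  - rewrite Rmin_left, Rmax_right in Hc by lra.
    generalize (Hp c Hc); intros. nra.
Qed.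

(** Both [G - g] and [G + g] are nondecreasing and start from [0]. *)
Lemma abs_le_from_0 (g dg G dG : R -> R) (r : R) :
  (forall x, 0 < x < r -> is_derive g x (dg x)) ->
  (forall x, 0 < x < r -> is_derive G x (dG x)) ->
  (forall x, 0 < x < r -> Rabs (dg x) <= dG x) ->
  filterlim g (at_right 0) (locally 0) ->
  filterlim G (at_right 0) (locally 0) ->
  forall x, 0 < x < r -> Rabs (g x) <= G x.
Proof.
  intros Hg HG Hle Lg LG x Hx.
  assert (Hev : at_right 0 (fun t => 0 < t < x)).
  { exists (mkposreal x (proj1 Hx)). intros t Ht Ht0.
    unfold ball in Ht; simpl in Ht; unfold AbsRing_ball, abs, minus, plus, opp in Ht;
    simpl in Ht. apply Rabs_def2 in Ht. lra. }
  assert (K : forall s, s = 1 \/ s = -1 -> 0 <= G x + s * g x).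
  { intros s Hs.
    assert (L : filterlim (fun t => G t + s * g t) (at_right 0) (locally 0)).
    { replace (locally 0) with (locally (0 + s * 0)) by (f_equal; ring).
      apply (filterlim_comp_2 (F := at_right 0) (G := locally 0)
               (H := locally (s * 0)) G (fun t => s * g t) Rplus).
      - exact LG.
      - apply (filterlim_comp _ _ _ g (fun y => s * y) _ (locally 0)); [exact Lg|].
        apply (filterlim_scal_r s 0).
      - apply (filterlim_plus 0 (s * 0)). }
    apply (filterlim_le (F := at_right 0) (fun t => G t + s * g t)
             (fun _ => G x + s * g x) 0 (G x + s * g x)); [|exact L|apply filterlim_const].
    revert Hev. apply filter_imp. intros t Ht.
    apply (derive_ge0_le (fun t => G t + s * g t) (fun t => dG t + s * dg t)).
    - lra.
    - intros z Hz. apply (is_derive_plus (V := R_NormedModule)).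
      + apply HG; lra.
      + apply is_derive_scal. apply Hg; lra.
    - intros z Hz. assert (H := Hle z ltac:(lra)).
      apply Rabs_le_between in H. destruct Hs; subst s; lra. }
  apply Rabs_le. generalize (K 1 (or_introl eq_refl)) (K (-1) (or_intror eq_refl)). lra.
Qed.

(** * Improper integrals over the half-line *)

(** [majorant c] is integrable over [(0, +oo)] for [0 < c]: its antiderivative
    [majorant_prim c] increases from [0] to [1 / c]. *)
Definition majorant (c t : R) : R := Rpower t (c - 1) * Rpower (1 + t) (- c - 1).
Definition majorant_prim (c t : R) : R := Rpower (t / (1 + t)) c / c.

Lemma Rpower_pos (x y : R) : 0 < Rpower x y.
Proof. apply exp_pos. Qed.

Lemma is_derive_Rpower (a x : R) :
  0 < x -> is_derive (fun t => Rpower t a) x (a * Rpower x (a - 1)).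
Proof. intros Hx. apply is_derive_Reals. now apply derivable_pt_lim_power. Qed.

Lemma Rpower_plus1 (x a : R) : 0 < x -> Rpower x (a + 1) = Rpower x a * x.
Proof. intros Hx. now rewrite Rpower_plus, Rpower_1. Qed.

Lemma Rpower_minus1 (x a : R) : 0 < x -> Rpower x (a - 1) = Rpower x a / x.
Proof.
  intros Hx. replace a with ((a - 1) + 1) at 2 by ring.
  rewrite Rpower_plus1 by assumption. field. lra.
Qed.

Lemma is_derive_majorant_prim (c t : R) :
  0 < c -> 0 < t -> is_derive (majorant_prim c) t (majorant c t).
Proof.
  intros Hc Ht. unfold majorant_prim, majorant.
  assert (Hq : 0 < t / (1 + t)) by (apply Rdiv_lt_0_compat; lra).
  evar_last.
  - apply (is_derive_ext (fun t => / c * Rpower (t / (1 + t)) c)).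
    { intros s. unfold Rdiv. now rewrite Rmult_comm. }
    apply is_derive_scal.
    apply (is_derive_comp (fun q => Rpower q c) (fun t => t / (1 + t))).
    + now apply is_derive_Rpower.
    + auto_derive; [lra|reflexivity].
  - unfold scal; simpl; unfold mult; simpl.
    replace (- c - 1) with (- (c + 1)) by ring.
    rewrite !Rpower_minus1 by lra.
    rewrite Rpower_Ropp, Rpower_plus1 by lra.
    assert (E : Rpower (t / (1 + t)) c = Rpower t c * / Rpower (1 + t) c).
    { unfold Rdiv. rewrite <- Rpower_mult_distr by (try apply Rinv_0_lt_compat; lra).
      f_equal. unfold Rpower. rewrite ln_Rinv by lra.
      rewrite <- exp_Ropp. f_equal. ring. }
    rewrite E. field. generalize (Rpower_pos (1 + t) c). lra.
Qed.

Lemma continuous_of_derive (f : R -> R) (x l : R) :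
  is_derive f x l -> continuous f x.
Proof. intros H. apply (ex_derive_continuous f). now exists l. Qed.

Lemma continuous_Rpower (a x : R) : 0 < x -> continuous (fun t => Rpower t a) x.
Proof. intros Hx. eapply continuous_of_derive. now apply is_derive_Rpower. Qed.

Lemma majorant_continuous (c t : R) : 0 < t -> continuous (majorant c) t.
Proof.
  intros Ht. unfold majorant. apply (continuous_mult (K := R_AbsRing)).
  - now apply continuous_Rpower.
  - apply (continuous_comp (fun t => 1 + t) (fun u => Rpower u (- c - 1))).
    + eapply continuous_of_derive. auto_derive; [exact I|reflexivity].
    + apply continuous_Rpower; lra.
Qed.

Lemma filterlim_Rpower_0 (c : R) : 0 < c ->
  filterlim (fun t => Rpower t c) (at_right 0) (locally 0).
Proof.
  intros Hc P [e He].
  exists (mkposreal (Rpower e (/ c)) (Rpower_pos _ _)).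
  intros t Ht Ht0. apply He.
  unfold ball in *; simpl in *; unfold AbsRing_ball, abs, minus, plus, opp in *; simpl in *.
  rewrite Ropp_0, Rplus_0_r in *.
  rewrite Rabs_pos_eq in Ht by lra.
  rewrite Rabs_pos_eq by (left; apply Rpower_pos).
  replace (pos e) with (Rpower (Rpower e (/ c)) c).
  - now apply Rlt_Rpower_l.
  - rewrite Rpower_mult, Rinv_l, Rpower_1; [reflexivity| apply e | lra].
Qed.

Lemma filterlim_inv_infty :
  filterlim (fun t : R => / t) (Rbar_locally p_infty) (at_right 0).
Proof.
  intros P [e He]. exists (/ e). intros t Ht.
  assert (0 < / e) by (apply Rinv_0_lt_compat, cond_pos).
  apply He.
  - unfold ball; simpl; unfold AbsRing_ball, abs, minus, plus, opp; simpl.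
    rewrite Ropp_0, Rplus_0_r, Rabs_pos_eq by (left; apply Rinv_0_lt_compat; lra).
    rewrite <- (Rinv_inv e). apply Rinv_lt_contravar; [|exact Ht].
    apply Rmult_lt_0_compat; lra.
  - apply Rinv_0_lt_compat; lra.
Qed.

Lemma majorant_prim_0 (c : R) : 0 < c -> filterlim (majorant_prim c) (at_right 0) (locally 0).
Proof.
  intros Hc. unfold majorant_prim, Rdiv.
  replace (locally 0) with (locally (0 * / c)) by (f_equal; ring).
  apply (filterlim_comp _ _ _ (fun t => Rpower (t / (1 + t)) c) (fun y => y * / c)
     _ (locally 0)).
  2: apply (filterlim_scal_l 0 (/ c)).
  apply (filterlim_comp _ _ _ (fun t => t / (1 + t)) (fun q => Rpower q c) _ (at_right 0)).
  2: now apply filterlim_Rpower_0.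
  intros P [e He]. exists e. intros t Ht Ht0. apply He.
  - unfold ball in *; simpl in *; unfold AbsRing_ball, abs, minus, plus, opp in *; simpl in *.
    rewrite Ropp_0, Rplus_0_r in *.
    rewrite Rabs_pos_eq in Ht by lra.
    assert (0 < t / (1 + t)) by (apply Rdiv_lt_0_compat; lra).
    rewrite Rabs_pos_eq by lra. apply Rle_lt_trans with t; [|exact Ht].
    apply Rmult_le_reg_r with (1 + t); [lra|].
    unfold Rdiv. rewrite Rmult_assoc, Rinv_l by lra. nra.
  - apply Rdiv_lt_0_compat; lra.
Qed.

Lemma majorant_prim_infty (c : R) : 0 < c ->
  filterlim (majorant_prim c) (Rbar_locally p_infty) (locally (/ c)).
Proof.
  intros Hc.
  assert (C : continuous (fun u => Rpower (/ (1 + u)) c / c) 0).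
  { eapply continuous_of_derive. unfold Rpower. auto_derive.
    - split; [lra|]. split; [|exact I]. rewrite Rplus_0_r, Rinv_1; lra.
    - reflexivity. }
  unfold continuous in C.
  replace (Rpower (/ (1 + 0)) c / c) with (/ c) in C.
  2:{ rewrite Rplus_0_r, Rinv_1. unfold Rpower. rewrite ln_1, Rmult_0_r, exp_0. field. lra. }
  apply (filterlim_ext_loc (fun t => (fun u => Rpower (/ (1 + u)) c / c) (/ t))).
  - exists 0. intros t Ht. unfold majorant_prim. do 2 f_equal. field. lra.
  - apply (filterlim_comp _ _ _ Rinv (fun u => Rpower (/ (1 + u)) c / c) _ (locally 0));
      [|exact C].
    eapply filterlim_filter_le_2; [|apply filterlim_inv_infty].
    apply filter_le_within.
Qed.

Lemma half_line_prod (P : R * R -> Prop) (m M : R) : 0 < m ->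
  (forall a b, 0 < a < m -> M < b -> P (a, b)) ->
  filter_prod (at_right 0) (Rbar_locally p_infty) P.
Proof.
  intros Hm H.
  apply (Filter_prod _ _ _ (fun a => 0 < a < m) (fun b => M < b)).
  - exists (mkposreal m Hm). intros t Ht Ht0. split; [exact Ht0|].
    unfold ball in Ht; simpl in Ht; unfold AbsRing_ball, abs, minus, plus, opp in Ht;
    simpl in Ht. apply Rabs_def2 in Ht. lra.
  - now exists M.
  - intros a b Ha Hb. now apply H.
Qed.

(** The half-line analogue of [is_RInt_derive]. *)
Lemma is_RInt_gen_half_line (f df : R -> R) (l0 l1 : R) :
  (forall t, 0 < t -> is_derive f t (df t)) ->
  (forall t, 0 < t -> continuous df t) ->
  filterlim f (at_right 0) (locally l0) ->
  filterlim f (Rbar_locally p_infty) (locally l1) ->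
  is_RInt_gen df (at_right 0) (Rbar_locally p_infty) (l1 - l0).
Proof.
  intros Hd Hc L0 L1 P HP.
  assert (L : filterlim (fun ab : R * R => f (snd ab) - f (fst ab))
     (filter_prod (at_right 0) (Rbar_locally p_infty)) (locally (l1 - l0))).
  { apply (filterlim_comp_2 (G := locally l1) (H := locally (- l0))
     (fun ab : R * R => f (snd ab)) (fun ab : R * R => - f (fst ab)) Rplus).
    - apply (filterlim_comp _ _ _ snd f _ (Rbar_locally p_infty));
        [apply filterlim_snd | exact L1].
    - apply (filterlim_comp _ _ _ fst (fun a => - f a) _ (at_right 0));
        [apply filterlim_fst |].
      apply (filterlim_comp _ _ _ f Ropp _ (locally l0)); [exact L0|].
      apply (filterlim_opp l0).
    - apply (filterlim_plus l1 (- l0)). }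
  assert (Q : filter_prod (at_right 0) (Rbar_locally p_infty)
     (fun ab => 0 < fst ab < 1 /\ 1 < snd ab)).
  { apply (half_line_prod _ 1 1); [lra|]. simpl. auto. }
  unfold filtermapi.
  assert (Q2 : filter_prod (at_right 0) (Rbar_locally p_infty)
     (fun ab => P (f (snd ab) - f (fst ab)))) by exact (L P HP).
  refine (filter_imp _ _ _ (filter_and _ _ Q Q2)).
  intros [a b] [[Ha Hb] HP']; simpl in *.
  exists (f b - f a). split; [|exact HP'].
  apply (is_RInt_derive f df).
  - intros x. rewrite Rmin_left, Rmax_right by lra. intros; apply Hd; lra.
  - intros x. rewrite Rmin_left, Rmax_right by lra. intros; apply Hc; lra.
Qed.

Lemma is_RInt_gen_majorant (c : R) : 0 < c ->
  is_RInt_gen (majorant c) (at_right 0) (Rbar_locally p_infty) (/ c).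
Proof.
  intros Hc. rewrite <- (Rminus_0_r (/ c)).
  apply (is_RInt_gen_half_line (majorant_prim c)).
  - intros. now apply is_derive_majorant_prim.
  - intros. now apply majorant_continuous.
  - now apply majorant_prim_0.
  - now apply majorant_prim_infty.
Qed.

Definition half_line_int (g : R -> R) : R :=
  RInt_gen g (at_right 0) (Rbar_locally p_infty).

Definition dominated (c : R) (g : R -> R) : Prop :=
  (forall t, 0 < t -> continuous g t) /\
  exists C, forall t, 0 < t -> Rabs (g t) <= C * majorant c t.

Lemma ex_RInt_half_line (g : R -> R) :
  (forall t, 0 < t -> continuous g t) ->
  forall a b, 0 < a -> 0 < b -> ex_RInt g a b.
Proof.
  intros Hg a b Ha Hb. apply (ex_RInt_continuous (V := R_CompleteNormedModule)).
  intros z Hz. apply Hg. assert (0 < Rmin a b) by (now apply Rmin_pos). lra.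
Qed.

Lemma majorant_prim_diff_le (c : R) (g : R -> R) (C : R) : 0 < c ->
  (forall t, 0 < t -> continuous g t) ->
  (forall t, 0 < t -> Rabs (g t) <= C * majorant c t) ->
  forall a b, 0 < a -> 0 < b -> Rabs (RInt g a b) <= Rabs (C * (majorant_prim c b - majorant_prim c a)).
Proof.
  intros Hc Hg HC.
  assert (Hex := ex_RInt_half_line g Hg).
  assert (W : forall a b, 0 < a -> a <= b ->
      Rabs (RInt g a b) <= Rabs (C * (majorant_prim c b - majorant_prim c a))).
  { intros a b Ha Hab.
    apply Rle_trans with (C * (majorant_prim c b - majorant_prim c a)); [|apply Rle_abs].
    apply (norm_RInt_le g (fun t => C * majorant c t) a b); [exact Hab| | |].
    - intros t Ht. apply HC. lra.
    - apply (RInt_correct (V := R_CompleteNormedModule)). apply Hex; lra.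
    - apply (is_RInt_scal (majorant c) a b C (majorant_prim c b - majorant_prim c a)).
      apply (is_RInt_derive (majorant_prim c)).
      + intros x. rewrite Rmin_left, Rmax_right by lra.
        intros; apply is_derive_majorant_prim; lra.
      + intros x. rewrite Rmin_left, Rmax_right by lra.
        intros; apply majorant_continuous; lra. }
  intros a b Ha Hb. destruct (Rle_dec a b) as [H|H].
  - now apply W.
  - rewrite <- opp_RInt_swap by (apply Hex; lra).
    unfold opp; simpl. rewrite Rabs_Ropp.
    replace (C * (majorant_prim c b - majorant_prim c a)) with (- (C * (majorant_prim c a - majorant_prim c b))) by ring.
    rewrite Rabs_Ropp. apply W; lra.
Qed.

(** Cauchy criterion: the increments of the integral of [g] are controlled by
    those of [C * majorant_prim c], which has limits at both ends. *)
Lemma dominated_ex (c : R) (g : R -> R) : 0 < c -> dominated c g ->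
  ex_RInt_gen g (at_right 0) (Rbar_locally p_infty).
Proof.
  intros Hc [Hg [C HC]].
  assert (Hex := ex_RInt_half_line g Hg).
  assert (Q : filter_prod (at_right 0) (Rbar_locally p_infty)
     (fun ab => 0 < fst ab < 1 /\ 1 < snd ab)).
  { apply (half_line_prod _ 1 1); [lra|]. simpl. auto. }
  assert (X : exists l : R, filterlim (fun ab : R * R => RInt g (fst ab) (snd ab))
     (filter_prod (at_right 0) (Rbar_locally p_infty)) (locally l)).
  { apply (filterlim_locally_cauchy (U := R_CompleteSpace)).
    intros eps.
    set (K := Rabs C + 1). assert (HK : 0 < K) by (unfold K; generalize (Rabs_pos C); lra).
    set (d := eps / (4 * K)).
    assert (Hd : 0 < d) by (apply Rdiv_lt_0_compat; [apply cond_pos|lra]).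
    exists (fun ab => (0 < fst ab < 1 /\ 1 < snd ab) /\
       (Rabs (majorant_prim c (fst ab) - 0) < d /\ Rabs (majorant_prim c (snd ab) - / c) < d)).
    split.
    - apply filter_and; [exact Q|].
      apply (Filter_prod _ _ _ (fun a => Rabs (majorant_prim c a - 0) < d)
         (fun b => Rabs (majorant_prim c b - / c) < d)).
      + apply (majorant_prim_0 c Hc (fun y => Rabs (y - 0) < d)).
        exists (mkposreal d Hd). intros y Hy. exact Hy.
      + apply (majorant_prim_infty c Hc (fun y => Rabs (y - / c) < d)).
        exists (mkposreal d Hd). intros y Hy. exact Hy.
      + intros a b H1 H2. now split.
    - intros [a b] [a' b'] [[Ha Hb] [A1 B1]] [[Ha' Hb'] [A2 B2]]; simpl in *.
      unfold ball; simpl; unfold AbsRing_ball, abs, minus, plus, opp; simpl.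
      assert (E : RInt g a' b' = RInt g a' a + RInt g a b + RInt g b b').
      { rewrite <- (RInt_Chasles g a' b b') by (apply Hex; lra).
        rewrite <- (RInt_Chasles g a' a b) by (apply Hex; lra). reflexivity. }
      assert (I1 := majorant_prim_diff_le c g C Hc Hg HC a' a ltac:(lra) ltac:(lra)).
      assert (I2 := majorant_prim_diff_le c g C Hc Hg HC b b' ltac:(lra) ltac:(lra)).
      rewrite Rabs_mult in I1, I2.
      assert (Z : forall u, 0 <= Rabs u -> Rabs u <= 2 * d -> Rabs C * Rabs u <= eps / 2 - 2 * d).
      { intros u Hu Hu2.
        replace (eps / 2) with (2 * d * K) by (unfold d; field; lra).
        unfold K. generalize (Rabs_pos C). nra. }
      assert (I1' : Rabs C * Rabs (majorant_prim c a - majorant_prim c a') <= eps / 2 - 2 * d).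
      { apply Z; [apply Rabs_pos|]. apply Rabs_def2 in A1; apply Rabs_def2 in A2.
        apply Rabs_le; lra. }
      assert (I2' : Rabs C * Rabs (majorant_prim c b' - majorant_prim c b) <= eps / 2 - 2 * d).
      { apply Z; [apply Rabs_pos|]. apply Rabs_def2 in B1; apply Rabs_def2 in B2.
        apply Rabs_le; lra. }
      rewrite E.
      replace (RInt g a' a + RInt g a b + RInt g b b' + - RInt g a b)
        with (RInt g a' a + RInt g b b') by ring.
      eapply Rle_lt_trans; [apply Rabs_triang|]. lra. }
  destruct X as [l Hl]. exists l. intros P HP.
  unfold filtermapi.
  assert (Q2 : filter_prod (at_right 0) (Rbar_locally p_infty)
     (fun ab => P (RInt g (fst ab) (snd ab)))) by exact (Hl P HP).
  refine (filter_imp _ _ _ (filter_and _ _ Q Q2)).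
  intros [a b] [[Ha Hb] HP']; simpl in *.
  exists (RInt g a b). split; [|exact HP'].
  apply (RInt_correct (V := R_CompleteNormedModule)). apply Hex; lra.
Qed.

Lemma dominated_is (c : R) (g : R -> R) : 0 < c -> dominated c g ->
  is_RInt_gen g (at_right 0) (Rbar_locally p_infty) (half_line_int g).
Proof.
  intros Hc Hg.
  apply (@RInt_gen_correct R_CompleteNormedModule _ _
           (Proper_StrongProper _ (at_right_proper_filter 0))
           (Proper_StrongProper _ (Rbar_locally_filter p_infty))).
  now apply dominated_ex with c.
Qed.

Lemma half_line_int_unique (g : R -> R) (l : R) :
  is_RInt_gen g (at_right 0) (Rbar_locally p_infty) l -> half_line_int g = l.
Proof.
  intros H.
  exact (@is_RInt_gen_unique R_CompleteNormedModule _ _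
           (Proper_StrongProper _ (at_right_proper_filter 0))
           (Proper_StrongProper _ (Rbar_locally_filter p_infty)) g l H).
Qed.

Lemma half_line_le (g h : R -> R) (lg lh : R) :
  is_RInt_gen g (at_right 0) (Rbar_locally p_infty) lg ->
  is_RInt_gen h (at_right 0) (Rbar_locally p_infty) lh ->
  (forall t, 0 < t -> Rabs (g t) <= h t) -> Rabs lg <= lh.
Proof.
  intros Hg Hh H.
  apply (RInt_gen_norm (V := R_CompleteNormedModule) (Fa := at_right 0)
           (Fb := Rbar_locally p_infty) g h lg lh).
  - apply (half_line_prod _ 1 1); [lra|]. simpl. intros; lra.
  - apply (half_line_prod _ 1 1); [lra|]. simpl. intros a b Ha Hb t Ht. apply H. lra.
  - exact Hg.
  - exact Hh.
Qed.

Lemma dominated_int_le (c C : R) (g : R -> R) : 0 < c ->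
  (forall t, 0 < t -> continuous g t) ->
  (forall t, 0 < t -> Rabs (g t) <= C * majorant c t) ->
  Rabs (half_line_int g) <= C / c.
Proof.
  intros Hc Hg HC.
  apply (half_line_le g (fun t => C * majorant c t)); [| |exact HC].
  - apply dominated_is with c; [exact Hc|]. split; [exact Hg|now exists C].
  - apply (is_RInt_gen_scal (majorant c) C (/ c)). now apply is_RInt_gen_majorant.
Qed.

Lemma half_line_int_ext (g h : R -> R) :
  (forall t, 0 < t -> g t = h t) ->
  ex_RInt_gen g (at_right 0) (Rbar_locally p_infty) ->
  half_line_int g = half_line_int h.
Proof.
  intros E [l H]. rewrite (half_line_int_unique g l H). symmetry.
  apply half_line_int_unique.
  apply (is_RInt_gen_ext g); [|exact H].
  apply (half_line_prod _ 1 1); [lra|]. simpl. intros a b Ha Hb t.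
  rewrite Rmin_left, Rmax_right by lra. intros Ht; apply E; lra.
Qed.

(** * The hypergeometric equation on the half-line *)

(** The hypergeometric equation in the variable [s = - z], with [A = a + b] and
    [B = a * b], so that conjugate parameters [a], [b] give a real equation. *)
Definition hyp_sol (A B c : R) (D : R -> Prop) (f f1 f2 : R -> R) : Prop :=
  forall s, D s ->
    is_derive f s (f1 s) /\ is_derive f1 s (f2 s) /\
    s * (1 + s) * f2 s + (c + (A + 1) * s) * f1 s + B * f s = 0.

(** The weight [s (1 + s)] is the leading coefficient of the equation, which allows [f'']
    to be eliminated from the derivative; the coefficient [1] of [f^2] keeps the form
    definite even when [B = 0]. *)
Definition energy (f f1 : R -> R) (s : R) : R := s * (1 + s) * (f1 s * f1 s) + f s * f s.

Lemma is_derive_energy A B c D f f1 f2 s :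
  hyp_sol A B c D f f1 f2 -> D s ->
  is_derive (energy f f1) s
    ((1 - 2 * c - 2 * A * s) * (f1 s * f1 s) + 2 * (1 - B) * (f s * f1 s)).
Proof.
  intros H Hs. destruct (H s Hs) as [H0 [H1 E]].
  unfold energy. evar_last.
  - apply (is_derive_plus (V := R_NormedModule)).
    + apply (is_derive_mult (fun s => s * (1 + s)) (fun s => f1 s * f1 s)).
      * auto_derive; [exact I|reflexivity].
      * apply (is_derive_mult f1 f1); [exact H1|exact H1|intros; apply Rmult_comm].
      * intros; apply Rmult_comm.
    + apply (is_derive_mult f f); [exact H0|exact H0|intros; apply Rmult_comm].
  - unfold plus, mult; simpl.
    replace (s * (1 + s) * (f2 s * f1 s + f1 s * f2 s))
      with (2 * f1 s * (s * (1 + s) * f2 s)) by ring.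
    replace (s * (1 + s) * f2 s) with (- (c + (A + 1) * s) * f1 s - B * f s) by lra.
    ring.
Qed.

(** The logarithmic derivative of the energy is [O(1 / s)], so the energy grows
    at most polynomially. *)
Lemma energy_growth A B c D f f1 f2 :
  hyp_sol A B c D f f1 f2 ->
  exists N : nat, forall a b, 0 < a <= b -> (forall s, a <= s <= b -> D s) ->
    energy f f1 b / b ^ N <= energy f f1 a / a ^ N.
Proof.
  intros H.
  destruct (INR_unbounded (Rabs (1 - 2 * c) + 2 * Rabs A + Rabs (1 - B))) as [N HN].
  exists N. intros a b Hab HD.
  assert (Hd : forall s, a <= s <= b -> is_derive (fun s => energy f f1 s / s ^ N) s
    ((((1 - 2 * c - 2 * A * s) * (f1 s * f1 s) + 2 * (1 - B) * (f s * f1 s)) * s ^ N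
      - energy f f1 s * (INR N * 1 * s ^ pred N)) / (s ^ N) ^ 2)).
  { intros s Hs. apply (is_derive_div (energy f f1) (fun s => s ^ N)).
    - eapply is_derive_energy; [exact H|now apply HD].
    - apply (is_derive_pow (fun s => s) N s 1). apply (is_derive_id (K := R_AbsRing)).
    - apply pow_nonzero. lra. }
  refine (derive_le0_ge _ _ a b (proj2 Hab) Hd _).
  intros s Hs. assert (Hs0 : 0 < s) by lra.
  apply Rmult_le_reg_r with ((s ^ N) ^ 2); [apply pow_lt, pow_lt, Hs0|].
  unfold Rdiv. rewrite Rmult_assoc, Rinv_l, Rmult_1_r, Rmult_0_l
    by (apply pow_nonzero, pow_nonzero; lra).
  set (X := _ + 2 * (1 - B) * _).
  assert (HX : X * s <= INR N * energy f f1 s).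
  { unfold X, energy. clear X Hd.
    generalize (f s) (f1 s); intros u v.
    assert (T1 : (1 - 2 * c - 2 * A * s) * s * (v * v) <=
        (Rabs (1 - 2 * c) + 2 * Rabs A) * (s * (1 + s) * (v * v))).
    { assert (0 <= v * v) by nra.
      assert ((1 - 2 * c) * s <= Rabs (1 - 2 * c) * (s * (1 + s))).
      { generalize (Rle_abs (1 - 2 * c)) (Rabs_pos (1 - 2 * c)); intros. nra. }
      assert (- A * (s * s) <= Rabs A * (s * (1 + s))).
      { generalize (Rle_abs (- A)) (Rabs_pos A); rewrite Rabs_Ropp; intros. nra. }
      nra. }
    assert (T2 : 2 * (1 - B) * (u * v) * s <= Rabs (1 - B) * (s * (1 + s) * (v * v) + u * u)).
    { apply Rle_trans with (Rabs (1 - B) * (2 * Rabs (u * (s * v)))).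
      - replace (2 * (1 - B) * (u * v) * s) with (2 * ((1 - B) * (u * (s * v)))) by ring.
        replace (Rabs (1 - B) * (2 * Rabs (u * (s * v))))
          with (2 * (Rabs (1 - B) * Rabs (u * (s * v)))) by ring.
        rewrite <- Rabs_mult.
        generalize (Rle_abs ((1 - B) * (u * (s * v)))). lra.
      - apply Rmult_le_compat_l; [apply Rabs_pos|].
        assert (0 <= s * (v * v)) by nra.
        generalize (pow2_ge_0 (u - s * v)) (pow2_ge_0 (u + s * v)); intros.
        unfold Rabs; destruct Rcase_abs; lra. }
    assert (0 <= s * (1 + s) * (v * v)) by (assert (0 <= v * v) by nra; apply Rmult_le_pos; nra).
    assert (0 <= u * u) by nra.
    assert (0 <= Rabs (1 - B)) by apply Rabs_pos.
    assert (0 <= Rabs (1 - 2 * c) + 2 * Rabs A)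
      by (generalize (Rabs_pos (1 - 2 * c)) (Rabs_pos A); lra).
    set (k1 := Rabs (1 - 2 * c) + 2 * Rabs A) in *. set (k2 := Rabs (1 - B)) in *.
    set (e1 := s * (1 + s) * (v * v)) in *. set (e2 := u * u) in *.
    apply Rle_trans with (k1 * e1 + k2 * (e1 + e2)); [lra|]. nra. }
  destruct N as [|N].
  - simpl in *. nra.
  - simpl pred. rewrite <- tech_pow_Rmult.
    assert (0 < s ^ N) by now apply pow_lt.
    replace (X * (s * s ^ N) - energy f f1 s * (INR (S N) * 1 * s ^ N))
      with (s ^ N * (X * s - INR (S N) * energy f f1 s)) by ring.
    nra.
Qed.

Lemma is_derive_scal_pow (k : R) (n : nat) (x : R) :
  is_derive (fun s => k * s ^ n) x (k * (INR n * x ^ pred n)).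
Proof.
  apply is_derive_scal. evar_last.
  - apply (is_derive_pow (fun s => s) n x 1). apply (is_derive_id (K := R_AbsRing)).
  - ring.
Qed.

(** By the equation [(s^c h')' = O (s^c h') + O (s^(c-1) h)].  If [h' = O (s^n)] and
    [h = O (s^(n+1))], then integrating this from [0] gains one power of [s]. *)
Lemma regular_flat A B c r h h1 h2 : 0 < c -> 0 < r <= 1 ->
  hyp_sol A B c (fun s => 0 <= s < r) h h1 h2 -> h 0 = 0 ->
  (exists M, forall s, 0 < s < r -> Rabs (h1 s) <= M) ->
  forall n : nat, exists M, forall s, 0 < s < r ->
    Rabs (h1 s) <= M * s ^ n /\ Rabs (h s) <= M * s ^ S n.
Proof.
  intros Hc Hr H H0 [M0 HM0].
  assert (Lh : filterlim h (at_right 0) (locally 0)).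
  { rewrite <- H0 at 2. eapply filterlim_filter_le_1; [apply filter_le_within|].
    apply (continuous_of_derive h 0 (h1 0)). apply H; lra. }
  assert (P0 : forall (p : R), 0 < p -> forall k : R,
      filterlim (fun s => k * Rpower s p) (at_right 0) (locally 0)).
  { intros p Hp k. replace (locally 0) with (locally (k * 0)) by (f_equal; ring).
    apply (filterlim_comp _ _ _ (fun s => Rpower s p) (fun y => k * y) _ (locally 0));
      [now apply filterlim_Rpower_0 | apply (filterlim_scal_r k 0)]. }
  assert (Step : forall (n : nat) M, (forall s, 0 < s < r -> Rabs (h1 s) <= M * s ^ n) ->
      forall s, 0 < s < r -> Rabs (h s) <= M * s ^ S n).
  { intros n M HM s Hs.
    assert (HM' : 0 <= M).
    { generalize (HM s Hs) (Rabs_pos (h1 s)) (pow_lt s n ltac:(lra)); intros. nra. }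
    assert (HSn : INR (S n) <> 0) by (apply not_0_INR; lia).
    apply Rle_trans with (M / INR (S n) * s ^ S n).
    - refine (abs_le_from_0 h h1 (fun s => M / INR (S n) * s ^ S n) (fun s => M * s ^ n) r
        _ _ HM Lh _ s Hs).
      + intros x Hx. apply H. lra.
      + intros x Hx. evar_last; [apply is_derive_scal_pow|]. simpl pred.
        now field.
      + eapply filterlim_filter_le_1; [apply filter_le_within|].
        assert (Z := continuous_of_derive _ _ _ (is_derive_scal_pow (M / INR (S n)) (S n) 0)).
        unfold continuous in Z. rewrite pow_i, Rmult_0_r in Z by lia. exact Z.
    - assert (1 <= INR (S n)) by (rewrite S_INR; generalize (pos_INR n); lra).
      apply Rmult_le_compat_r; [left; apply pow_lt; lra|].
      apply Rmult_le_reg_r with (INR (S n)); [lra|].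
      unfold Rdiv. rewrite Rmult_assoc, Rinv_l, Rmult_1_r by lra. nra. }
  induction n as [|n [M HM]].
  - exists M0. intros s Hs. split; [simpl; rewrite Rmult_1_r; now apply HM0|].
    apply Step; [|exact Hs]. intros. simpl; rewrite Rmult_1_r; now apply HM0.
  - set (K := Rabs (c - (A + 1)) + Rabs B).
    set (q := c + INR (S n)).
    assert (Hq : c < q).
    { unfold q; rewrite S_INR; generalize (pos_INR n); lra. }
    assert (X : forall s, 0 < s < r -> Rabs (Rpower s c * h1 s) <= K * M / q * Rpower s q).
    { refine (abs_le_from_0 (fun s => Rpower s c * h1 s)
        (fun s => Rpower s (c - 1) * (c * h1 s + s * h2 s))
        (fun s => K * M / q * Rpower s q) (fun s => K * M * Rpower s (q - 1)) r _ _ _ _ _).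
      - intros x Hx. evar_last.
        + apply (is_derive_mult (fun s => Rpower s c) h1).
          * apply is_derive_Rpower; lra.
          * apply H; lra.
          * intros; apply Rmult_comm.
        + unfold plus, mult; simpl. rewrite Rpower_minus1 by lra. field. lra.
      - intros x Hx. evar_last.
        + apply is_derive_scal. apply is_derive_Rpower; lra.
        + field. lra.
      - intros x Hx. destruct (H x ltac:(lra)) as [_ [_ E]].
        destruct (HM x Hx) as [I1 I2].
        assert (E2 : c * h1 x + x * h2 x = (x * ((c - (A + 1)) * h1 x) - B * h x) / (1 + x)).
        { apply Rmult_eq_reg_r with (1 + x); [|lra].
          replace ((x * ((c - (A + 1)) * h1 x) - B * h x) / (1 + x) * (1 + x))
            with (x * ((c - (A + 1)) * h1 x) - B * h x) by (field; lra).
          lra. }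
        rewrite E2, Rabs_mult, (Rabs_pos_eq (Rpower x (c - 1)))
          by (left; apply Rpower_pos).
        replace (q - 1) with ((c - 1) + INR (S n)) by (unfold q; ring).
        rewrite Rpower_plus, Rpower_pow by lra.
        replace (K * M * (Rpower x (c - 1) * x ^ S n))
          with (Rpower x (c - 1) * (K * (M * x ^ S n))) by ring.
        apply Rmult_le_compat_l; [left; apply Rpower_pos|].
        unfold Rdiv. rewrite Rabs_mult.
        rewrite (Rabs_pos_eq (/ (1 + x))) by (left; apply Rinv_0_lt_compat; lra).
        apply Rle_trans with (Rabs (x * ((c - (A + 1)) * h1 x) - B * h x) * 1).
        + apply Rmult_le_compat_l; [apply Rabs_pos|].
          rewrite <- Rinv_1. apply Rinv_le_contravar; lra.
        + rewrite Rmult_1_r. unfold Rminus at 1. eapply Rle_trans; [apply Rabs_triang|].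
          rewrite Rabs_Ropp, !Rabs_mult, (Rabs_pos_eq x) by lra. unfold K.
          rewrite Rmult_plus_distr_r. apply Rplus_le_compat.
          * rewrite <- tech_pow_Rmult.
            replace (x * (Rabs (c - (A + 1)) * Rabs (h1 x)))
              with (Rabs (c - (A + 1)) * (x * Rabs (h1 x))) by ring.
            replace (M * (x * x ^ n)) with (x * (M * x ^ n)) by ring.
            apply Rmult_le_compat_l; [apply Rabs_pos|].
            apply Rmult_le_compat_l; lra.
          * apply Rmult_le_compat_l; [apply Rabs_pos|exact I2].
      - intros P HP.
        assert (Z : filterlim (fun s => M0 * Rpower s c) (at_right 0) (locally 0)) by now apply P0.
        destruct HP as [e He].
        assert (Z1 : at_right 0 (fun s => ball 0 e (M0 * Rpower s c)))
          by exact (Z _ (ex_intro _ e (fun y Hy => Hy))).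
        assert (Z2 : at_right 0 (fun s => 0 < s < r)).
        { exists (mkposreal r (proj1 Hr)). intros t Ht Ht0.
          unfold ball in Ht; simpl in Ht; unfold AbsRing_ball, abs, minus, plus, opp in Ht;
          simpl in Ht. apply Rabs_def2 in Ht. lra. }
        refine (filter_imp _ _ _ (filter_and _ _ Z1 Z2)).
        intros s [S1 S2]. apply He.
        unfold ball in *; simpl in *; unfold AbsRing_ball, abs, minus, plus, opp in *; simpl in *.
        rewrite Ropp_0, Rplus_0_r in *.
        eapply Rle_lt_trans; [|exact S1].
        rewrite !Rabs_mult. rewrite (Rmult_comm (Rabs M0)).
        apply Rmult_le_compat_l; [apply Rabs_pos|].
        eapply Rle_trans; [apply HM0; exact S2|apply Rle_abs].
      - apply P0. lra. }
    assert (Y : forall s, 0 < s < r -> Rabs (h1 s) <= K * M / q * s ^ S n).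
    { intros s Hs. generalize (X s Hs). rewrite Rabs_mult.
      rewrite (Rabs_pos_eq (Rpower s c)) by (left; apply Rpower_pos).
      unfold q at 2. rewrite Rpower_plus, Rpower_pow by lra.
      intros Z. apply Rmult_le_reg_l with (Rpower s c); [apply Rpower_pos|]. lra. }
    exists (K * M / q). intros s Hs. split; [now apply Y|]. now apply Step.
Qed.

(** For some [N] the quotient [energy / s^N] is nonincreasing, while it tends to [0] at
    [0+] by flatness. *)
Lemma regular_unique A B c r h h1 h2 : 0 < c ->
  hyp_sol A B c (fun s => 0 <= s < r) h h1 h2 -> h 0 = 0 ->
  forall s, 0 <= s < r -> h s = 0.
Proof.
  intros Hc H H0 s Hs. destruct (Req_dec s 0) as [->|Hs0]; [exact H0|].
  set (r' := Rmin (s / 2) (1 / 2)).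
  assert (Hr' : 0 < r' <= 1 / 2 /\ r' < s).
  { unfold r', Rmin; destruct Rle_dec; lra. }
  assert (H' : hyp_sol A B c (fun s => 0 <= s < r') h h1 h2).
  { intros t Ht. apply H. lra. }
  destruct (bounded_continuity h1 0 r') as [M HM].
  { intros x Hx. apply (continuous_of_derive h1 x (h2 x)). apply H; lra. }
  destruct (energy_growth A B c _ h h1 h2 H) as [N HN].
  destruct (regular_flat A B c r' h h1 h2 Hc ltac:(lra) H' H0) with (n := S N) as [M' HM'].
  { exists M. intros t Ht. left. apply (HM t). lra. }
  assert (Hle : forall t, 0 < t < r' -> energy h h1 s / s ^ N <= 3 * M' ^ 2 * t).
  { intros t Ht. eapply Rle_trans; [apply (HN t s); [lra|intros; lra]|].
    destruct (HM' t Ht) as [I1 I2].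
    assert (Ht' : 0 < t ^ N) by (apply pow_lt; lra).
    apply Rmult_le_reg_r with (t ^ N); [exact Ht'|].
    unfold Rdiv. rewrite Rmult_assoc, Rinv_l, Rmult_1_r by lra.
    assert (HMp : 0 <= M').
    { generalize (Rabs_pos (h1 t)) (pow_lt t (S N) ltac:(lra)); intros; nra. }
    assert (Q1 : h1 t * h1 t <= (M' * t ^ S N) * (M' * t ^ S N)).
    { rewrite <- (Rabs_pos_eq (h1 t * h1 t)) by nra. rewrite Rabs_mult.
      generalize (Rabs_pos (h1 t)); intros. nra. }
    assert (Q2 : h t * h t <= (M' * t ^ S (S N)) * (M' * t ^ S (S N))).
    { rewrite <- (Rabs_pos_eq (h t * h t)) by nra. rewrite Rabs_mult.
      generalize (Rabs_pos (h t)); intros. nra. }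
    unfold energy.
    assert (Hp1 : t ^ N <= 1).
    { rewrite <- (pow1 N). apply pow_incr. lra. }
    simpl pow in Q1, Q2. set (p := t ^ N) in *.
    assert (U : 0 <= M' * M') by nra.
    assert (V : p * p <= p) by nra.
    assert (Q1' : h1 t * h1 t <= M' * M' * (t * t * p)).
    { eapply Rle_trans; [exact Q1|].
      replace (M' * (t * p) * (M' * (t * p))) with (M' * M' * (t * t * (p * p))) by ring.
      apply Rmult_le_compat_l; [exact U|]. apply Rmult_le_compat_l; nra. }
    assert (Q2' : h t * h t <= M' * M' * (t * p)).
    { eapply Rle_trans; [exact Q2|].
      replace (M' * (t * (t * p)) * (M' * (t * (t * p))))
        with (M' * M' * (t * (t * t * t * (p * p)))) by ring.
      apply Rmult_le_compat_l; [exact U|]. apply Rmult_le_compat_l; [lra|].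
      assert (t * t <= 1) by nra. assert (t * t * t <= 1) by nra.
      assert (0 <= t * t * t) by nra. nra. }
    assert (Q3 : t * (1 + t) * (h1 t * h1 t) <= 2 * (M' * M' * (t * p))).
    { apply Rle_trans with (2 * (h1 t * h1 t)); [nra|].
      apply Rmult_le_compat_l; [lra|]. eapply Rle_trans; [exact Q1'|].
      apply Rmult_le_compat_l; [exact U|]. apply Rmult_le_compat_r; nra. }
    simpl pow. rewrite Rmult_1_r. nra. }
  assert (Hz : energy h h1 s / s ^ N <= 0).
  { apply Rnot_lt_le. intros Hpos.
    set (e := energy h h1 s / s ^ N) in *.
    set (L := 3 * M' ^ 2) in *.
    assert (HL : 0 <= L) by (unfold L; nra).
    set (t := Rmin (r' / 2) (e / (2 * (L + 1)))).
    assert (0 < e / (2 * (L + 1))) by (apply Rdiv_lt_0_compat; lra).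
    assert (Ht : 0 < t < r') by (unfold t, Rmin; destruct Rle_dec; lra).
    assert (Ht2 : t <= e / (2 * (L + 1))) by apply Rmin_r.
    assert (I := Hle t Ht).
    assert (L * t <= (L + 1) * (e / (2 * (L + 1)))) by nra.
    replace ((L + 1) * (e / (2 * (L + 1)))) with (e / 2) in * by (field; lra).
    lra. }
  assert (Hsp : 0 < s ^ N) by (apply pow_lt; lra).
  assert (He : energy h h1 s <= 0).
  { apply Rmult_le_reg_r with (/ s ^ N); [now apply Rinv_0_lt_compat|]. lra. }
  unfold energy in He.
  assert (0 <= s * (1 + s) * (h1 s * h1 s)) by (apply Rmult_le_pos; nra).
  assert (h s * h s = 0) by (apply Rle_antisym; nra).
  nra.
Qed.

(** * Power series solutions *)

Definition converges_in_disk (e : nat -> R) : Prop :=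
  forall x, Rabs x < 1 -> Rbar_lt (Rabs x) (CV_radius e).

Lemma converges_in_disk_of_growth (e : nat -> R) :
  (forall rho, 1 < rho -> exists M, forall n, Rabs (e n) <= M * rho ^ n) ->
  converges_in_disk e.
Proof.
  intros H x Hx.
  set (r := (1 + Rabs x) / 2). assert (Hr : Rabs x < r < 1) by (unfold r; lra).
  assert (Hr0 : 0 < r) by (generalize (Rabs_pos x); lra).
  apply Rbar_lt_le_trans with r; [exact (proj1 Hr)|].
  apply (CV_radius_bounded e).
  destruct (H (/ r)) as [M HM].
  { rewrite <- Rinv_1. apply Rinv_lt_contravar; lra. }
  exists M. intros n. rewrite Rabs_mult, (Rabs_pos_eq (r ^ n)) by (left; now apply pow_lt).
  apply Rle_trans with (M * (/ r) ^ n * r ^ n).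
  - apply Rmult_le_compat_r; [left; now apply pow_lt|apply HM].
  - rewrite Rmult_assoc, <- Rpow_mult_distr, Rinv_l, pow1 by lra. lra.
Qed.

Lemma eventually_geometric (n0 : nat) : forall (v : nat -> R) (rho : R), 1 < rho ->
  (forall n, 0 <= v n) ->
  (forall n, (n0 <= n)%nat -> v (S n) <= rho * v n) ->
  exists M, forall n, v n <= M * rho ^ n.
Proof.
  induction n0 as [|n0 IH]; intros v rho Hr Hp Hv.
  - exists (v O). intros n. induction n as [|n IHn]; [simpl; lra|].
    rewrite <- tech_pow_Rmult.
    generalize (Hv n (le_0_n n)). nra.
  - destruct (IH (fun n => v (S n)) rho Hr) as [M HM].
    + intros; apply Hp.
    + intros n Hn. apply Hv. lia.
    + exists (Rmax (v O) M). intros [|n].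
      * simpl. rewrite Rmult_1_r. apply Rmax_l.
      * rewrite <- tech_pow_Rmult. generalize (HM n) (Hp (S n)) (Rmax_r (v O) M); intros.
        assert (0 < rho ^ n) by (apply pow_lt; lra).
        assert (0 <= M) by nra.
        apply Rle_trans with (Rmax (v O) M * rho ^ n); [nra|].
        assert (0 <= Rmax (v O) M * rho ^ n) by (apply Rmult_le_pos; lra). nra.
Qed.

Lemma PSeries_chain (e : nat -> R) (n : nat) (x : R) :
  converges_in_disk e -> Rabs x < 1 ->
  is_derive (PSeries (Nat.iter n PS_derive e)) x (PSeries (Nat.iter (S n) PS_derive e) x).
Proof.
  intros He Hx. apply (is_derive_PSeries (Nat.iter n PS_derive e)).
  replace (CV_radius (Nat.iter n PS_derive e)) with (CV_radius e); [now apply He|].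
  clear. induction n as [|n IH]; [reflexivity|].
  simpl. now rewrite CV_radius_derive.
Qed.

(** Covers both the Gauss series and the series in [s / (1 + s)] below. *)
Lemma PSeries_equation (p1 p2 p3 q0 q1 q2 r : R) (e : nat -> R) (x : R) :
  converges_in_disk e -> Rabs x < 1 ->
  (let e1 := PS_derive e in let e2 := PS_derive e1 in
   forall n, p1 * PS_incr_1 e2 n + p2 * PS_incr_1 (PS_incr_1 e2) n
     + p3 * PS_incr_1 (PS_incr_1 (PS_incr_1 e2)) n
     + q0 * e1 n + q1 * PS_incr_1 e1 n + q2 * PS_incr_1 (PS_incr_1 e1) n + r * e n = 0) ->
  let e1 := PS_derive e in let e2 := PS_derive e1 in
  (p1 * x + p2 * x ^ 2 + p3 * x ^ 3) * PSeries e2 x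
  + (q0 + q1 * x + q2 * x ^ 2) * PSeries e1 x + r * PSeries e x = 0.
Proof.
  intros He Hx Hn e1 e2.
  assert (S0 : is_pseries e x (PSeries e x)) by now apply PSeries_correct, CV_radius_inside, He.
  assert (S1 : is_pseries e1 x (PSeries e1 x)).
  { apply PSeries_correct, CV_radius_inside. unfold e1. rewrite CV_radius_derive. now apply He. }
  assert (S2 : is_pseries e2 x (PSeries e2 x)).
  { apply PSeries_correct, CV_radius_inside. unfold e2, e1. rewrite !CV_radius_derive.
    now apply He. }
  assert (Sc : forall (k : R) a l, is_pseries a x l -> is_pseries (fun n => k * a n) x (k * l)).
  { intros k a l Ha. apply (is_pseries_scal (V := R_NormedModule) k a x l); [apply Rmult_comm|exact Ha]. }
  assert (Pl : forall a b l m, is_pseries a x l -> is_pseries b x m ->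
     is_pseries (fun n => a n + b n) x (l + m)).
  { intros a b l m Ha Hb. now apply (is_pseries_plus (V := R_NormedModule) a b x l m). }
  assert (In : forall a l, is_pseries a x l -> is_pseries (PS_incr_1 a) x (x * l)).
  { intros a l Ha. now apply (is_pseries_incr_1 (V := R_NormedModule) a x l). }
  assert (Z : is_pseries (fun _ : nat => 0) x
     (p1 * (x * PSeries e2 x) + p2 * (x * (x * PSeries e2 x)) + p3 * (x * (x * (x * PSeries e2 x)))
      + q0 * PSeries e1 x + q1 * (x * PSeries e1 x) + q2 * (x * (x * PSeries e1 x))
      + r * PSeries e x)).
  { eapply is_pseries_ext; [exact Hn|].
    repeat apply Pl; apply Sc; repeat apply In; assumption. }
  apply is_pseries_unique in Z. rewrite PSeries_const_0 in Z.
  eapply eq_trans; [|symmetry; exact Z]. ring.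
Qed.

Section Coefficients.

Variables A B c : R.
Hypothesis Hc : 0 < c.

(** The Gauss series in the variable [s = - z]; as
    [(a + n) (b + n) = n^2 + A n + B], it only depends on [A], [B] and [c]. *)
Fixpoint gauss_coeff (n : nat) : R :=
  match n with
  | O => 1
  | S m => gauss_coeff m *
      (- (INR m * INR m + A * INR m + B) / ((INR m + 1) * (INR m + c)))
  end.

Lemma gauss_coeff_converges : converges_in_disk gauss_coeff.
Proof.
  apply converges_in_disk_of_growth. intros rho Hrho.
  destruct (INR_unbounded ((Rabs A + Rabs B) / (rho - 1))) as [n0 Hn0].
  apply (eventually_geometric (S n0) (fun n => Rabs (gauss_coeff n)) rho Hrho).
  - intros; apply Rabs_pos.
  - intros n Hn. simpl. rewrite Rabs_mult, Rmult_comm.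
    apply Rmult_le_compat_r; [apply Rabs_pos|].
    assert (Hn1 : INR n0 + 1 <= INR n) by (rewrite <- S_INR; now apply le_INR).
    set (x := INR n) in *. assert (Hx0 : 0 <= INR n0) by apply pos_INR.
    assert (Hd : 0 < (x + 1) * (x + c)) by (apply Rmult_lt_0_compat; lra).
    unfold Rdiv. rewrite Rabs_mult, Rabs_Ropp, (Rabs_pos_eq (/ _))
      by (left; now apply Rinv_0_lt_compat).
    apply Rmult_le_reg_r with ((x + 1) * (x + c)); [exact Hd|].
    rewrite Rmult_assoc, Rinv_l, Rmult_1_r by lra.
    assert (H1 : Rabs A + Rabs B <= (rho - 1) * x).
    { replace (Rabs A + Rabs B) with ((rho - 1) * ((Rabs A + Rabs B) / (rho - 1))) by (field; lra).
      apply Rmult_le_compat_l; lra. }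
    assert (H2 : Rabs (x * x + A * x + B) <= x * x + Rabs A * x + Rabs B).
    { eapply Rle_trans; [apply Rabs_triang|]. apply Rplus_le_compat_r.
      eapply Rle_trans; [apply Rabs_triang|]. rewrite !Rabs_mult, (Rabs_pos_eq x) by lra. lra. }
    generalize (Rabs_pos A) (Rabs_pos B); intros.
    apply Rle_trans with (rho * (x * x)); [|apply Rmult_le_compat_l; nra].
    eapply Rle_trans; [exact H2|]. nra.
Qed.

Definition gauss_series (n : nat) : R -> R := PSeries (Nat.iter n PS_derive gauss_coeff).

Lemma gauss_series_sol :
  hyp_sol A B c (fun s => Rabs s < 1) (gauss_series 0) (gauss_series 1) (gauss_series 2).
Proof.
  intros s Hs.
  split; [apply (PSeries_chain gauss_coeff 0 s gauss_coeff_converges Hs)|].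
  split; [apply (PSeries_chain gauss_coeff 1 s gauss_coeff_converges Hs)|].
  rewrite <- (PSeries_equation 1 1 0 c (A + 1) 0 B gauss_coeff s gauss_coeff_converges Hs).
  - unfold gauss_series. simpl. ring.
  - intros e1 e2 n. unfold e2, e1, PS_derive.
    destruct n as [|[|n]]; cbn [PS_incr_1].
    + simpl. unfold zero; simpl. field. lra.
    + unfold zero; simpl. field. lra.
    + cbn [gauss_coeff]. rewrite !S_INR. generalize (pos_INR n); intros Hn.
      unfold zero; simpl. destruct n; field; lra.
Qed.

(** The same solution expanded in [w = s / (1 + s)], which maps the half-line onto
    [(0, 1)].  The coefficients [e_n] obey a three-term recurrence with double
    characteristic root [1], written here for the pair [(e_n, e_(n+1) - e_n)]. *)
Fixpoint pfaff_pair (n : nat) : R * R :=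
  match n with
  | O => (1, - B / c - 1)
  | S m => let (e, d) := pfaff_pair m in
      (e + d, (INR m * (INR m - A + c) * d - (A + 1 + B) * (e + d))
              / ((INR m + 2) * (INR m + 1 + c)))
  end.

Definition pfaff_coeff (n : nat) : R := fst (pfaff_pair n).

(** In the norm [|e| + |d| / eta] one step of the recurrence multiplies by at most
    [1 + 3 eta], as soon as [n] is large. *)
Lemma pfaff_coeff_converges : converges_in_disk pfaff_coeff.
Proof.
  apply converges_in_disk_of_growth. intros rho Hrho.
  set (eta := Rmin 1 ((rho - 1) / 3)).
  assert (He : 0 < eta <= 1 /\ 1 + 3 * eta <= rho).
  { unfold eta, Rmin; destruct Rle_dec; lra. }
  destruct He as [He He2].
  destruct (INR_unbounded ((Rabs A + c) / eta + Rabs (A + 1 + B) / (eta * eta))) as [n0 Hn0].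
  set (v := fun n => Rabs (fst (pfaff_pair n)) + Rabs (snd (pfaff_pair n)) / eta).
  destruct (eventually_geometric (S n0) v rho Hrho) as [M HM].
  - intros n. unfold v. apply Rplus_le_le_0_compat; [apply Rabs_pos|].
    apply Rmult_le_pos; [apply Rabs_pos|left; apply Rinv_0_lt_compat; lra].
  - intros n Hn. unfold v. simpl. destruct (pfaff_pair n) as [e d]; simpl.
    assert (Hn1 : INR n0 + 1 <= INR n) by (rewrite <- S_INR; now apply le_INR).
    set (x := INR n) in *. assert (Hx0 : 0 <= INR n0) by apply pos_INR.
    assert (Hd : 0 < (x + 2) * (x + 1 + c)) by (apply Rmult_lt_0_compat; lra).
    assert (P1 : 0 <= (Rabs A + c) / eta).
    { apply Rmult_le_pos; [generalize (Rabs_pos A); lra|left; apply Rinv_0_lt_compat; lra]. }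
    assert (P2 : 0 <= Rabs (A + 1 + B) / (eta * eta)).
    { apply Rmult_le_pos; [apply Rabs_pos|left; apply Rinv_0_lt_compat; nra]. }
    assert (H1 : Rabs A + c <= eta * x).
    { replace (Rabs A + c) with (eta * ((Rabs A + c) / eta)) by (field; lra).
      apply Rmult_le_compat_l; lra. }
    assert (H2 : Rabs (A + 1 + B) <= eta * eta * x).
    { replace (Rabs (A + 1 + B)) with (eta * eta * (Rabs (A + 1 + B) / (eta * eta))) by (field; lra).
      apply Rmult_le_compat_l; nra. }
    assert (K1 : Rabs (x * (x - A + c)) <= (1 + eta) * (x * x)).
    { rewrite Rabs_mult, (Rabs_pos_eq x) by lra.
      replace ((1 + eta) * (x * x)) with (x * (x + eta * x)) by ring.
      apply Rmult_le_compat_l; [lra|].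
      apply Rabs_le. generalize (Rle_abs A) (Rle_abs (- A)). rewrite Rabs_Ropp. intros; lra. }
    assert (K2 : Rabs ((x * (x - A + c) * d - (A + 1 + B) * (e + d)) / ((x + 2) * (x + 1 + c)))
        <= (1 + eta) * Rabs d + eta * eta * (Rabs e + Rabs d)).
    { unfold Rdiv. rewrite Rabs_mult, (Rabs_pos_eq (/ _))
        by (left; now apply Rinv_0_lt_compat).
      apply Rmult_le_reg_r with ((x + 2) * (x + 1 + c)); [exact Hd|].
      rewrite Rmult_assoc, Rinv_l, Rmult_1_r by lra.
      unfold Rminus at 1. eapply Rle_trans; [apply Rabs_triang|].
      rewrite Rabs_Ropp, !(Rabs_mult _ d), (Rabs_mult _ (e + d)).
      generalize (Rabs_triang e d) (Rabs_pos d) (Rabs_pos e) (Rabs_pos (e + d)); intros.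
      assert (x * x <= (x + 2) * (x + 1 + c)) by nra.
      assert (x <= (x + 2) * (x + 1 + c)) by nra.
      set (R0 := (x + 2) * (x + 1 + c)) in *.
      rewrite Rmult_plus_distr_r. apply Rplus_le_compat.
      - replace ((1 + eta) * Rabs d * R0) with ((1 + eta) * R0 * Rabs d) by ring.
        apply Rmult_le_compat_r; [lra|]. eapply Rle_trans; [exact K1|].
        apply Rmult_le_compat_l; lra.
      - replace (eta * eta * (Rabs e + Rabs d) * R0) with ((eta * eta * R0) * (Rabs e + Rabs d)) by ring.
        apply Rmult_le_compat; [apply Rabs_pos|lra| |lra].
        eapply Rle_trans; [exact H2|]. apply Rmult_le_compat_l; [nra|assumption]. }
    set (Y := Rabs ((x * (x - A + c) * d - _) / _)) in *.
    assert (K3 : Y / eta <= ((1 + eta) * Rabs d + eta * eta * (Rabs e + Rabs d)) / eta).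
    { apply Rmult_le_compat_r; [left; apply Rinv_0_lt_compat; lra|exact K2]. }
    replace (((1 + eta) * Rabs d + eta * eta * (Rabs e + Rabs d)) / eta)
      with ((1 + eta) * (Rabs d / eta) + eta * Rabs e + eta * (eta * (Rabs d / eta))) in K3
      by (field; lra).
    generalize (Rabs_triang e d); intros K4.
    replace (Rabs d) with (eta * (Rabs d / eta)) in K4 by (field; lra).
    assert (0 <= Rabs d / eta).
    { apply Rmult_le_pos; [apply Rabs_pos|left; apply Rinv_0_lt_compat; lra]. }
    generalize (Rabs_pos e); intros.
    set (u := Rabs d / eta) in *. set (z := Rabs e) in *.
    clearbody u z Y. clear K1 K2 P1 P2 H1 H2 Hn0 Hd.
    assert (0 <= eta * u) by (apply Rmult_le_pos; lra).
    assert (0 <= eta * z) by (apply Rmult_le_pos; lra).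
    assert (eta * (eta * u) <= eta * u) by nra.
    assert ((1 + 3 * eta) * (z + u) <= rho * (z + u)) by (apply Rmult_le_compat_r; lra).
    lra.
  - exists M. intros n. eapply Rle_trans; [|apply HM].
    unfold pfaff_coeff, v.
    assert (0 <= Rabs (snd (pfaff_pair n)) / eta).
    { apply Rmult_le_pos; [apply Rabs_pos|left; apply Rinv_0_lt_compat; lra]. }
    lra.
Qed.

Definition pfaff_series (n : nat) : R -> R := PSeries (Nat.iter n PS_derive pfaff_coeff).

Lemma pfaff_series_equation (w : R) : Rabs w < 1 ->
  w * (1 - w) ^ 2 * pfaff_series 2 w
  + (1 - w) * (c + (A - 1 - c) * w) * pfaff_series 1 w + B * pfaff_series 0 w = 0.
Proof.
  intros Hw.
  rewrite <- (PSeries_equation 1 (-2) 1 c (A - 1 - 2 * c) (- (A - 1 - c)) B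
                pfaff_coeff w pfaff_coeff_converges Hw).
  - unfold pfaff_series. simpl. ring.
  - assert (Hrec : forall n, (INR n + 2) * (INR n + 1 + c) * (pfaff_coeff (S (S n)) - pfaff_coeff (S n))
      = INR n * (INR n - A + c) * (pfaff_coeff (S n) - pfaff_coeff n)
        - (A + 1 + B) * pfaff_coeff (S n)).
    { intros n. unfold pfaff_coeff. simpl. destruct (pfaff_pair n) as [e d]; simpl.
      field. generalize (pos_INR n); lra. }
    intros e1 e2 n. unfold e2, e1, PS_derive.
    destruct n as [|[|n]]; cbn [PS_incr_1].
    + unfold pfaff_coeff; simpl. unfold zero; simpl. field. lra.
    + generalize (Hrec O). unfold zero; simpl INR.
      generalize (pfaff_coeff 0) (pfaff_coeff 1) (pfaff_coeff 2). intros r0 r1 r2 E; simpl.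
      eapply eq_trans; [|exact (Rminus_diag_eq _ _ E)]. ring.
    + generalize (Hrec (S n)). rewrite !S_INR.
      destruct n as [|n].
      * simpl INR; simpl; unfold zero; simpl.
        generalize (pfaff_coeff 1) (pfaff_coeff 2) (pfaff_coeff 3). intros r0 r1 r2 E.
        eapply eq_trans; [|exact (Rminus_diag_eq _ _ E)]. ring.
      * rewrite !S_INR. cbn [PS_incr_1]. rewrite ?S_INR.
        generalize (pfaff_coeff (S (S n))) (pfaff_coeff (S (S (S n)))) (pfaff_coeff (S (S (S (S n))))).
        intros r0 r1 r2 E.
        eapply eq_trans; [|exact (Rminus_diag_eq _ _ E)]. ring.
Qed.

Definition moebius (s : R) : R := s / (1 + s).

Lemma moebius_disk (s : R) : - (1 / 2) < s -> Rabs (moebius s) < 1.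
Proof.
  intros Hs. unfold moebius. apply Rabs_def1.
  - apply Rmult_lt_reg_r with (1 + s); [lra|]. unfold Rdiv.
    rewrite Rmult_assoc, Rinv_l; lra.
  - apply Rmult_lt_reg_r with (1 + s); [lra|]. unfold Rdiv.
    rewrite Rmult_assoc, Rinv_l; lra.
Qed.

Lemma pfaff_sol :
  hyp_sol A B c (fun s => - (1 / 2) < s)
    (fun s => pfaff_series 0 (moebius s))
    (fun s => pfaff_series 1 (moebius s) / (1 + s) ^ 2)
    (fun s => pfaff_series 2 (moebius s) / (1 + s) ^ 4
              - 2 * pfaff_series 1 (moebius s) / (1 + s) ^ 3).
Proof.
  intros s Hs.
  assert (Hw := moebius_disk s Hs).
  assert (Hm : is_derive moebius s (1 / (1 + s) ^ 2)).
  { unfold moebius. auto_derive; [lra|]. field. lra. }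
  assert (Hcomp : forall n, is_derive (fun s => pfaff_series n (moebius s)) s
      (pfaff_series (S n) (moebius s) / (1 + s) ^ 2)).
  { intros n. evar_last.
    - apply (is_derive_comp (pfaff_series n) moebius s); [|exact Hm].
      apply (PSeries_chain pfaff_coeff n _ pfaff_coeff_converges Hw).
    - unfold scal; simpl; unfold mult; simpl. unfold pfaff_series. simpl. field. lra. }
  split; [apply Hcomp|]. split.
  - evar_last.
    + apply (is_derive_div (fun s => pfaff_series 1 (moebius s)) (fun s => (1 + s) ^ 2)).
      * apply Hcomp.
      * auto_derive; [exact I|reflexivity].
      * apply pow_nonzero. lra.
    + field. lra.
  - generalize (pfaff_series_equation (moebius s) Hw).
    generalize (pfaff_series 0 (moebius s)) (pfaff_series 1 (moebius s))
               (pfaff_series 2 (moebius s)).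
    unfold moebius. intros u0 u1 u2 E. rewrite <- E at 1. field. lra.
Qed.

(** Both sides are regular at [0] and take the value [1] there. *)
Lemma gauss_pfaff_agree (s : R) : 0 <= s < 1 ->
  gauss_series 0 s = pfaff_series 0 (moebius s).
Proof.
  intros Hs. apply Rminus_diag_uniq.
  refine (regular_unique A B c 1
    (fun s => gauss_series 0 s - pfaff_series 0 (moebius s))
    (fun s => gauss_series 1 s - pfaff_series 1 (moebius s) / (1 + s) ^ 2)
    (fun s => gauss_series 2 s - (pfaff_series 2 (moebius s) / (1 + s) ^ 4
              - 2 * pfaff_series 1 (moebius s) / (1 + s) ^ 3)) Hc _ _ s Hs).
  - intros t Ht.
    destruct (gauss_series_sol t) as [G0 [G1 GE]]; [rewrite Rabs_pos_eq; lra|].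
    destruct (pfaff_sol t) as [F0 [F1 FE]]; [lra|].
    split; [now apply (is_derive_minus (V := R_NormedModule))|].
    split; [now apply (is_derive_minus (V := R_NormedModule))|].
    lra.
  - unfold gauss_series, pfaff_series, moebius. simpl.
    replace (0 / (1 + 0)) with 0 by field.
    rewrite !PSeries_0. unfold pfaff_coeff. simpl. ring.
Qed.

End Coefficients.

(** * Derivatives of all orders and analyticity *)

Lemma locally_of_interval (a b x : R) (P : R -> Prop) :
  a < x < b -> (forall t, a < t < b -> P t) -> locally x P.
Proof.
  intros Hx H. apply (locally_interval P x a b); simpl; [lra|lra|].
  intros y H1 H2. apply H. simpl in *. lra.
Qed.

Section HypFun.

Variables A B c : R.
Hypothesis Hc : 0 < c.

(** Solving the [n]-fold differentiated equation for its highest order term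
    gives all derivatives of a solution, two at a time. *)
Fixpoint ode_pair (f f1 : R -> R) (n : nat) (s : R) : R * R :=
  match n with
  | O => (f s, f1 s)
  | S m => let (u, v) := ode_pair f f1 m s in
      (v, - ((INR m * (1 + 2 * s) + c + (A + 1) * s) * v
             + (INR m * INR m + A * INR m + B) * u) / (s * (1 + s)))
  end.

Definition ode_deriv (f f1 : R -> R) (n : nat) (s : R) : R := fst (ode_pair f f1 n s).

Lemma ode_deriv_SS f f1 n s :
  ode_deriv f f1 (S (S n)) s =
  - ((INR n * (1 + 2 * s) + c + (A + 1) * s) * ode_deriv f f1 (S n) s
             + (INR n * INR n + A * INR n + B) * ode_deriv f f1 n s) / (s * (1 + s)).
Proof. unfold ode_deriv. simpl. now destruct (ode_pair f f1 n s). Qed.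

Lemma ode_deriv_2 D f f1 f2 s : hyp_sol A B c D f f1 f2 -> D s -> s * (1 + s) <> 0 ->
  ode_deriv f f1 2 s = f2 s.
Proof.
  intros H Hs Hn. destruct (H s Hs) as [_ [_ E]].
  unfold ode_deriv. simpl.
  apply Rmult_eq_reg_r with (s * (1 + s)); [|exact Hn].
  unfold Rdiv. rewrite Rmult_assoc, Rinv_l by exact Hn. lra.
Qed.

Lemma ode_deriv_chain D f f1 f2 : hyp_sol A B c D f f1 f2 ->
  (forall s, D s -> s * (1 + s) <> 0) ->
  forall n s, D s -> is_derive (ode_deriv f f1 n) s (ode_deriv f f1 (S n) s).
Proof.
  intros H HD n s Hs. assert (Hn := HD s Hs).
  assert (X : is_derive (ode_deriv f f1 n) s (ode_deriv f f1 (S n) s) /\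
      is_derive (ode_deriv f f1 (S n)) s (ode_deriv f f1 (S (S n)) s)); [|apply X].
  induction n as [|n [IH1 IH2]].
  - split; [now apply H|]. rewrite (ode_deriv_2 D f f1 f2 s H Hs Hn). now apply H.
  - split; [exact IH2|].
    eapply is_derive_ext; [intros t; symmetry; apply ode_deriv_SS|].
    evar_last.
    + apply (is_derive_div
        (fun s => - ((INR n * (1 + 2 * s) + c + (A + 1) * s) * ode_deriv f f1 (S n) s
             + (INR n * INR n + A * INR n + B) * ode_deriv f f1 n s))
        (fun s => s * (1 + s))); [| |exact Hn].
      * apply (is_derive_opp (V := R_NormedModule)), (is_derive_plus (V := R_NormedModule)).
        -- apply (is_derive_mult (fun s => INR n * (1 + 2 * s) + c + (A + 1) * s)
              (ode_deriv f f1 (S n))); [|exact IH2|intros; apply Rmult_comm].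
           auto_derive; [exact I|reflexivity].
        -- apply is_derive_scal. exact IH1.
      * auto_derive; [exact I|reflexivity].
    + unfold opp, plus, mult; simpl.
      rewrite (ode_deriv_SS f f1 (S n)).
      assert (E := ode_deriv_SS f f1 n s).
      assert (E' : (INR n * INR n + A * INR n + B) * ode_deriv f f1 n s =
         - (s * (1 + s)) * ode_deriv f f1 (S (S n)) s
         - (INR n * (1 + 2 * s) + c + (A + 1) * s) * ode_deriv f f1 (S n) s).
      { rewrite E. field. split; intros Z; apply Hn; rewrite Z; ring. }
      rewrite E'. clear E E'. rewrite S_INR. field.
      split; intros Z; apply Hn; rewrite Z; ring.
Qed.

Definition pfaff0 (s : R) : R := pfaff_series A B c 0 (moebius s).
Definition pfaff1 (s : R) : R := pfaff_series A B c 1 (moebius s) / (1 + s) ^ 2.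

(** [hyp_fun 0 s] is the hypergeometric function at [- s], and [hyp_fun n] is its [n]-th
    derivative.  Any threshold inside [(0, 1)], where the two branches agree, would do. *)
Definition hyp_fun (n : nat) (s : R) : R :=
  if Rlt_dec s (1 / 2) then gauss_series A B c n s else ode_deriv pfaff0 pfaff1 n s.

Lemma pfaff_chain n s : 0 < s ->
  is_derive (ode_deriv pfaff0 pfaff1 n) s (ode_deriv pfaff0 pfaff1 (S n) s).
Proof.
  intros Hs.
  refine (ode_deriv_chain (fun s => 0 < s) _ _ _ _ _ n s Hs).
  - intros t Ht. apply (pfaff_sol A B c Hc t). lra.
  - intros t Ht. apply Rmult_integral_contrapositive; lra.
Qed.

Lemma gauss_pfaff_deriv_agree n s : 0 < s < 1 ->
  gauss_series A B c n s = ode_deriv pfaff0 pfaff1 n s.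
Proof.
  revert s; induction n as [|n IH]; intros s Hs.
  - apply (gauss_pfaff_agree A B c Hc). lra.
  - assert (D1 : is_derive (gauss_series A B c n) s (gauss_series A B c (S n) s)).
    { apply PSeries_chain; [now apply gauss_coeff_converges|]. rewrite Rabs_pos_eq; lra. }
    assert (D2 : is_derive (gauss_series A B c n) s (ode_deriv pfaff0 pfaff1 (S n) s)).
    { apply (is_derive_ext_loc (ode_deriv pfaff0 pfaff1 n)).
      - apply (locally_of_interval 0 1); [lra|]. intros t Ht. symmetry. now apply IH.
      - apply pfaff_chain; lra. }
    apply is_derive_unique in D1. apply is_derive_unique in D2. congruence.
Qed.

Lemma hyp_fun_gauss n s : -1 < s < 1 -> hyp_fun n s = gauss_series A B c n s.
Proof.
  intros Hs. unfold hyp_fun. destruct Rlt_dec; [reflexivity|].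
  symmetry. apply gauss_pfaff_deriv_agree. lra.
Qed.

Lemma hyp_fun_pfaff n s : 0 < s -> hyp_fun n s = ode_deriv pfaff0 pfaff1 n s.
Proof.
  intros Hs. unfold hyp_fun. destruct Rlt_dec; [|reflexivity].
  apply gauss_pfaff_deriv_agree. lra.
Qed.

Lemma hyp_fun_0 : hyp_fun 0 0 = 1.
Proof.
  rewrite hyp_fun_gauss by lra. unfold gauss_series. simpl. rewrite PSeries_0. reflexivity.
Qed.

Lemma hyp_fun_chain n s : -1 < s -> is_derive (hyp_fun n) s (hyp_fun (S n) s).
Proof.
  intros Hs. destruct (Rlt_dec s (1 / 2)) as [H|H].
  - rewrite hyp_fun_gauss by lra.
    apply (is_derive_ext_loc (gauss_series A B c n)).
    + apply (locally_of_interval (-1) 1); [lra|]. intros t Ht. now rewrite hyp_fun_gauss.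
    + apply PSeries_chain; [now apply gauss_coeff_converges|]. apply Rabs_def1; lra.
  - rewrite hyp_fun_pfaff by lra.
    apply (is_derive_ext_loc (ode_deriv pfaff0 pfaff1 n)).
    + apply (locally_of_interval 0 (s + 1)); [lra|]. intros t Ht. rewrite hyp_fun_pfaff; lra.
    + apply pfaff_chain. lra.
Qed.

(** Each identity is the derivative of the previous one. *)
Lemma hyp_fun_equation n s : -1 < s ->
  s * (1 + s) * hyp_fun (S (S n)) s
  + (INR n * (1 + 2 * s) + c + (A + 1) * s) * hyp_fun (S n) s
  + (INR n * INR n + A * INR n + B) * hyp_fun n s = 0.
Proof.
  revert s; induction n as [|n IH]; intros s Hs.
  - simpl INR. destruct (Rlt_dec s (1 / 2)) as [H|H].
    + rewrite !hyp_fun_gauss by lra.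
      destruct (gauss_series_sol A B c Hc s) as [_ [_ E]]; [apply Rabs_def1; lra|].
      eapply eq_trans; [|exact E]. ring.
    + rewrite !hyp_fun_pfaff by lra. rewrite ode_deriv_SS. simpl INR. field. lra.
  - assert (D1 : is_derive (fun s => s * (1 + s) * hyp_fun (S (S n)) s
        + (INR n * (1 + 2 * s) + c + (A + 1) * s) * hyp_fun (S n) s
        + (INR n * INR n + A * INR n + B) * hyp_fun n s) s 0).
    { apply (is_derive_ext_loc (fun _ => 0)).
      - apply (locally_of_interval (-1) (s + 1)); [lra|]. intros t Ht. symmetry. apply IH. lra.
      - apply (is_derive_const (K := R_AbsRing) (V := R_NormedModule)). }
    eapply eq_trans; [|exact (is_derive_unique _ _ _ D1)].
    symmetry. apply is_derive_unique. evar_last.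
    + apply (is_derive_plus (V := R_NormedModule)); [apply (is_derive_plus (V := R_NormedModule))|].
      * apply (is_derive_mult (fun s => s * (1 + s)) (hyp_fun (S (S n))));
          [|now apply hyp_fun_chain|intros; apply Rmult_comm].
        auto_derive; [exact I|reflexivity].
      * apply (is_derive_mult (fun s => INR n * (1 + 2 * s) + c + (A + 1) * s) (hyp_fun (S n)));
          [|now apply hyp_fun_chain|intros; apply Rmult_comm].
        auto_derive; [exact I|reflexivity].
      * apply is_derive_scal. now apply hyp_fun_chain.
    + rewrite S_INR. unfold plus, mult; simpl. ring.
Qed.

Lemma hyp_fun_sol : hyp_sol A B c (fun s => -1 < s) (hyp_fun 0) (hyp_fun 1) (hyp_fun 2).
Proof.
  intros s Hs. split; [now apply hyp_fun_chain|]. split; [now apply hyp_fun_chain|].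
  eapply eq_trans; [|exact (hyp_fun_equation 0 s Hs)]. simpl INR. ring.
Qed.

(** The equation of order [n] bounds [|F_(n+2)| / (n+2)!] by a constant multiple of the
    two previous quotients; the points [s0 = 0] and [s0 = -1], where its leading
    coefficient vanishes, are excluded. *)
Lemma hyp_fun_factorial_bound s0 : -1 < s0 -> s0 <> 0 ->
  exists delta K M, 0 < delta /\ 0 < K /\ 0 <= M /\ delta < 1 + s0 /\
    forall n s, Rabs (s - s0) <= delta -> Rabs (hyp_fun n s) <= M * INR (fact n) * K ^ n.
Proof.
  intros Hs0 Hn0.
  set (delta := Rmin (Rabs s0) (1 + s0) / 2).
  assert (Hd : 0 < delta /\ delta <= Rabs s0 / 2 /\ delta <= (1 + s0) / 2).
  { assert (0 < Rabs s0) by now apply Rabs_pos_lt.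
    unfold delta, Rmin; destruct Rle_dec; lra. }
  set (m := (Rabs s0 / 2) * ((1 + s0) / 2)).
  assert (Hm : 0 < m).
  { unfold m. apply Rmult_lt_0_compat; [|lra].
    assert (0 < Rabs s0) by now apply Rabs_pos_lt. lra. }
  set (S0 := Rabs s0 + delta).
  assert (HS : forall s, Rabs (s - s0) <= delta ->
     -1 < s /\ m <= Rabs (s * (1 + s)) /\ Rabs s <= S0).
  { intros s Hs.
    assert (Hs1 : (1 + s0) / 2 <= 1 + s).
    { apply Rabs_le_between in Hs. lra. }
    split; [lra|]. split.
    - rewrite Rabs_mult, (Rabs_pos_eq (1 + s)) by lra.
      unfold m. apply Rmult_le_compat; [generalize (Rabs_pos s0); lra|lra| |exact Hs1].
      generalize (Rabs_triang_inv s0 (s0 - s)). replace (s0 - (s0 - s)) with s by ring.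
      rewrite (Rabs_minus_sym s0 s). lra.
    - unfold S0. generalize (Rabs_triang s0 (s - s0)). replace (s0 + (s - s0)) with s by ring. lra. }
  assert (Hcont : forall n, exists M, forall s, Rabs (s - s0) <= delta -> Rabs (hyp_fun n s) <= M).
  { intros n. destruct (bounded_continuity (hyp_fun n) (s0 - delta) (s0 + delta)) as [M HM].
    - intros x Hx. apply (continuous_of_derive _ x (hyp_fun (S n) x)).
      apply hyp_fun_chain. lra.
    - exists M. intros s Hs. left. apply (HM s). apply Rabs_le_between in Hs. lra. }
  destruct (Hcont O) as [M0 HM0]. destruct (Hcont 1%nat) as [M1 HM1].
  assert (HM0p : 0 <= M0).
  { eapply Rle_trans; [apply Rabs_pos|apply (HM0 s0)]. rewrite Rminus_diag, Rabs_R0; lra. }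
  assert (HM1p : 0 <= M1).
  { eapply Rle_trans; [apply Rabs_pos|apply (HM1 s0)]. rewrite Rminus_diag, Rabs_R0; lra. }
  set (C1 := 1 + 2 * S0 + c + (Rabs A + 1) * S0).
  set (C2 := 1 + Rabs A + Rabs B).
  (* this [K] satisfies [C (K + 1) <= K^2] *)
  set (C := (C1 + C2) / m). set (K := 1 + 2 * C). set (M := M0 + M1).
  assert (HS0 : 0 <= S0) by (unfold S0; generalize (Rabs_pos s0); lra).
  assert (HC1 : 0 <= C1) by (unfold C1; generalize (Rabs_pos A); nra).
  assert (HC2 : 0 <= C2) by (unfold C2; generalize (Rabs_pos A) (Rabs_pos B); lra).
  assert (HC : 0 <= C) by (unfold C; apply Rmult_le_pos; [lra|left; now apply Rinv_0_lt_compat]).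
  exists delta, K, M. split; [apply Hd|]. split; [unfold K; lra|]. split; [unfold M; lra|].
  split; [lra|]. intros n s Hs.
  destruct (HS s Hs) as [Hs1 [Hs2 Hs3]].
  assert (X : Rabs (hyp_fun n s) <= M * INR (fact n) * K ^ n /\
     Rabs (hyp_fun (S n) s) <= M * INR (fact (S n)) * K ^ S n); [|apply X].
  induction n as [|n [IH1 IH2]].
  - simpl. split.
    + generalize (HM0 s Hs). unfold M. lra.
    + generalize (HM1 s Hs). unfold M, K. nra.
  - split; [exact IH2|].
    assert (Hfn : INR (fact (S n)) = (INR n + 1) * INR (fact n)).
    { rewrite <- S_INR, <- mult_INR. reflexivity. }
    assert (HfSn : INR (fact (S (S n))) = (INR n + 2) * INR (fact (S n))).
    { replace (INR n + 2) with (INR (S (S n))) by (rewrite !S_INR; ring).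
      rewrite <- mult_INR. reflexivity. }
    assert (Hf : 0 < INR (fact n)) by apply INR_fact_lt_0.
    assert (Hn : 0 <= INR n) by apply pos_INR.
    assert (HK : 0 < K ^ n) by (apply pow_lt; unfold K; lra).
    assert (E := hyp_fun_equation n s Hs1).
    assert (B1 : Rabs (INR n * (1 + 2 * s) + c + (A + 1) * s) <= (INR n + 1) * C1).
    { assert (T1 : Rabs (INR n * (1 + 2 * s)) <= INR n * (1 + 2 * S0)).
      { rewrite Rabs_mult, (Rabs_pos_eq (INR n)) by lra. apply Rmult_le_compat_l; [lra|].
        eapply Rle_trans; [apply Rabs_triang|]. rewrite Rabs_R1, Rabs_mult, (Rabs_pos_eq 2); lra. }
      assert (T2 : Rabs ((A + 1) * s) <= (Rabs A + 1) * S0).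
      { rewrite Rabs_mult. apply Rmult_le_compat; [apply Rabs_pos|apply Rabs_pos| |exact Hs3].
        eapply Rle_trans; [apply Rabs_triang|]. rewrite Rabs_R1; lra. }
      eapply Rle_trans; [apply Rabs_triang|].
      apply Rle_trans with (INR n * (1 + 2 * S0) + c + (Rabs A + 1) * S0).
      - apply Rplus_le_compat; [|exact T2]. eapply Rle_trans; [apply Rabs_triang|].
        rewrite (Rabs_pos_eq c) by lra. lra.
      - unfold C1. generalize (Rabs_pos A). intros.
        assert (0 <= (Rabs A + 1) * S0) by (apply Rmult_le_pos; lra). nra. }
    assert (B2 : Rabs (INR n * INR n + A * INR n + B) <= (INR n + 1) * (INR n + 1) * C2).
    { eapply Rle_trans; [apply Rabs_triang|].
      apply Rle_trans with (INR n * INR n + Rabs A * INR n + Rabs B).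
      - apply Rplus_le_compat_r. eapply Rle_trans; [apply Rabs_triang|].
        rewrite !Rabs_mult, (Rabs_pos_eq (INR n)) by lra. lra.
      - unfold C2. generalize (Rabs_pos A) (Rabs_pos B). intros. nra. }
    assert (B3 : m * Rabs (hyp_fun (S (S n)) s) <=
       (INR n + 1) * C1 * Rabs (hyp_fun (S n) s)
       + (INR n + 1) * (INR n + 1) * C2 * Rabs (hyp_fun n s)).
    { apply Rle_trans with (Rabs (s * (1 + s)) * Rabs (hyp_fun (S (S n)) s)).
      - apply Rmult_le_compat_r; [apply Rabs_pos|exact Hs2].
      - rewrite <- Rabs_mult.
        replace (s * (1 + s) * hyp_fun (S (S n)) s) with
          (- ((INR n * (1 + 2 * s) + c + (A + 1) * s) * hyp_fun (S n) s
            + (INR n * INR n + A * INR n + B) * hyp_fun n s)) by lra.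
        rewrite Rabs_Ropp. eapply Rle_trans; [apply Rabs_triang|].
        rewrite !Rabs_mult. apply Rplus_le_compat; apply Rmult_le_compat_r;
        try apply Rabs_pos; assumption. }
    set (Z := M * INR (fact (S n)) * K ^ n).
    assert (HZ : 0 <= Z).
    { unfold Z. apply Rmult_le_pos; [|lra]. apply Rmult_le_pos; [unfold M; lra|apply pos_INR]. }
    assert (B4 : m * Rabs (hyp_fun (S (S n)) s) <= (INR n + 1) * ((C1 + C2) * (K + 1)) * Z).
    { eapply Rle_trans; [exact B3|].
      apply Rle_trans with ((INR n + 1) * C1 * (K * Z) + (INR n + 1) * C2 * Z).
      - apply Rplus_le_compat.
        + apply Rmult_le_compat_l; [apply Rmult_le_pos; lra|].
          replace (K * Z) with (M * INR (fact (S n)) * K ^ S n) by (unfold Z; simpl; ring).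
          exact IH2.
        + replace ((INR n + 1) * (INR n + 1) * C2 * Rabs (hyp_fun n s))
            with ((INR n + 1) * C2 * ((INR n + 1) * Rabs (hyp_fun n s))) by ring.
          apply Rmult_le_compat_l; [apply Rmult_le_pos; lra|].
          unfold Z. rewrite Hfn.
          replace (M * ((INR n + 1) * INR (fact n)) * K ^ n)
            with ((INR n + 1) * (M * INR (fact n) * K ^ n)) by ring.
          apply Rmult_le_compat_l; [lra|exact IH1].
      - assert (0 <= (INR n + 1) * Z) by (apply Rmult_le_pos; lra).
        assert (0 <= K) by (unfold K; lra).
        replace ((INR n + 1) * C1 * (K * Z) + (INR n + 1) * C2 * Z)
          with ((INR n + 1) * Z * (C1 * K + C2)) by ring.
        replace ((INR n + 1) * ((C1 + C2) * (K + 1)) * Z)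
          with ((INR n + 1) * Z * ((C1 + C2) * (K + 1))) by ring.
        apply Rmult_le_compat_l; [assumption|]. nra. }
    apply Rmult_le_reg_l with m; [exact Hm|].
    eapply Rle_trans; [exact B4|].
    replace (m * (M * INR (fact (S (S n))) * K ^ S (S n)))
      with ((INR n + 2) * (m * (K * K)) * Z) by (rewrite HfSn; unfold Z; simpl; ring).
    apply Rmult_le_compat_r; [exact HZ|].
    replace (C1 + C2) with (m * C) by (unfold C; field; lra).
    assert (C * (K + 1) <= K * K) by (unfold K; nra).
    assert (m * (C * (K + 1)) <= m * (K * K)) by (apply Rmult_le_compat_l; lra).
    assert (0 <= C * (K + 1)) by (apply Rmult_le_pos; [exact HC|unfold K; lra]).
    assert (0 <= m * (K * K)) by nra.
    rewrite Rmult_assoc. nra.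
Qed.

End HypFun.

Definition real_analytic_at (f : R -> R) (x0 : R) : Prop :=
  exists (a : nat -> R) (delta : R), 0 < delta /\
    forall h, Rabs h < delta -> is_pseries a h (f (x0 + h)).

(** The Taylor polynomial at the moving center [x] has derivative
    [g_(n+1) (x) (y - x)^n / n!], so the mean value theorem controls the remainder. *)
Lemma analytic_of_factorial_bound (g : nat -> R -> R) (x0 delta K M : R) :
  0 < delta -> 0 < K -> 0 <= M ->
  (forall n x, Rabs (x - x0) <= delta -> is_derive (g n) x (g (S n) x)) ->
  (forall n x, Rabs (x - x0) <= delta -> Rabs (g n x) <= M * INR (fact n) * K ^ n) ->
  real_analytic_at (g O) x0.
Proof.
  intros Hd HK HM Hg HB.
  (* [(n + 1) / 4^(n + 1) <= 1 / 2^(n + 1)] absorbs the factor [n + 1] of the remainder *)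
  set (d := Rmin delta (/ (4 * K))).
  assert (Hdd : 0 < d /\ d <= delta /\ d <= / (4 * K)).
  { assert (0 < / (4 * K)) by (apply Rinv_0_lt_compat; lra).
    unfold d, Rmin; destruct Rle_dec; lra. }
  exists (fun n => g n x0 / INR (fact n)), d. split; [apply Hdd|].
  intros h Hh. apply is_pseries_R. set (y := x0 + h).
  set (T := fun (n : nat) (x : R) => sum_n (fun k => g k x / INR (fact k) * (y - x) ^ k) n).
  assert (HT : forall n x, Rabs (x - x0) <= delta ->
     is_derive (T n) x (g (S n) x * (y - x) ^ n / INR (fact n))).
  { intros n x Hx.
    assert (Hterm : forall k, is_derive (fun x => g (S k) x / INR (fact (S k)) * (y - x) ^ S k) x
       (g (S (S k)) x * (y - x) ^ S k / INR (fact (S k)) - g (S k) x * (y - x) ^ k / INR (fact k))).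
    { intros k. evar_last.
      - apply (is_derive_mult (fun x => g (S k) x / INR (fact (S k))) (fun x => (y - x) ^ S k)).
        + apply (is_derive_ext (fun x => / INR (fact (S k)) * g (S k) x)).
          { intros t. apply Rmult_comm. }
          apply is_derive_scal. now apply Hg.
        + apply (is_derive_pow (fun x => y - x) (S k)).
          auto_derive; [exact I|reflexivity].
        + intros; apply Rmult_comm.
      - unfold plus, mult; simpl pred.
        replace (INR (fact (S k))) with ((INR k + 1) * INR (fact k))
          by (rewrite <- S_INR, <- mult_INR; reflexivity).
        rewrite S_INR. simpl. field.
        split; [apply INR_fact_neq_0|generalize (pos_INR k); lra]. }
    induction n as [|n IH].
    - unfold T. apply (is_derive_ext (g O)).
      { intros t. rewrite sum_O. simpl. field. }
      evar_last; [now apply Hg|]. simpl. field.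
    - apply (is_derive_ext (fun x => T n x + g (S n) x / INR (fact (S n)) * (y - x) ^ S n)).
      { intros t. unfold T. rewrite sum_Sn. reflexivity. }
      evar_last.
      + apply (is_derive_plus (V := R_NormedModule)); [exact IH|apply Hterm].
      + unfold plus; simpl. ring. }
  assert (HTy : forall n, T n y = g O y).
  { intros n. unfold T. induction n as [|n IH].
    - rewrite sum_O. simpl. field.
    - rewrite sum_Sn, IH. unfold plus; simpl. rewrite Rminus_diag. ring. }
  assert (Hrem : forall n, Rabs (T n x0 - g O y) <= M * (1 / 2) ^ S n).
  { intros n. rewrite <- (HTy n).
    destruct (mvt_is_derive (T n) (fun x => g (S n) x * (y - x) ^ n / INR (fact n)) y x0)
      as [xi [Hxi E]].
    { intros x Hx. apply HT.
      assert (Rabs (x - x0) <= Rabs h).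
      { unfold y, Rmin, Rmax in Hx. unfold Rabs; destruct (Rcase_abs (x - x0)), (Rcase_abs h);
        repeat destruct Rle_dec; lra. }
      lra. }
    rewrite E, Rabs_mult.
    assert (Hx1 : Rabs (xi - x0) <= Rabs h /\ Rabs (y - xi) <= Rabs h).
    { unfold y, Rmin, Rmax in *. unfold Rabs;
      destruct (Rcase_abs (xi - x0)), (Rcase_abs h), (Rcase_abs (x0 + h - xi));
        repeat destruct Rle_dec; lra. }
    replace (Rabs (x0 - y)) with (Rabs h)
      by (unfold y; replace (x0 - (x0 + h)) with (- h) by ring; now rewrite Rabs_Ropp).
    unfold Rdiv. rewrite !Rabs_mult, (Rabs_pos_eq (/ _))
      by (left; apply Rinv_0_lt_compat, INR_fact_lt_0).
    rewrite <- RPow_abs. change (1 * / 2) with (1 / 2).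
    assert (B1 := HB (S n) xi ltac:(lra)).
    assert (B2 : Rabs (y - xi) ^ n <= Rabs h ^ n).
    { apply pow_incr. split; [apply Rabs_pos|apply Hx1]. }
    assert (Hf : 0 < INR (fact n)) by apply INR_fact_lt_0.
    assert (Hfn : INR (fact (S n)) = (INR n + 1) * INR (fact n)).
    { rewrite <- S_INR, <- mult_INR. reflexivity. }
    apply Rle_trans with (M * INR (fact (S n)) * K ^ S n * Rabs h ^ n * / INR (fact n) * Rabs h).
    { apply Rmult_le_compat_r; [apply Rabs_pos|].
      apply Rmult_le_compat_r; [left; now apply Rinv_0_lt_compat|].
      apply Rmult_le_compat; [apply Rabs_pos|apply pow_le, Rabs_pos|exact B1|exact B2]. }
    rewrite Hfn.
    replace (M * ((INR n + 1) * INR (fact n)) * K ^ S n * Rabs h ^ n * / INR (fact n) * Rabs h)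
      with (M * ((INR n + 1) * (K * Rabs h) ^ S n))
      by (rewrite Rpow_mult_distr; simpl; field; lra).
    apply Rmult_le_compat_l; [exact HM|].
    assert (B3 : (K * Rabs h) ^ S n <= (1 / 4) ^ S n).
    { apply pow_incr. split; [apply Rmult_le_pos; [lra|apply Rabs_pos]|].
      replace (1 / 4) with (K * / (4 * K)) by (field; lra).
      apply Rmult_le_compat_l; lra. }
    assert (B4 : INR n + 1 <= 2 ^ S n).
    { rewrite <- S_INR. left.
      replace 2 with (INR 2) by reflexivity. rewrite <- pow_INR. apply lt_INR.
      apply Nat.pow_gt_lin_r. lia. }
    replace (1 / 4) with ((1 / 2) * (1 / 2)) in B3 by field.
    rewrite (Rpow_mult_distr (1 / 2) (1 / 2)) in B3.
    assert (B5 : 2 ^ S n * (1 / 2) ^ S n = 1).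
    { rewrite <- Rpow_mult_distr. replace (2 * (1 / 2)) with 1 by field. apply pow1. }
    assert (0 < (1 / 2) ^ S n) by (apply pow_lt; lra).
    assert (0 <= (K * Rabs h) ^ S n) by (apply pow_le, Rmult_le_pos; [lra|apply Rabs_pos]).
    set (p := (1 / 2) ^ S n) in *. set (q := 2 ^ S n) in *.
    apply Rle_trans with (q * (p * p)); [|rewrite <- Rmult_assoc, B5; lra].
    apply Rmult_le_compat; [generalize (pos_INR n); lra|assumption|exact B4|exact B3]. }
  apply (is_lim_seq_ext (fun n => T n x0) _ (g O y)).
  { intros n. unfold T. apply sum_n_ext. intros k. unfold y.
    replace (x0 + h - x0) with h by ring. reflexivity. }
  assert (L : is_lim_seq (fun n => M * (1 / 2) ^ S n) 0).
  { replace 0 with (M * 0) by ring.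
    apply (is_lim_seq_scal_l (fun n => (1 / 2) ^ S n) M 0).
    apply (is_lim_seq_incr_1 (fun n => (1 / 2) ^ n)). apply is_lim_seq_geom.
    rewrite Rabs_pos_eq; lra. }
  apply (is_lim_seq_ext (fun n => g O y + (T n x0 - g O y))).
  { intros; ring. }
  assert (L2 : is_lim_seq (fun n => g O y + (T n x0 - g O y)) (g O y + 0)).
  { apply is_lim_seq_plus'; [apply is_lim_seq_const|].
    apply is_lim_seq_abs_0.
    apply (is_lim_seq_le_le (fun _ => 0) _ (fun n => M * (1 / 2) ^ S n) 0).
    - intros n. split; [apply Rabs_pos|apply Hrem].
    - apply is_lim_seq_const.
    - exact L. }
  rewrite Rplus_0_r in L2. exact L2.
Qed.

Lemma hyp_fun_analytic A B c s0 : 0 < c -> -1 < s0 ->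
  real_analytic_at (hyp_fun A B c 0) s0.
Proof.
  intros Hc Hs. destruct (Req_dec s0 0) as [->|H0].
  - exists (gauss_coeff A B c), 1. split; [lra|]. intros h Hh.
    assert (-1 < h < 1) by (apply Rabs_def2 in Hh; lra).
    rewrite Rplus_0_l, (hyp_fun_gauss A B c Hc 0 h) by lra.
    apply PSeries_correct, CV_radius_inside. now apply gauss_coeff_converges.
  - destruct (hyp_fun_factorial_bound A B c Hc s0 Hs H0) as [d [K [M [H1 [H2 [H3 [H4 H5]]]]]]].
    apply (analytic_of_factorial_bound (hyp_fun A B c) s0 d K M H1 H2 H3); [|exact H5].
    intros n x Hx. apply hyp_fun_chain; [exact Hc|]. apply Rabs_le_between in Hx. lra.
Qed.

(** * Uniqueness of the analytic continuation *)

(** All derivatives of the series vanish to the right of [0], hence at [0] by continuity. *)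
Lemma PSeries_zero_right (r : R) : 0 < r -> forall (n : nat) (a : nat -> R),
  (forall h, Rabs h < r -> Rbar_lt (Rabs h) (CV_radius a)) ->
  (forall h, 0 < h < r -> PSeries a h = 0) -> a n = 0.
Proof.
  intros Hr. induction n as [|n IH]; intros a Ha H0.
  - rewrite <- PSeries_0.
    assert (C : continuous (PSeries a) 0).
    { apply continuity_pt_filterlim, PSeries_continuity.
      apply Ha. rewrite Rabs_R0; lra. }
    assert (L : filterlim (PSeries a) (at_right 0) (locally (PSeries a 0))).
    { eapply filterlim_filter_le_1; [apply filter_le_within|exact C]. }
    assert (L0 : filterlim (PSeries a) (at_right 0) (locally 0)).
    { apply (filterlim_ext_loc (fun _ => 0)); [|apply filterlim_const].
      exists (mkposreal r Hr). intros t Ht Ht0. symmetry. apply H0.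
      unfold ball in Ht; simpl in Ht; unfold AbsRing_ball, abs, minus, plus, opp in Ht;
      simpl in Ht. apply Rabs_def2 in Ht. lra. }
    exact (filterlim_locally_unique (F := at_right 0) _ _ _ L L0).
  - assert (Z : PS_derive a n = 0).
    { apply IH.
      - intros h Hh. rewrite CV_radius_derive. now apply Ha.
      - intros h Hh. rewrite <- Derive_PSeries.
        + apply is_derive_unique. apply (is_derive_ext_loc (fun _ => 0)).
          * apply (locally_of_interval 0 r); [lra|]. intros t Ht. symmetry. now apply H0.
          * apply (is_derive_const (K := R_AbsRing) (V := R_NormedModule)).
        + apply Ha. rewrite Rabs_pos_eq; lra. }
    unfold PS_derive in Z. apply Rmult_integral in Z. destruct Z as [Z|Z]; [|exact Z].
    exfalso. revert Z. apply not_0_INR. lia.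
Qed.

(** The supremum of the [s] with [f = 0] on [(- s, 1)] cannot be finite: the power
    series of [f] at the endpoint vanishes on its right side. *)
Lemma analytic_identity (f : R -> R) :
  (forall x, x < 1 -> real_analytic_at f x) ->
  (forall x, -1 < x < 1 -> f x = 0) ->
  forall x, x < 1 -> f x = 0.
Proof.
  intros Ha H0 x1 Hx1. apply NNPP. intros Hne.
  set (E := fun s => forall x, - s < x < 1 -> f x = 0).
  destruct (completeness E) as [m [Hub Hlub]].
  - exists (- x1). intros s Hs. apply Rnot_lt_le. intros Hlt.
    apply Hne, Hs. lra.
  - exists 1. exact H0.
  - assert (Hm1 : 1 <= m) by (apply Hub; exact H0).
    assert (Hm : forall x, - m < x < 1 -> f x = 0).
    { intros x Hx. apply NNPP. intros Hnx.
      assert (m <= - x); [|lra].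
      apply Hlub. intros s Hs. apply Rnot_lt_le. intros Hlt. apply Hnx, Hs. lra. }
    destruct (Ha (- m)) as [a [d [Hd HS]]]; [lra|].
    set (r := Rmin d 1 / 2).
    assert (Hr : 0 < r /\ r < d /\ r < 1) by (unfold r, Rmin; destruct Rle_dec; lra).
    assert (HR : forall h, Rabs h < r -> Rbar_lt (Rabs h) (CV_radius a)).
    { intros h Hh. apply Rbar_lt_le_trans with r; [exact Hh|].
      apply (CV_radius_bounded a).
      assert (X : is_pseries a r (f (- m + r))) by (apply HS; rewrite Rabs_pos_eq; lra).
      apply is_pseries_R in X.
      assert (Y : is_lim_seq (fun n => a n * r ^ n) 0).
      { apply ex_series_lim_0. now exists (f (- m + r)). }
      destruct (filterlim_bounded _ (ex_intro _ 0 Y)) as [M HM]. exists M. exact HM. }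
    assert (Hz : forall n, a n = 0).
    { intros n. apply (PSeries_zero_right r (proj1 Hr) n a HR).
      intros h Hh. rewrite (is_pseries_unique a h (f (- m + h))).
      - apply Hm. lra.
      - apply HS. rewrite Rabs_pos_eq; lra. }
    assert (HE : E (m + r)).
    { intros x Hx. destruct (Rlt_dec (- m) x) as [Hlt|Hge]; [apply Hm; lra|].
      assert (X : is_pseries a (x + m) (f x)).
      { replace (f x) with (f (- m + (x + m))) by (f_equal; ring).
        apply HS. apply Rabs_def1; lra. }
      apply is_pseries_unique in X. rewrite <- X.
      rewrite (PSeries_ext a (fun _ => 0)) by exact Hz. apply PSeries_const_0. }
    generalize (Hub _ HE). lra.
Qed.

(** * The hypergeometric function with complex conjugate parameters *)

Lemma filterlim_C {T : Type} (F : (T -> Prop) -> Prop) {FF : Filter F} (f : T -> C) (l : C) :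
  filterlim f F (locally (T := C_R_NormedModule) l) <->
  filterlim (fun t => fst (f t)) F (locally (fst l)) /\
  filterlim (fun t => snd (f t)) F (locally (snd l)).
Proof.
  split.
  - intros H. split; apply filterlim_locally; intros eps;
    (assert (H' := proj1 (filterlim_locally (U := C_R_NormedModule) f l) H eps);
     revert H'; apply filter_imp; intros t [H1 H2]; assumption).
  - intros [H1 H2]. apply (filterlim_locally (U := C_R_NormedModule)). intros eps.
    assert (K1 := proj1 (filterlim_locally (U := R_UniformSpace) _ _) H1 eps).
    assert (K2 := proj1 (filterlim_locally (U := R_UniformSpace) _ _) H2 eps).
    refine (filter_imp _ _ _ (filter_and _ _ K1 K2)). intros t [Z1 Z2]. now split.
Qed.

Lemma is_pseries_C (a : nat -> C) (x : R) (l : C) :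
  @is_pseries R_AbsRing C_R_NormedModule a x l <->
  is_pseries (fun n => fst (a n)) x (fst l) /\ is_pseries (fun n => snd (a n)) x (snd l).
Proof.
  assert (E : forall n, sum_n (fun k => @scal R_AbsRing C_R_NormedModule (pow_n x k) (a k)) n =
     (sum_n (fun k => scal (pow_n x k) (fst (a k))) n,
      sum_n (fun k => scal (pow_n x k) (snd (a k))) n)).
  { induction n as [|n IH].
    - rewrite !sum_O. reflexivity.
    - rewrite !sum_Sn, IH. reflexivity. }
  unfold is_pseries, is_series. rewrite (@filterlim_C nat eventually _).
  split; intros [H1 H2]; split.
  - eapply filterlim_ext; [|exact H1]. intros n. exact (f_equal fst (E n)).
  - eapply filterlim_ext; [|exact H2]. intros n. exact (f_equal snd (E n)).
  - eapply filterlim_ext; [|exact H1]. intros n. exact (eq_sym (f_equal fst (E n))).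
  - eapply filterlim_ext; [|exact H2]. intros n. exact (eq_sym (f_equal snd (E n))).
Qed.

Lemma is_pseries_zero (x : R) : is_pseries (fun _ : nat => 0) x 0.
Proof.
  apply is_pseries_R.
  apply (filterlim_ext (fun _ : nat => 0)); [|apply filterlim_const].
  intros n. induction n as [|n IH].
  - rewrite sum_O. ring.
  - rewrite sum_Sn, <- IH. unfold plus; simpl. ring.
Qed.

Lemma RtoC_neq_0 (x : R) : x <> 0 -> RtoC x <> RtoC 0.
Proof. intros H E. apply H. now apply RtoC_inj. Qed.

Section Conjugate.

Variables (a b : C) (A B c : R).
Hypothesis Hc : 0 < c.
Hypothesis HA : (a + b)%C = RtoC A.
Hypothesis HB : (a * b)%C = RtoC B.

Lemma pochhammer_real_neq_0 (n : nat) : pochhammer (RtoC c) n <> RtoC 0.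
Proof.
  induction n as [|n IH]; simpl.
  - apply RtoC_neq_0. lra.
  - apply Cmult_neq_0; [exact IH|]. rewrite <- RtoC_plus. apply RtoC_neq_0.
    generalize (pos_INR n). lra.
Qed.

Lemma Gauss_coeff_conjugate (n : nat) :
  Gauss_coeff a b (RtoC c) n = RtoC ((-1) ^ n * gauss_coeff A B c n).
Proof.
  unfold Gauss_coeff. induction n as [|n IH].
  - simpl. rewrite !Rmult_1_r. field.
  - assert (Hk : ((a + RtoC (INR n)) * (b + RtoC (INR n)))%C
        = RtoC (INR n * INR n + A * INR n + B)).
    { rewrite !RtoC_plus, !RtoC_mult, <- HA, <- HB. ring. }
    assert (Hn := pos_INR n).
    assert (Hf : RtoC (INR (fact n)) <> RtoC 0) by apply RtoC_neq_0, INR_fact_neq_0.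
    assert (Hp := pochhammer_real_neq_0 n).
    assert (Hcn : (RtoC c + RtoC (INR n))%C <> RtoC 0).
    { rewrite <- RtoC_plus. apply RtoC_neq_0. lra. }
    assert (Hn1 : (RtoC (INR n) + 1)%C <> RtoC 0).
    { rewrite <- RtoC_plus. apply RtoC_neq_0. lra. }
    replace (INR (fact (S n))) with ((INR n + 1) * INR (fact n))
      by (rewrite <- S_INR, <- mult_INR; reflexivity).
    cbn [pochhammer gauss_coeff].
    replace ((-1) ^ S n * (gauss_coeff A B c n *
       (- (INR n * INR n + A * INR n + B) / ((INR n + 1) * (INR n + c)))))
      with (((-1) ^ n * gauss_coeff A B c n) *
       ((INR n * INR n + A * INR n + B) / ((INR n + 1) * (c + INR n))))
      by (simpl; field; lra).
    rewrite (RtoC_mult ((-1) ^ n * gauss_coeff A B c n)), <- IH,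
      RtoC_div by (apply Rgt_not_eq, Rmult_lt_0_compat; lra).
    rewrite <- Hk, !RtoC_mult, !RtoC_plus.
    field. repeat split; assumption.
Qed.

Definition hyp_real (z : R) : R := hyp_fun A B c 0 (- z).

Lemma pseries_opp_arg (d : nat -> R) (h l : R) :
  is_pseries d (- h) l -> is_pseries (fun n => (-1) ^ n * d n) h l.
Proof.
  intros H. apply is_pseries_R. apply is_pseries_R in H.
  eapply is_series_ext; [|exact H]. intros n. simpl.
  replace (- h) with (-1 * h) by ring. rewrite Rpow_mult_distr. ring.
Qed.

Lemma hyp_real_is_hyp2F1 : is_hyp2F1 a b (RtoC c) (fun z => RtoC (hyp_real z)).
Proof.
  split.
  - intros x Hx. unfold has_pseries_at. apply is_pseries_C. rewrite Rminus_0_r.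
    split.
    + apply (is_pseries_ext (fun n => (-1) ^ n * gauss_coeff A B c n)).
      { intros n. now rewrite Gauss_coeff_conjugate. }
      apply pseries_opp_arg. unfold hyp_real. rewrite hyp_fun_gauss by (exact Hc || lra).
      apply PSeries_correct, CV_radius_inside, gauss_coeff_converges; [exact Hc|].
      apply Rabs_def1; lra.
    + apply (is_pseries_ext (fun _ => 0)); [|apply is_pseries_zero].
      intros n. now rewrite Gauss_coeff_conjugate.
  - intros x Hx. destruct (hyp_fun_analytic A B c (- x) Hc) as [d [r [Hr Hd]]]; [lra|].
    exists (fun n => RtoC ((-1) ^ n * d n)).
    apply (locally_of_interval (x - r) (x + r)); [lra|]. intros t Ht.
    unfold has_pseries_at. apply is_pseries_C. split; simpl; [|apply is_pseries_zero].
    apply pseries_opp_arg. unfold hyp_real.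
    replace (- t) with (- x + - (t - x)) by ring. apply Hd.
    rewrite Rabs_Ropp. apply Rabs_def1; lra.
Qed.

Lemma hyp2F1_unique (F G : R -> C) : is_hyp2F1 a b (RtoC c) F -> is_hyp2F1 a b (RtoC c) G ->
  forall z, z < 1 -> F z = G z.
Proof.
  intros [F1 F2] [G1 G2] z Hz.
  assert (K : forall p : C -> R, (p = fst \/ p = snd) -> p (F z) - p (G z) = 0).
  { intros p Hp.
    assert (Hps : forall (e : nat -> C) x l, @is_pseries R_AbsRing C_R_NormedModule e x l ->
      is_pseries (fun n => p (e n)) x (p l)).
    { intros e x l H. apply is_pseries_C in H. destruct Hp; subst p; apply H. }
    apply (analytic_identity (fun z => p (F z) - p (G z))); [| |exact Hz].
    - intros x Hx. destruct (F2 x Hx) as [d [r1 H1]]. destruct (G2 x Hx) as [e [r2 H2]].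
      exists (fun n => p (d n) - p (e n)), (Rmin r1 r2).
      split; [apply Rmin_pos; apply cond_pos|].
      intros h Hh.
      assert (L1 : has_pseries_at F x (x + h) d).
      { apply H1. unfold ball; simpl; unfold AbsRing_ball, abs, minus, plus, opp; simpl.
        replace (x + h + - x) with h by ring. generalize (Rmin_l r1 r2); lra. }
      assert (L2 : has_pseries_at G x (x + h) e).
      { apply H2. unfold ball; simpl; unfold AbsRing_ball, abs, minus, plus, opp; simpl.
        replace (x + h + - x) with h by ring. generalize (Rmin_r r1 r2); lra. }
      unfold has_pseries_at in L1, L2.
      replace (x + h - x) with h in L1, L2 by ring.
      apply (is_pseries_minus (V := R_NormedModule) (fun n => p (d n)) (fun n => p (e n))
              h (p (F (x + h))) (p (G (x + h)))); now apply Hps.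
    - intros x Hx. apply Rminus_diag_eq.
      assert (L1 := Hps _ _ _ (F1 x Hx)). assert (L2 := Hps _ _ _ (G1 x Hx)).
      apply is_pseries_unique in L1. apply is_pseries_unique in L2. congruence. }
  apply injective_projections; apply Rminus_diag_uniq; apply K; auto.
Qed.

Lemma hyp2F1_conjugate (z : R) : z < 1 -> hyp2F1 a b (RtoC c) z = RtoC (hyp_real z).
Proof.
  assert (X : is_hyp2F1 a b (RtoC c) (hyp2F1 a b (RtoC c))).
  { unfold hyp2F1. apply epsilon_spec. exists (fun z => RtoC (hyp_real z)).
    apply hyp_real_is_hyp2F1. }
  exact (hyp2F1_unique _ _ X hyp_real_is_hyp2F1 z).
Qed.

End Conjugate.

(** * Polynomial growth and Euler's transformation *)

Definition poly_bounded (g : R -> R) : Prop :=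
  exists (C : R) (N : nat), 0 <= C /\ forall s, 0 <= s -> Rabs (g s) <= C * (1 + s) ^ N.

Lemma poly_bounded_glue (g : R -> R) (C : R) (N : nat) :
  (forall s, 0 <= s <= 1 -> continuous g s) -> 0 <= C ->
  (forall s, 1 <= s -> Rabs (g s) <= C * (1 + s) ^ N) -> poly_bounded g.
Proof.
  intros Hg HC HN.
  destruct (bounded_continuity g 0 1 Hg) as [M HM].
  exists (Rabs M + C), N. split; [generalize (Rabs_pos M); lra|].
  intros s Hs. assert (H1 : 1 <= (1 + s) ^ N) by (apply pow_R1_Rle; lra).
  assert (HM0 := Rabs_pos M).
  destruct (Rle_dec s 1) as [H|H].
  - apply Rle_trans with M; [left; apply (HM s); lra|]. generalize (Rle_abs M). nra.
  - eapply Rle_trans; [apply HN; lra|]. nra.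
Qed.

Lemma hyp_sol_poly_bounded A B c f f1 f2 : 0 < c ->
  hyp_sol A B c (fun s => -1 < s) f f1 f2 -> poly_bounded f.
Proof.
  intros Hc H. destruct (energy_growth A B c _ f f1 f2 H) as [N HN].
  assert (He : forall s, 1 <= s -> energy f f1 s <= energy f f1 1 * (1 + s) ^ N).
  { intros s Hs. assert (X := HN 1 s ltac:(lra) ltac:(intros; lra)).
    rewrite pow1 in X. unfold Rdiv in X. rewrite Rinv_1, Rmult_1_r in X.
    assert (0 < s ^ N) by (apply pow_lt; lra).
    assert (0 <= energy f f1 1).
    { unfold energy. generalize (Rle_0_sqr (f1 1)) (Rle_0_sqr (f 1)). unfold Rsqr. lra. }
    assert (s ^ N <= (1 + s) ^ N) by (apply pow_incr; lra).
    apply Rle_trans with (energy f f1 1 * s ^ N); [|apply Rmult_le_compat_l; assumption].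
    apply (Rmult_le_compat_r (s ^ N)) in X; [|lra].
    rewrite Rmult_assoc, Rinv_l, Rmult_1_r in X; lra. }
  apply (poly_bounded_glue f (1 + energy f f1 1) N).
  - intros s Hs. apply (continuous_of_derive f s (f1 s)). apply H. lra.
  - unfold energy. generalize (Rle_0_sqr (f1 1)) (Rle_0_sqr (f 1)). unfold Rsqr. lra.
  - intros s Hs. assert (1 <= (1 + s) ^ N) by (apply pow_R1_Rle; lra).
    assert (X := He s Hs).
    assert (f s * f s <= energy f f1 s).
    { unfold energy at 1. generalize (Rle_0_sqr (f1 s)). unfold Rsqr. intros. nra. }
    assert (Rabs (f s) <= 1 + f s * f s).
    { unfold Rabs; destruct Rcase_abs; nra. }
    lra.
Qed.

(** The [n]-th derivative is a solution for the parameters [a + n], [b + n], [c + n]. *)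
Lemma hyp_fun_poly_bounded A B c n : 0 < c -> poly_bounded (hyp_fun A B c n).
Proof.
  intros Hc.
  apply (hyp_sol_poly_bounded (A + 2 * INR n) (INR n * INR n + A * INR n + B) (c + INR n)
           _ (hyp_fun A B c (S n)) (hyp_fun A B c (S (S n)))).
  - generalize (pos_INR n). lra.
  - intros s Hs. split; [now apply hyp_fun_chain|]. split; [now apply hyp_fun_chain|].
    eapply eq_trans; [|exact (hyp_fun_equation A B c Hc n s Hs)]. ring.
Qed.

(** Euler's transformation, with [p = c - a - b]: multiplication by [(1 + s)^p] carries the
    hypergeometric equation with parameters [c - a], [c - b] to the one with
    parameters [a], [b], and both sides are regular at [0]. *)
Lemma euler_transform A B c p s : 0 < c -> A + p = c -> 0 <= s ->
  hyp_fun A B c 0 s = Rpower (1 + s) p * hyp_fun (A + 2 * p) (B + p * c) c 0 s.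
Proof.
  intros Hc HA Hs. apply Rminus_diag_uniq.
  set (f := hyp_fun (A + 2 * p) (B + p * c) c).
  assert (Hp : forall t, -1 < t -> is_derive (fun s => Rpower (1 + s) p) t
      (p * (Rpower (1 + t) p / (1 + t)))).
  { intros t Ht. evar_last.
    - apply (is_derive_comp (fun u => Rpower u p) (fun s => 1 + s)).
      + apply is_derive_Rpower. lra.
      + auto_derive; [exact I|reflexivity].
    - unfold scal; simpl; unfold mult; simpl. rewrite Rpower_minus1 by lra. ring. }
  set (g1 := fun s => Rpower (1 + s) p * (f 1%nat s + p * f 0%nat s / (1 + s))).
  set (g2 := fun s => Rpower (1 + s) p *
     (f 2%nat s + 2 * p * f 1%nat s / (1 + s) + p * (p - 1) * f 0%nat s / (1 + s) ^ 2)).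
  assert (Hf : forall n t, -1 < t -> is_derive (f n) t (f (S n) t)).
  { intros n t Ht. now apply hyp_fun_chain. }
  refine (regular_unique A B c (s + 1)
    (fun s => hyp_fun A B c 0 s - Rpower (1 + s) p * f 0%nat s)
    (fun s => hyp_fun A B c 1 s - g1 s)
    (fun s => hyp_fun A B c 2 s - g2 s) Hc _ _ s _); [| |lra].
  - intros t Ht. destruct (hyp_fun_sol A B c Hc t) as [H0 [H1 E]]; [lra|].
    split; [|split].
    + apply (is_derive_minus (V := R_NormedModule)); [exact H0|]. evar_last.
      * apply (is_derive_mult (fun s => Rpower (1 + s) p) (f 0%nat)).
        -- apply Hp; lra.
        -- apply Hf; lra.
        -- intros; apply Rmult_comm.
      * unfold plus, mult, g1; simpl. field. lra.
    + apply (is_derive_minus (V := R_NormedModule)); [exact H1|]. evar_last.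
      * apply (is_derive_mult (fun s => Rpower (1 + s) p)
                 (fun s => f 1%nat s + p * f 0%nat s / (1 + s))).
        -- apply Hp; lra.
        -- apply (is_derive_plus (V := R_NormedModule)); [apply Hf; lra|].
           apply (is_derive_div (fun s => p * f 0%nat s) (fun s => 1 + s)).
           ++ apply is_derive_scal. apply Hf; lra.
           ++ auto_derive; [exact I|reflexivity].
           ++ lra.
        -- intros; apply Rmult_comm.
      * unfold plus, mult, g2; simpl. field. lra.
    + destruct (hyp_fun_sol (A + 2 * p) (B + p * c) c Hc t) as [_ [_ E2]]; [lra|].
      fold f in E2. unfold g1, g2.
      assert (E3 : t * (1 + t) * f 2%nat t =
         - (c + (A + 2 * p + 1) * t) * f 1%nat t - (B + p * c) * f 0%nat t) by lra.
      assert (E4 : t * (1 + t) * (f 2%nat t + 2 * p * f 1%nat t / (1 + t)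
            + p * (p - 1) * f 0%nat t / (1 + t) ^ 2)
         + (c + (A + 1) * t) * (f 1%nat t + p * f 0%nat t / (1 + t)) + B * f 0%nat t = 0).
      { replace (t * (1 + t) * (f 2%nat t + 2 * p * f 1%nat t / (1 + t)
            + p * (p - 1) * f 0%nat t / (1 + t) ^ 2))
          with (t * (1 + t) * f 2%nat t + 2 * p * t * f 1%nat t
            + p * (p - 1) * t * f 0%nat t / (1 + t)) by (field; lra).
        rewrite E3. rewrite <- HA. field. lra. }
      set (X := f 2%nat t + _ + _) in *. set (Y := f 1%nat t + _) in *.
      set (q := Rpower (1 + t) p).
      replace (t * (1 + t) * (hyp_fun A B c 2 t - q * X)
        + (c + (A + 1) * t) * (hyp_fun A B c 1 t - q * Y)
        + B * (hyp_fun A B c 0 t - q * f 0%nat t))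
       with ((t * (1 + t) * hyp_fun A B c 2 t + (c + (A + 1) * t) * hyp_fun A B c 1 t
              + B * hyp_fun A B c 0 t)
         - q * (t * (1 + t) * X + (c + (A + 1) * t) * Y + B * f 0%nat t)) by ring.
      rewrite E, E4. ring.
  - unfold f. rewrite !hyp_fun_0 by exact Hc. rewrite Rplus_0_r. unfold Rpower.
    rewrite ln_1, Rmult_0_r, exp_0. ring.
Qed.

(** * Laplace-type integrals of polynomially bounded functions *)

(** [1 + t <= P (1 + t / P) <= P exp (t / P)] for every integer [P >= 1]. *)
Lemma exp_beats_powers (c : R) (M : nat) : 0 < c ->
  exists K, 0 < K /\ forall t, 0 < t -> exp (- t) * (1 + t) ^ M <= K * Rpower (1 + t) (- c - 1).
Proof.
  intros Hc. destruct (INR_unbounded (INR M + c + 1)) as [P HP].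
  assert (HP1 : 1 <= INR P) by (generalize (pos_INR M); lra).
  exists (INR P ^ P). split; [apply pow_lt; lra|]. intros t Ht.
  assert (X : (1 + t) ^ P <= INR P ^ P * exp t).
  { apply Rle_trans with ((INR P * exp (t / INR P)) ^ P).
    - apply pow_incr. split; [lra|].
      apply Rle_trans with (INR P * (1 + t / INR P)).
      + replace (INR P * (1 + t / INR P)) with (INR P + t) by (field; lra). lra.
      + apply Rmult_le_compat_l; [lra|]. left. apply exp_ineq1.
        apply Rgt_not_eq, Rdiv_lt_0_compat; lra.
    - rewrite Rpow_mult_distr. right. f_equal.
      rewrite <- Rpower_pow by apply exp_pos. unfold Rpower. rewrite ln_exp.
      f_equal. field. lra. }
  assert (Y : Rpower (1 + t) (INR M + c + 1) <= (1 + t) ^ P).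
  { rewrite <- Rpower_pow by lra. apply Rle_Rpower; lra. }
  replace (- c - 1) with (INR M + - (INR M + c + 1)) by ring.
  rewrite Rpower_plus, Rpower_pow by lra. rewrite Rpower_Ropp.
  assert (Hq : 0 < Rpower (1 + t) (INR M + c + 1)) by apply Rpower_pos.
  set (q := Rpower (1 + t) (INR M + c + 1)) in *.
  assert (Hm : 0 < (1 + t) ^ M) by (apply pow_lt; lra).
  rewrite exp_Ropp.
  apply Rmult_le_reg_r with (exp t * q).
  - apply Rmult_lt_0_compat; [apply exp_pos|exact Hq].
  - replace (/ exp t * (1 + t) ^ M * (exp t * q)) with ((1 + t) ^ M * q)
      by (field; apply Rgt_not_eq, exp_pos).
    replace (INR P ^ P * ((1 + t) ^ M * / q) * (exp t * q))
      with ((1 + t) ^ M * (INR P ^ P * exp t)) by (field; lra).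
    apply Rmult_le_compat_l; lra.
Qed.

Section Laplace.

Variables (g c eps : R).
Hypothesis Hc : 0 < c.
Hypothesis Heps : 0 <= eps.

Definition weight (t : R) : R := exp (- t) * Rpower t (c - 1) * Rpower (1 + eps * t) g.

(** For [w = 1 / x] and [eps = 1 / y] this is minus the argument of the hypergeometric
    function in the product formula; [eps = 0] serves a single Whittaker function. *)
Definition arg (w t : R) : R := (1 + t * w) * (1 + eps * t) - 1.

(** The [w]-derivative of [arg]. *)
Definition dilation (t : R) : R := t * (1 + eps * t).

(** If [phi] is the [j]-th derivative of [F], this is the [j]-th [w]-derivative of
    [weight t * F (arg w t)]. *)
Definition kernel (j : nat) (phi : R -> R) (w t : R) : R :=
  weight t * dilation t ^ j * phi (arg w t).

Lemma arg_nonneg w t : 0 <= w -> 0 < t -> 0 <= arg w t.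
Proof.
  intros Hw Ht. unfold arg. assert (0 <= t * w) by (apply Rmult_le_pos; lra).
  assert (0 <= eps * t) by (apply Rmult_le_pos; lra). nra.
Qed.

Lemma weight_pos t : 0 < weight t.
Proof.
  unfold weight. apply Rmult_lt_0_compat; [apply Rmult_lt_0_compat|].
  - apply exp_pos. - apply Rpower_pos. - apply Rpower_pos.
Qed.

(** All factors other than [exp (- t) t^(c-1)] are bounded by powers of [1 + t], uniformly
    for [0 <= w <= W], and the exponential absorbs them. *)
Lemma kernel_bound (W : R) (j N : nat) : 0 <= W ->
  exists K, 0 <= K /\ forall t w z, 0 < t -> 0 <= w <= W ->
    0 <= z <= (1 + arg w t) ^ N -> weight t * dilation t ^ j * z <= K * majorant c t.
Proof.
  intros HW.
  destruct (INR_unbounded (Rabs g)) as [m Hm].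
  destruct (exp_beats_powers c (m + (2 * j + 2 * N)) Hc) as [K [HK HK2]].
  exists ((1 + eps) ^ m * (1 + eps) ^ j * ((1 + W) * (1 + eps)) ^ N * K).
  split.
  { repeat apply Rmult_le_pos; try apply pow_le; try lra. apply Rmult_le_pos; lra. }
  intros t w z Ht Hw Hz.
  assert (H0 : 0 <= eps * t) by (apply Rmult_le_pos; lra).
  assert (H1 : 1 + eps * t <= (1 + eps) * (1 + t)) by nra.
  assert (H2 : Rpower (1 + eps * t) g <= (1 + eps) ^ m * (1 + t) ^ m).
  { apply Rle_trans with ((1 + eps * t) ^ m).
    - rewrite <- Rpower_pow by lra. apply Rle_Rpower; [lra|].
      generalize (Rle_abs g). lra.
    - rewrite <- Rpow_mult_distr. apply pow_incr. lra. }
  assert (H3 : dilation t ^ j <= (1 + eps) ^ j * (1 + t) ^ (2 * j)).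
  { rewrite pow_mult, <- Rpow_mult_distr. unfold dilation. apply pow_incr.
    split; [apply Rmult_le_pos; lra|]. simpl. nra. }
  assert (H4 : z <= ((1 + W) * (1 + eps)) ^ N * (1 + t) ^ (2 * N)).
  { eapply Rle_trans; [apply Hz|].
    rewrite pow_mult, <- Rpow_mult_distr. unfold arg. apply pow_incr.
    assert (0 <= t * w) by (apply Rmult_le_pos; lra).
    assert (t * w <= t * W) by (apply Rmult_le_compat_l; lra).
    split; [nra|].
    replace (1 + ((1 + t * w) * (1 + eps * t) - 1)) with ((1 + t * w) * (1 + eps * t)) by ring.
    replace ((1 + W) * (1 + eps) * (1 + t) ^ 2)
      with (((1 + W) * (1 + t)) * ((1 + eps) * (1 + t))) by ring.
    apply Rmult_le_compat; nra. }
  assert (0 < Rpower t (c - 1)) by apply Rpower_pos.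
  assert (0 < Rpower (1 + eps * t) g) by apply Rpower_pos.
  assert (0 < exp (- t)) by apply exp_pos.
  assert (0 <= dilation t ^ j).
  { apply pow_le. unfold dilation. apply Rmult_le_pos; lra. }
  unfold weight, majorant.
  apply Rle_trans with (exp (- t) * Rpower t (c - 1) * ((1 + eps) ^ m * (1 + t) ^ m)
     * ((1 + eps) ^ j * (1 + t) ^ (2 * j)) * (((1 + W) * (1 + eps)) ^ N * (1 + t) ^ (2 * N))).
  - apply Rmult_le_compat; [|lra| |exact H4].
    + apply Rmult_le_pos; [|assumption]. repeat apply Rmult_le_pos; lra.
    + apply Rmult_le_compat; [|assumption| |exact H3].
      * repeat apply Rmult_le_pos; lra.
      * apply Rmult_le_compat_l; [apply Rmult_le_pos; lra|exact H2].
  - assert (X := HK2 t Ht). rewrite !pow_add in X.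
    set (k := (1 + eps) ^ m * (1 + eps) ^ j * ((1 + W) * (1 + eps)) ^ N).
    replace (exp (- t) * Rpower t (c - 1) * ((1 + eps) ^ m * (1 + t) ^ m)
     * ((1 + eps) ^ j * (1 + t) ^ (2 * j)) * (((1 + W) * (1 + eps)) ^ N * (1 + t) ^ (2 * N)))
     with (k * Rpower t (c - 1) *
       (exp (- t) * ((1 + t) ^ m * ((1 + t) ^ (2 * j) * (1 + t) ^ (2 * N)))))
     by (unfold k; ring).
    replace (k * K * (Rpower t (c - 1) * Rpower (1 + t) (- c - 1)))
      with (k * Rpower t (c - 1) * (K * Rpower (1 + t) (- c - 1))) by ring.
    apply Rmult_le_compat_l; [|exact X].
    apply Rmult_le_pos; [|lra]. unfold k.
    repeat apply Rmult_le_pos; try apply pow_le; try lra. apply Rmult_le_pos; lra.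
Qed.

Lemma kernel_continuous (j : nat) (phi : R -> R) (w t : R) :
  0 <= w -> 0 < t -> (forall s, -1 < s -> continuous phi s) ->
  continuous (kernel j phi w) t.
Proof.
  intros Hw Ht Hphi. unfold kernel.
  assert (0 <= eps * t) by (apply Rmult_le_pos; lra).
  apply (continuous_mult (K := R_AbsRing)); [apply (continuous_mult (K := R_AbsRing))|].
  - unfold weight. apply (continuous_mult (K := R_AbsRing)); [apply (continuous_mult (K := R_AbsRing))|].
    + eapply continuous_of_derive. auto_derive; [exact I|reflexivity].
    + now apply continuous_Rpower.
    + apply (continuous_comp (fun t => 1 + eps * t) (fun u => Rpower u g)).
      * eapply continuous_of_derive. auto_derive; [exact I|reflexivity].
      * apply continuous_Rpower. lra.
  - unfold dilation. eapply continuous_of_derive. auto_derive; [exact I|reflexivity].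
  - apply (continuous_comp (arg w) phi).
    + unfold arg. eapply continuous_of_derive. auto_derive; [exact I|reflexivity].
    + apply Hphi. generalize (arg_nonneg w t Hw Ht). lra.
Qed.

Lemma kernel_dominated (j : nat) (phi : R -> R) (w : R) : 0 <= w ->
  (forall s, -1 < s -> continuous phi s) -> poly_bounded phi ->
  dominated c (kernel j phi w).
Proof.
  intros Hw Hphi [C [N [HC HN]]]. split; [intros; now apply kernel_continuous|].
  destruct (kernel_bound w j N Hw) as [K [HK HK2]].
  exists (C * K). intros t Ht. unfold kernel.
  assert (Ha := arg_nonneg w t Hw Ht).
  assert (Hd : 0 <= weight t * dilation t ^ j).
  { apply Rmult_le_pos; [left; apply weight_pos|]. apply pow_le. unfold dilation.
    apply Rmult_le_pos; [lra|]. assert (0 <= eps * t) by (apply Rmult_le_pos; lra). lra. }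
  rewrite Rabs_mult, (Rabs_pos_eq (weight t * _)) by exact Hd.
  apply Rle_trans with (C * (weight t * dilation t ^ j * (1 + arg w t) ^ N)).
  - replace (C * (weight t * dilation t ^ j * (1 + arg w t) ^ N))
      with (weight t * dilation t ^ j * (C * (1 + arg w t) ^ N)) by ring.
    apply Rmult_le_compat_l; [exact Hd|]. now apply HN.
  - rewrite (Rmult_assoc C K). apply Rmult_le_compat_l; [exact HC|].
    apply (HK2 t w); [exact Ht|lra|]. split; [apply pow_le; lra|lra].
Qed.

Definition laplace (j : nat) (phi : R -> R) (w : R) : R := half_line_int (kernel j phi w).

Lemma laplace_is (j : nat) (phi : R -> R) (w : R) : 0 <= w ->
  (forall s, -1 < s -> continuous phi s) -> poly_bounded phi ->
  is_RInt_gen (kernel j phi w) (at_right 0) (Rbar_locally p_infty) (laplace j phi w).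
Proof. intros. apply dominated_is with c; [exact Hc|]. now apply kernel_dominated. Qed.

Lemma arg_minus w w' t : arg w' t - arg w t = (w' - w) * dilation t.
Proof. unfold arg, dilation. ring. Qed.

Lemma arg_between w w' W t xi : 0 < t -> 0 <= w <= W -> 0 <= w' <= W ->
  Rmin (arg w t) (arg w' t) <= xi <= Rmax (arg w t) (arg w' t) -> 0 <= xi <= arg W t.
Proof.
  intros Ht Hw Hw' Hxi.
  assert (0 <= dilation t).
  { unfold dilation. apply Rmult_le_pos; [lra|].
    assert (0 <= eps * t) by (apply Rmult_le_pos; lra). lra. }
  generalize (arg_nonneg w t ltac:(lra) Ht) (arg_nonneg w' t ltac:(lra) Ht)
     (arg_minus w W t) (arg_minus w' W t); intros.
  assert (0 <= (W - w) * dilation t) by (apply Rmult_le_pos; lra).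
  assert (0 <= (W - w') * dilation t) by (apply Rmult_le_pos; lra).
  unfold Rmin, Rmax in Hxi. repeat destruct Rle_dec; lra.
Qed.

(** By the mean value theorem the difference of the integrands is dominated by a multiple
    of [|w' - w|]; unlike differentiability, this includes the endpoint [w = 0]. *)
Lemma laplace_lipschitz (j : nat) (phi phi1 : R -> R) (W : R) : 0 <= W ->
  (forall s, -1 < s -> is_derive phi s (phi1 s)) ->
  poly_bounded phi -> poly_bounded phi1 ->
  exists K, forall w w', 0 <= w <= W -> 0 <= w' <= W ->
    Rabs (laplace j phi w' - laplace j phi w) <= K * Rabs (w' - w).
Proof.
  intros HW Hphi Hb [C [N [HC HN]]].
  assert (Hcont : forall s, -1 < s -> continuous phi s).
  { intros s Hs. eapply continuous_of_derive. now apply Hphi. }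
  destruct (kernel_bound W (S j) N HW) as [K [HK HK2]].
  exists (C * K / c). intros w w' Hw Hw'.
  assert (X : is_RInt_gen (fun t => kernel j phi w' t - kernel j phi w t)
      (at_right 0) (Rbar_locally p_infty) (laplace j phi w' - laplace j phi w)).
  { apply (is_RInt_gen_minus (V := R_NormedModule) (kernel j phi w') (kernel j phi w));
    apply laplace_is; (lra || assumption). }
  rewrite <- (half_line_int_unique _ _ X).
  replace (C * K / c * Rabs (w' - w)) with (C * K * Rabs (w' - w) / c) by (field; lra).
  apply dominated_int_le; [exact Hc| |].
  - intros t Ht. apply (continuous_minus (V := R_NormedModule)); apply kernel_continuous; (lra || assumption).
  - intros t Ht. unfold kernel.
    assert (Hd : 0 <= dilation t).
    { unfold dilation. apply Rmult_le_pos; [lra|].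
      assert (0 <= eps * t) by (apply Rmult_le_pos; lra). lra. }
    destruct (mvt_is_derive phi phi1 (arg w t) (arg w' t)) as [xi [Hxi E]].
    { intros x Hx. apply Hphi. generalize (arg_between w w' W t x Ht Hw Hw' Hx). lra. }
    assert (Hxi2 := arg_between w w' W t xi Ht Hw Hw' Hxi).
    rewrite <- Rmult_minus_distr_l, E, arg_minus.
    replace (weight t * dilation t ^ j * (phi1 xi * ((w' - w) * dilation t)))
      with (weight t * dilation t ^ S j * (phi1 xi * (w' - w))) by (simpl; ring).
    assert (Hd2 : 0 <= weight t * dilation t ^ S j).
    { apply Rmult_le_pos; [left; apply weight_pos|now apply pow_le]. }
    rewrite Rabs_mult, (Rabs_pos_eq _ Hd2), Rabs_mult.
    apply Rle_trans with (weight t * dilation t ^ S j * (1 + arg W t) ^ N * (C * Rabs (w' - w))).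
    + replace (weight t * dilation t ^ S j * (1 + arg W t) ^ N * (C * Rabs (w' - w)))
        with (weight t * dilation t ^ S j * (C * (1 + arg W t) ^ N * Rabs (w' - w))) by ring.
      apply Rmult_le_compat_l; [exact Hd2|]. apply Rmult_le_compat_r; [apply Rabs_pos|].
      eapply Rle_trans; [apply HN; lra|].
      apply Rmult_le_compat_l; [exact HC|]. apply pow_incr. lra.
    + replace (C * K * Rabs (w' - w) * majorant c t) with (K * majorant c t * (C * Rabs (w' - w))) by ring.
      apply Rmult_le_compat_r; [apply Rmult_le_pos; [exact HC|apply Rabs_pos]|].
      apply (HK2 t W); [exact Ht|lra|]. split; [|lra]. apply pow_le.
      generalize (arg_nonneg W t HW Ht). lra.
Qed.

Lemma is_derive_of_quadratic (f : R -> R) (x l d K : R) : 0 < d ->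
  (forall y, Rabs (y - x) < d -> Rabs (f y - f x - (y - x) * l) <= K * (y - x) ^ 2) ->
  is_derive f x l.
Proof.
  intros Hd H. apply is_derive_Reals. intros e He.
  set (K' := Rabs K + 1). assert (HK : 0 < K') by (unfold K'; generalize (Rabs_pos K); lra).
  assert (Hd' : 0 < Rmin d (e / K')).
  { apply Rmin_pos; [exact Hd|]. apply Rdiv_lt_0_compat; lra. }
  exists (mkposreal _ Hd'). intros h Hh0 Hh. simpl in Hh.
  assert (Hhd : Rabs h < d) by (eapply Rlt_le_trans; [exact Hh|apply Rmin_l]).
  assert (Hhe : Rabs h < e / K') by (eapply Rlt_le_trans; [exact Hh|apply Rmin_r]).
  assert (X := H (x + h)). replace (x + h - x) with h in X by ring. specialize (X Hhd).
  replace ((f (x + h) - f x) / h - l) with ((f (x + h) - f x - h * l) / h) by (field; exact Hh0).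
  unfold Rdiv. rewrite Rabs_mult, Rabs_inv.
  assert (Hp : 0 < Rabs h) by now apply Rabs_pos_lt.
  apply Rmult_lt_reg_r with (Rabs h); [exact Hp|].
  rewrite Rmult_assoc, Rinv_l, Rmult_1_r by lra.
  apply Rle_lt_trans with (K' * (Rabs h * Rabs h)).
  - eapply Rle_trans; [exact X|]. rewrite <- Rabs_mult.
    replace (h ^ 2) with (h * h) by ring. rewrite (Rabs_pos_eq (h * h)) by nra.
    apply Rmult_le_compat_r; [nra|]. unfold K'. generalize (Rle_abs K). lra.
  - replace (e * Rabs h) with (K' * (e / K' * Rabs h)) by (field; lra).
    apply Rmult_lt_compat_l; [exact HK|]. apply Rmult_lt_compat_r; assumption.
Qed.

(** Differentiation under the integral sign: the Taylor remainder of order two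
    of the integrand is dominated by a multiple of [(w' - w)^2]. *)
Lemma is_derive_laplace (j : nat) (phi phi1 phi2 : R -> R) (w : R) : 0 < w ->
  (forall s, -1 < s -> is_derive phi s (phi1 s)) ->
  (forall s, -1 < s -> is_derive phi1 s (phi2 s)) ->
  poly_bounded phi -> poly_bounded phi1 -> poly_bounded phi2 ->
  is_derive (laplace j phi) w (laplace (S j) phi1 w).
Proof.
  intros Hw Hphi Hphi1 Hb Hb1 [C [N [HC HN]]].
  assert (Hcont : forall s, -1 < s -> continuous phi s).
  { intros s Hs. eapply continuous_of_derive. now apply Hphi. }
  assert (Hcont1 : forall s, -1 < s -> continuous phi1 s).
  { intros s Hs. eapply continuous_of_derive. now apply Hphi1. }
  set (W := 2 * w).
  destruct (kernel_bound W (S (S j)) N ltac:(unfold W; lra)) as [K [HK HK2]].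
  apply (is_derive_of_quadratic _ _ _ w (C * K / c) Hw). intros w' Hw'.
  apply Rabs_def2 in Hw'.
  assert (X : is_RInt_gen (fun t => kernel j phi w' t - kernel j phi w t
        - (w' - w) * kernel (S j) phi1 w t)
      (at_right 0) (Rbar_locally p_infty)
      (laplace j phi w' - laplace j phi w - (w' - w) * laplace (S j) phi1 w)).
  { apply (is_RInt_gen_minus (V := R_NormedModule)
       (fun t => kernel j phi w' t - kernel j phi w t) (fun t => (w' - w) * kernel (S j) phi1 w t)).
    - apply (is_RInt_gen_minus (V := R_NormedModule) (kernel j phi w') (kernel j phi w));
      apply laplace_is; (lra || assumption).
    - apply (is_RInt_gen_scal (V := R_NormedModule) (kernel (S j) phi1 w) (w' - w)).
      apply laplace_is; (lra || assumption). }
  rewrite <- (half_line_int_unique _ _ X).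
  replace (C * K / c * (w' - w) ^ 2) with (C * K * (w' - w) ^ 2 / c) by (field; lra).
  apply dominated_int_le; [exact Hc| |].
  - intros t Ht. apply (continuous_minus (V := R_NormedModule)).
    + apply (continuous_minus (V := R_NormedModule)); apply kernel_continuous; (lra || assumption).
    + apply (continuous_scal_r (V := R_NormedModule) (w' - w)).
      apply kernel_continuous; (lra || assumption).
  - intros t Ht. unfold kernel.
    assert (Hd : 0 <= dilation t).
    { unfold dilation. apply Rmult_le_pos; [lra|].
      assert (0 <= eps * t) by (apply Rmult_le_pos; lra). lra. }
    assert (Hw1 : 0 <= w <= W) by (unfold W; lra).
    assert (Hw2 : 0 <= w' <= W) by (unfold W; lra).
    destruct (mvt_is_derive phi phi1 (arg w t) (arg w' t)) as [xi [Hxi E]].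
    { intros x Hx. apply Hphi. generalize (arg_between w w' W t x Ht Hw1 Hw2 Hx). lra. }
    assert (Hxi3 : forall x, Rmin (arg w t) xi <= x <= Rmax (arg w t) xi ->
       Rmin (arg w t) (arg w' t) <= x <= Rmax (arg w t) (arg w' t)).
    { intros x. revert Hxi. unfold Rmin, Rmax. repeat destruct Rle_dec; lra. }
    destruct (mvt_is_derive phi1 phi2 (arg w t) xi) as [eta [Heta E2]].
    { intros x Hx. apply Hphi1.
      generalize (arg_between w w' W t x Ht Hw1 Hw2 (Hxi3 x Hx)). lra. }
    assert (Heta2 := arg_between w w' W t eta Ht Hw1 Hw2 (Hxi3 eta Heta)).
    replace (weight t * dilation t ^ j * phi (arg w' t) - weight t * dilation t ^ j * phi (arg w t) -
      (w' - w) * (weight t * dilation t ^ S j * phi1 (arg w t)))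
     with (weight t * dilation t ^ j * ((phi (arg w' t) - phi (arg w t))
        - (w' - w) * dilation t * phi1 (arg w t))) by (simpl; ring).
    rewrite E, arg_minus.
    replace (phi1 xi * ((w' - w) * dilation t) - (w' - w) * dilation t * phi1 (arg w t))
      with ((phi1 xi - phi1 (arg w t)) * ((w' - w) * dilation t)) by ring.
    rewrite E2.
    assert (Hd2 : 0 <= weight t * dilation t ^ S (S j)).
    { apply Rmult_le_pos; [left; apply weight_pos|now apply pow_le]. }
    assert (Hxd : Rabs (xi - arg w t) <= Rabs (w' - w) * dilation t).
    { rewrite <- (Rabs_pos_eq (dilation t)) by exact Hd. rewrite <- Rabs_mult, <- arg_minus.
      revert Hxi. unfold Rmin, Rmax, Rabs.
      repeat destruct Rle_dec; repeat destruct Rcase_abs; lra. }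
    assert (Hwt : 0 <= weight t * dilation t ^ j).
    { apply Rmult_le_pos; [left; apply weight_pos|now apply pow_le]. }
    rewrite !Rabs_mult, <- (Rabs_mult (weight t)), (Rabs_pos_eq _ Hwt), (Rabs_pos_eq _ Hd).
    assert (Hph : Rabs (phi2 eta) <= C * (1 + arg W t) ^ N).
    { eapply Rle_trans; [apply HN; lra|]. apply Rmult_le_compat_l; [exact HC|].
      apply pow_incr. lra. }
    apply Rle_trans with (weight t * dilation t ^ S (S j) * (1 + arg W t) ^ N * (C * (w' - w) ^ 2)).
    + replace (weight t * dilation t ^ S (S j) * (1 + arg W t) ^ N * (C * (w' - w) ^ 2))
        with (weight t * dilation t ^ j * ((C * (1 + arg W t) ^ N) * (Rabs (w' - w) * dilation t)
              * (Rabs (w' - w) * dilation t))).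
      2:{ rewrite <- (pow2_abs (w' - w)). simpl. ring. }
      apply Rmult_le_compat_l; [exact Hwt|].
      apply Rmult_le_compat_r; [apply Rmult_le_pos; [apply Rabs_pos|exact Hd]|].
      apply Rmult_le_compat; [apply Rabs_pos|apply Rabs_pos|exact Hph|exact Hxd].
    + replace (C * K * (w' - w) ^ 2 * majorant c t) with (K * majorant c t * (C * (w' - w) ^ 2)) by ring.
      apply Rmult_le_compat_r; [apply Rmult_le_pos; [exact HC|apply pow2_ge_0]|].
      apply (HK2 t W); [exact Ht|unfold W; lra|]. split; [|lra]. apply pow_le.
      generalize (arg_nonneg W t ltac:(unfold W; lra) Ht). lra.
Qed.

End Laplace.

Lemma squeeze_0 {T : Type} (F : (T -> Prop) -> Prop) {FF : Filter F} (f h : T -> R) :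
  F (fun x => Rabs (f x) <= h x) -> filterlim h F (locally 0) -> filterlim f F (locally 0).
Proof.
  intros H L. apply filterlim_locally. intros eps.
  assert (K := proj1 (filterlim_locally (U := R_UniformSpace) _ _) L eps).
  refine (filter_imp _ _ _ (filter_and _ _ H K)). intros x [H1 H2].
  unfold ball in *; simpl in *; unfold AbsRing_ball, abs, minus, plus, opp in *; simpl in *.
  rewrite Ropp_0, Rplus_0_r in *. eapply Rle_lt_trans; [exact H1|].
  eapply Rle_lt_trans; [apply Rle_abs|exact H2].
Qed.

Lemma half_line_pos (g : R -> R) (l : R) :
  (forall t, 0 < t -> continuous g t) -> (forall t, 0 < t -> 0 < g t) ->
  is_RInt_gen g (at_right 0) (Rbar_locally p_infty) l -> 0 < l.
Proof.
  intros Hc Hp H. assert (Hex := ex_RInt_half_line g Hc).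
  set (m := RInt g 1 2).
  assert (Hm : 0 < m).
  { apply RInt_gt_0; [lra|intros; apply Hp; lra|]. intros; apply Hc; lra. }
  apply Rnot_le_lt. intros Hl.
  assert (HP : locally l (fun y => y < m)).
  { apply (locally_of_interval (l - 1) m); [lra|]. intros; lra. }
  assert (Q : filter_prod (at_right 0) (Rbar_locally p_infty)
     (fun ab => 0 < fst ab < 1 /\ 2 < snd ab)).
  { apply (half_line_prod _ 1 2); [lra|]. simpl. auto. }
  assert (Q2 : filter_prod (at_right 0) (Rbar_locally p_infty)
     (fun ab => exists y, is_RInt g (fst ab) (snd ab) y /\ y < m)) by exact (H _ HP).
  destruct (filter_ex _ (filter_and _ _ Q Q2)) as [[a b] [[Ha Hb] [y [Hy Hym]]]]; simpl in *.
  apply (is_RInt_unique (V := R_CompleteNormedModule) g a b y) in Hy.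
  assert (E : RInt g a b = RInt g a 1 + RInt g 1 2 + RInt g 2 b).
  { rewrite <- (RInt_Chasles g a 2 b) by (apply Hex; lra).
    rewrite <- (RInt_Chasles g a 1 2) by (apply Hex; lra). reflexivity. }
  assert (0 <= RInt g a 1).
  { apply RInt_ge_0; [lra|apply Hex; lra|]. intros; left; apply Hp; lra. }
  assert (0 <= RInt g 2 b).
  { apply RInt_ge_0; [lra|apply Hex; lra|]. intros; left; apply Hp; lra. }
  fold m in E. lra.
Qed.

(** * The confluent equation satisfied by the Laplace integral *)

Section Confluent.

Variables A B c eps : R.
Hypothesis Hc : 0 < c.
Hypothesis Heps : 0 <= eps.

(** The integral of the product formula, up to elementary factors, and its
    [w]-derivatives. *)
Definition conf_int (j : nat) (w : R) : R :=
  laplace (A - c) c eps j (hyp_fun A B c j) w.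

Lemma hyp_fun_continuous n s : -1 < s -> continuous (hyp_fun A B c n) s.
Proof. intros Hs. eapply continuous_of_derive. now apply hyp_fun_chain. Qed.

Lemma conf_int_is j w : 0 <= w ->
  is_RInt_gen (kernel (A - c) c eps j (hyp_fun A B c j) w)
    (at_right 0) (Rbar_locally p_infty) (conf_int j w).
Proof.
  intros Hw. apply (laplace_is (A - c) c eps Hc Heps); [exact Hw| |].
  - apply hyp_fun_continuous.
  - now apply hyp_fun_poly_bounded.
Qed.

Lemma conf_int_derive j w : 0 < w -> is_derive (conf_int j) w (conf_int (S j) w).
Proof.
  intros Hw. apply (is_derive_laplace (A - c) c eps Hc Heps j (hyp_fun A B c j)
     (hyp_fun A B c (S j)) (hyp_fun A B c (S (S j))) w Hw);
    (intros; now apply hyp_fun_chain) || now apply hyp_fun_poly_bounded.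
Qed.

Lemma conf_int_lipschitz : exists K, forall w, 0 <= w <= 1 ->
  Rabs (conf_int 0 w - conf_int 0 0) <= K * w.
Proof.
  destruct (laplace_lipschitz (A - c) c eps Hc Heps 0 (hyp_fun A B c 0) (hyp_fun A B c 1) 1)
    as [K HK]; try lra; try (now apply hyp_fun_poly_bounded).
  { intros; now apply hyp_fun_chain. }
  exists K. intros w Hw. eapply Rle_trans; [apply HK; lra|].
  rewrite Rminus_0_r, Rabs_pos_eq; lra.
Qed.

(** Minus this function is an antiderivative in [t] of the integrand of
    [w^2 V'' + ((A + 1) w + 1) V' + B V], where [V = conf_int 0]. *)
Let flux (w t : R) : R := kernel (A - c) c eps 1 (hyp_fun A B c 1) w t.

(** The hypergeometric equation at [arg w t] eliminates [B F]; what is left is an identity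
    between the coefficients of [F'] and [F'']. *)
Lemma flux_derive w t : 0 <= w -> 0 < t ->
  is_derive (fun t => - flux w t) t
   (w ^ 2 * kernel (A - c) c eps 2 (hyp_fun A B c 2) w t
    + (((A + 1) * w + 1) * kernel (A - c) c eps 1 (hyp_fun A B c 1) w t
    + B * kernel (A - c) c eps 0 (hyp_fun A B c 0) w t)).
Proof.
  intros Hw Ht.
  assert (H0 : 0 <= eps * t) by (apply Rmult_le_pos; lra).
  assert (Ha : 0 <= arg eps w t) by now apply arg_nonneg.
  assert (Hwt : is_derive (weight (A - c) c eps) t
     (weight (A - c) c eps t * (-1 + (c - 1) / t + eps * (A - c) / (1 + eps * t)))).
  { unfold weight. evar_last.
    - apply (is_derive_mult (fun t => exp (- t) * Rpower t (c - 1))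
               (fun t => Rpower (1 + eps * t) (A - c))); [| |intros; apply Rmult_comm].
      + apply (is_derive_mult (fun t => exp (- t)) (fun t => Rpower t (c - 1)));
          [| |intros; apply Rmult_comm].
        * auto_derive; [exact I|reflexivity].
        * now apply is_derive_Rpower.
      + apply (is_derive_comp (fun u => Rpower u (A - c)) (fun t => 1 + eps * t)).
        * apply is_derive_Rpower. lra.
        * auto_derive; [exact I|reflexivity].
    - unfold plus, mult, scal; simpl; unfold mult; simpl.
      rewrite (Rpower_minus1 t (c - 1)), (Rpower_minus1 (1 + eps * t)) by lra. field. lra. }
  assert (HF : is_derive (fun t => hyp_fun A B c 1 (arg eps w t)) t
     ((w * (1 + eps * t) + eps * (1 + t * w)) * hyp_fun A B c 2 (arg eps w t))).
  { evar_last.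
    - apply (is_derive_comp (hyp_fun A B c 1) (arg eps w)).
      + apply hyp_fun_chain; [exact Hc|lra].
      + unfold arg. auto_derive; [exact I|reflexivity].
    - unfold scal; simpl; unfold mult; simpl. ring. }
  unfold flux, kernel. evar_last.
  - apply (is_derive_opp (V := R_NormedModule)).
    apply (is_derive_mult (fun t => weight (A - c) c eps t * dilation eps t ^ 1)
             (fun t => hyp_fun A B c 1 (arg eps w t))); [|exact HF|intros; apply Rmult_comm].
    apply (is_derive_mult (weight (A - c) c eps) (fun t => dilation eps t ^ 1));
      [exact Hwt| |intros; apply Rmult_comm].
    unfold dilation. auto_derive; [exact I|reflexivity].
  - destruct (hyp_fun_sol A B c Hc (arg eps w t)) as [_ [_ E]]; [lra|].
    unfold plus, mult, opp; simpl.
    set (F0 := hyp_fun A B c 0 (arg eps w t)) in *.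
    set (F1 := hyp_fun A B c 1 (arg eps w t)) in *.
    set (F2 := hyp_fun A B c 2 (arg eps w t)) in *.
    set (q := weight (A - c) c eps t).
    replace (B * (q * 1 * F0)) with (q * (B * F0)) by ring.
    replace (B * F0) with (- (arg eps w t * (1 + arg eps w t) * F2
       + (c + (A + 1) * arg eps w t) * F1)) by lra.
    unfold arg, dilation. field. lra.
Qed.

(** The two bounds make the boundary terms vanish at [0] and at infinity. *)
Lemma flux_bound w : 0 <= w -> exists K, forall t, 0 < t ->
  Rabs (flux w t) <= K * Rpower t c /\ Rabs (flux w t) <= K * / t.
Proof.
  intros Hw. destruct (hyp_fun_poly_bounded A B c 1 Hc) as [C [N [HC HN]]].
  destruct (kernel_bound (A - c) c eps Hc Heps w 0 (S N) Hw) as [K [HK HK2]].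
  exists (C * K). intros t Ht.
  assert (H0 : 0 <= eps * t) by (apply Rmult_le_pos; lra).
  assert (H0' : 0 <= t * w) by (apply Rmult_le_pos; lra).
  assert (Ha : 0 <= arg eps w t) by now apply arg_nonneg.
  assert (X : Rabs (flux w t) <= C * K * (t * majorant c t)).
  { unfold flux, kernel.
    assert (Hq := weight_pos (A - c) c eps t).
    assert (Hd : 0 <= dilation eps t) by (unfold dilation; apply Rmult_le_pos; lra).
    rewrite pow_1, !Rabs_mult, (Rabs_pos_eq (weight _ _ _ _)), (Rabs_pos_eq _ Hd) by lra.
    apply Rle_trans with (weight (A - c) c eps t * dilation eps t * (C * (1 + arg eps w t) ^ N)).
    - apply Rmult_le_compat_l; [apply Rmult_le_pos; lra|]. now apply HN.
    - assert (Y := HK2 t w ((1 + eps * t) * (1 + arg eps w t) ^ N) Ht ltac:(lra)).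
      rewrite pow_O, Rmult_1_r in Y.
      replace (weight (A - c) c eps t * dilation eps t * (C * (1 + arg eps w t) ^ N))
        with (C * t * (weight (A - c) c eps t * ((1 + eps * t) * (1 + arg eps w t) ^ N)))
        by (unfold dilation; ring).
      replace (C * K * (t * majorant c t)) with (C * t * (K * majorant c t)) by ring.
      apply Rmult_le_compat_l; [apply Rmult_le_pos; lra|]. apply Y.
      assert (0 <= (1 + arg eps w t) ^ N) by (apply pow_le; lra).
      split; [apply Rmult_le_pos; lra|].
      rewrite <- tech_pow_Rmult. apply Rmult_le_compat_r; [assumption|].
      unfold arg. nra. }
  assert (HCK : 0 <= C * K) by (apply Rmult_le_pos; lra).
  assert (Hp : 0 < Rpower t c) by apply Rpower_pos.
  assert (E : t * majorant c t = Rpower t c * Rpower (1 + t) (- c - 1)).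
  { unfold majorant. rewrite Rpower_minus1 by lra. field. lra. }
  rewrite E in X.
  assert (E2 : Rpower (1 + t) (- c - 1) = / (Rpower (1 + t) c * (1 + t))).
  { replace (- c - 1) with (- (c + 1)) by ring. rewrite Rpower_Ropp, Rpower_plus1 by lra.
    reflexivity. }
  assert (H1 : 1 <= Rpower (1 + t) c).
  { apply Rle_trans with (Rpower (1 + t) 0); [rewrite Rpower_O; lra|apply Rle_Rpower; lra]. }
  split; eapply Rle_trans; try exact X; apply Rmult_le_compat_l; try exact HCK; rewrite E2.
  - rewrite <- (Rmult_1_r (Rpower t c)) at 2. apply Rmult_le_compat_l; [lra|].
    apply Rle_trans with (/ 1); [|rewrite Rinv_1; lra]. apply Rinv_le_contravar; nra.
  - assert (Rpower t c <= Rpower (1 + t) c).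
    { apply Rle_Rpower_l; lra. }
    apply Rmult_le_reg_r with (t * (Rpower (1 + t) c * (1 + t))); [apply Rmult_lt_0_compat; nra|].
    replace (Rpower t c * / (Rpower (1 + t) c * (1 + t)) * (t * (Rpower (1 + t) c * (1 + t))))
      with (Rpower t c * t) by (field; lra).
    replace (/ t * (t * (Rpower (1 + t) c * (1 + t)))) with (Rpower (1 + t) c * (1 + t))
      by (field; lra).
    apply Rmult_le_compat; lra.
Qed.

Lemma conf_int_equation w : 0 < w ->
  w ^ 2 * conf_int 2 w + ((A + 1) * w + 1) * conf_int 1 w + B * conf_int 0 w = 0.
Proof.
  intros Hw. destruct (flux_bound w ltac:(lra)) as [K HK].
  set (df := fun t => w ^ 2 * kernel (A - c) c eps 2 (hyp_fun A B c 2) w t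
    + (((A + 1) * w + 1) * kernel (A - c) c eps 1 (hyp_fun A B c 1) w t
    + B * kernel (A - c) c eps 0 (hyp_fun A B c 0) w t)).
  assert (I1 : is_RInt_gen df (at_right 0) (Rbar_locally p_infty) (0 - 0)).
  { apply (is_RInt_gen_half_line (fun t => - flux w t)).
    - intros t Ht. apply flux_derive; lra.
    - intros t Ht. unfold df.
      assert (Hk : forall k j, continuous (fun t => k * kernel (A - c) c eps j (hyp_fun A B c j) w t) t).
      { intros k j. apply (continuous_scal_r (V := R_NormedModule) k).
        apply kernel_continuous; [exact Heps|lra|exact Ht|apply hyp_fun_continuous]. }
      repeat apply (continuous_plus (V := R_NormedModule)); apply Hk.
    - apply (squeeze_0 (at_right 0) _ (fun t => K * Rpower t c)).
      + exists (mkposreal 1 Rlt_0_1). intros t _ Ht. rewrite Rabs_Ropp. now apply HK.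
      + replace (locally 0) with (locally (K * 0)) by (f_equal; ring).
        apply (filterlim_comp _ _ _ (fun s => Rpower s c) (fun y => K * y) _ (locally 0));
          [now apply filterlim_Rpower_0 | apply (filterlim_scal_r K 0)].
    - apply (squeeze_0 (Rbar_locally p_infty) _ (fun t => K * / t)).
      + exists 0. intros t Ht. rewrite Rabs_Ropp. now apply HK.
      + replace (locally 0) with (locally (K * 0)) by (f_equal; ring).
        apply (filterlim_comp _ _ _ Rinv (fun y => K * y) _ (locally 0));
          [|apply (filterlim_scal_r K 0)].
        eapply filterlim_filter_le_2; [|apply filterlim_inv_infty].
        apply filter_le_within. }
  assert (I2 : is_RInt_gen df (at_right 0) (Rbar_locally p_infty)
     (w ^ 2 * conf_int 2 w + (((A + 1) * w + 1) * conf_int 1 w + B * conf_int 0 w))).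
  { assert (Hk : forall k j, is_RInt_gen (fun t => k * kernel (A - c) c eps j (hyp_fun A B c j) w t)
       (at_right 0) (Rbar_locally p_infty) (k * conf_int j w)).
    { intros k j. apply (is_RInt_gen_scal (V := R_NormedModule) _ k). apply conf_int_is. lra. }
    apply (is_RInt_gen_plus (V := R_NormedModule)); [apply Hk|].
    apply (is_RInt_gen_plus (V := R_NormedModule)); apply Hk. }
  apply half_line_int_unique in I1. apply half_line_int_unique in I2. lra.
Qed.

End Confluent.

(** * Whittaker's equation *)

Definition wh_sol (alpha tau : R) (u u1 u2 : R -> R) : Prop :=
  forall x, 0 < x ->
    is_derive u x (u1 x) /\ is_derive u1 x (u2 x) /\
    u2 x + (alpha / x - 1 / 4 + (1 / 4 + tau * tau) / (x * x)) * u x = 0.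

Definition envelope (alpha x : R) : R := Rpower x alpha * exp (- x / 2).

Lemma envelope_pos alpha x : 0 < envelope alpha x.
Proof. apply Rmult_lt_0_compat; [apply Rpower_pos|apply exp_pos]. Qed.

Lemma envelope_bounded alpha : exists K, forall x, 1 <= x -> envelope alpha x <= K.
Proof.
  destruct (INR_unbounded (Rabs alpha)) as [m Hm].
  destruct (exp_beats_powers 1 m Rlt_0_1) as [K [HK HK2]].
  exists (2 ^ m * K). intros x Hx. unfold envelope.
  assert (X := HK2 (x / 2) ltac:(lra)).
  assert (Y : Rpower (1 + x / 2) (Ropp 1 - 1) <= 1).
  { apply Rle_trans with (Rpower (1 + x / 2) 0);
      [apply Rle_Rpower; lra|rewrite Rpower_O; lra]. }
  assert (Z : Rpower x alpha <= 2 ^ m * (1 + x / 2) ^ m).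
  { rewrite <- Rpow_mult_distr. apply Rle_trans with (x ^ m).
    - rewrite <- Rpower_pow by lra. apply Rle_Rpower; [lra|]. generalize (Rle_abs alpha). lra.
    - apply pow_incr. lra. }
  assert (0 < 2 ^ m) by (apply pow_lt; lra).
  replace (- x / 2) with (- (x / 2)) by field.
  apply Rle_trans with (2 ^ m * (exp (- (x / 2)) * (1 + x / 2) ^ m)).
  - replace (2 ^ m * (exp (- (x / 2)) * (1 + x / 2) ^ m))
      with (2 ^ m * (1 + x / 2) ^ m * exp (- (x / 2))) by ring.
    apply Rmult_le_compat_r; [left; apply exp_pos|exact Z].
  - apply Rmult_le_compat_l; [lra|]. eapply Rle_trans; [exact X|].
    rewrite <- (Rmult_1_r K) at 2. apply Rmult_le_compat_l; lra.
Qed.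

(** Gronwall backwards from [b] for [d^2 + d'^2]. *)
Lemma wh_zero_backward alpha tau d d1 d2 a b :
  wh_sol alpha tau d d1 d2 -> 0 < a <= b -> d b = 0 -> d1 b = 0 -> d a = 0.
Proof.
  intros H Hab Hb Hb1.
  set (Q := fun x => alpha / x - 1 / 4 + (1 / 4 + tau * tau) / (x * x)).
  set (K := 2 + Rabs alpha / a + (1 / 4 + tau * tau) / (a * a)).
  set (e := fun x => (d x * d x + d1 x * d1 x) * exp (K * x)).
  assert (Hd : forall x, a <= x <= b -> is_derive e x
     ((2 * d x * d1 x * (1 - Q x) + K * (d x * d x + d1 x * d1 x)) * exp (K * x))).
  { intros x Hx. destruct (H x ltac:(lra)) as [H0 [H1 E]]. fold (Q x) in E. unfold e. evar_last.
    - apply (is_derive_mult (fun x => d x * d x + d1 x * d1 x) (fun x => exp (K * x)));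
        [| |intros; apply Rmult_comm].
      + apply (is_derive_plus (V := R_NormedModule)).
        * apply (is_derive_mult d d); [exact H0|exact H0|intros; apply Rmult_comm].
        * apply (is_derive_mult d1 d1); [exact H1|exact H1|intros; apply Rmult_comm].
      + auto_derive; [exact I|reflexivity].
    - unfold plus, mult; simpl. replace (d2 x) with (- (Q x * d x)) by lra. ring. }
  assert (HQ : forall x, a <= x <= b -> 1 + Rabs (Q x) <= K).
  { intros x Hx. unfold Q, K.
    assert (0 < / x) by (apply Rinv_0_lt_compat; lra).
    assert (/ x <= / a) by (apply Rinv_le_contravar; lra).
    assert (T1 : Rabs (alpha / x) <= Rabs alpha / a).
    { unfold Rdiv. rewrite Rabs_mult, (Rabs_pos_eq (/ x)) by lra.
      apply Rmult_le_compat_l; [apply Rabs_pos|lra]. }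
    assert (T2 : 0 <= (1 / 4 + tau * tau) / (x * x) <= (1 / 4 + tau * tau) / (a * a)).
    { assert (0 <= 1 / 4 + tau * tau) by nra. split.
      - apply Rmult_le_pos; [assumption|left; apply Rinv_0_lt_compat; nra].
      - apply Rmult_le_compat_l; [assumption|]. apply Rinv_le_contravar; nra. }
    apply Rabs_le_between in T1.
    assert (Rabs (alpha / x - 1 / 4 + (1 / 4 + tau * tau) / (x * x))
       <= 1 + Rabs alpha / a + (1 / 4 + tau * tau) / (a * a)); [|lra].
    apply Rabs_le. lra. }
  assert (Hle : e a <= e b).
  { refine (derive_ge0_le e _ a b (proj2 Hab) Hd _). intros x Hx.
    apply Rmult_le_pos; [|left; apply exp_pos].
    assert (X := HQ x Hx).
    assert (Y : Rabs (1 - Q x) <= K).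
    { eapply Rle_trans; [|exact X]. unfold Rminus. eapply Rle_trans; [apply Rabs_triang|].
      rewrite Rabs_R1, Rabs_Ropp. lra. }
    apply Rabs_le_between in Y.
    generalize (d x) (d1 x) (1 - Q x) Y; intros p q k Hk.
    assert (0 <= (K - k) * ((p - q) * (p - q))) by (apply Rmult_le_pos; [lra|apply Rle_0_sqr]).
    assert (0 <= (K + k) * ((p + q) * (p + q))) by (apply Rmult_le_pos; [lra|apply Rle_0_sqr]).
    lra. }
  unfold e in Hle. rewrite Hb, Hb1 in Hle.
  replace ((0 * 0 + 0 * 0) * exp (K * b)) with 0 in Hle by ring.
  assert (Hp : 0 < exp (K * a)) by apply exp_pos.
  assert (d a * d a + d1 a * d1 a <= 0) by nra.
  nra.
Qed.

(** If the Wronskian [om] of [d] and [u] were nonzero, the increments of [d / u]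
    over unit intervals would be bounded away from [0], since [(d / u)' = - om / u^2] and [u] is
    bounded, whereas [d / u] tends to [0].  Hence [om = 0], so [d / u] is constant near
    infinity, and the constant is [0]; backward uniqueness then gives [d = 0]. *)
Lemma wh_recessive_unique alpha tau u u1 u2 d d1 d2 :
  wh_sol alpha tau u u1 u2 -> wh_sol alpha tau d d1 d2 ->
  filterlim (fun x => u x / envelope alpha x) (Rbar_locally p_infty) (locally 1) ->
  filterlim (fun x => d x / envelope alpha x) (Rbar_locally p_infty) (locally 0) ->
  forall x, 0 < x -> d x = 0.
Proof.
  intros Hu Hd Lu Ld.
  set (om := d 1 * u1 1 - d1 1 * u 1).
  assert (Hom : forall x, 0 < x -> d x * u1 x - d1 x * u x = om).
  { intros x Hx.
    destruct (mvt_is_derive (fun x => d x * u1 x - d1 x * u x) (fun _ => 0) 1 x) as [xi [_ E]].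
    - intros z Hz. assert (Hz0 : 0 < z).
      { generalize (Rmin_pos 1 x Rlt_0_1 Hx). lra. }
      destruct (Hu z Hz0) as [U0 [U1 UE]]. destruct (Hd z Hz0) as [D0 [D1 DE]]. evar_last.
      + apply (is_derive_minus (V := R_NormedModule)).
        * apply (is_derive_mult d u1); [exact D0|exact U1|intros; apply Rmult_comm].
        * apply (is_derive_mult d1 u); [exact D1|exact U0|intros; apply Rmult_comm].
      + unfold minus, plus, opp, mult; simpl.
        set (q := alpha / z - 1 / 4 + (1 / 4 + tau * tau) / (z * z)) in *.
        replace (u2 z) with (- (q * u z)) by lra. replace (d2 z) with (- (q * d z)) by lra. ring.
    - unfold om. lra. }
  destruct (envelope_bounded alpha) as [K0 HK0].
  set (L := Rabs K0 + 1).
  assert (HL : 1 <= L) by (unfold L; generalize (Rabs_pos K0); lra).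
  (* eventually [u] differs from the envelope by less than half of it, hence is positive
     and bounded, and [d] is negligible with respect to the envelope *)
  assert (Hnear : forall eta, 0 < eta -> exists X, 1 <= X /\ forall x, X < x ->
     0 < u x <= 2 * L /\ Rabs (d x / u x) <= 2 * eta).
  { intros eta Heta.
    destruct (Lu (fun y => Rabs (y - 1) < 1 / 2)) as [X1 HX1].
    { exists (mkposreal (1 / 2) ltac:(lra)). intros y Hy. exact Hy. }
    destruct (Ld (fun y => Rabs (y - 0) < eta)) as [X2 HX2].
    { exists (mkposreal eta Heta). intros y Hy. exact Hy. }
    exists (Rmax 1 (Rmax X1 X2)). split; [apply Rmax_l|]. intros x Hx.
    assert (M1 := Rmax_l 1 (Rmax X1 X2)). assert (M2 := Rmax_r 1 (Rmax X1 X2)).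
    assert (M3 := Rmax_l X1 X2). assert (M4 := Rmax_r X1 X2).
    assert (A1 := HX1 x ltac:(lra)). assert (A2 := HX2 x ltac:(lra)).
    rewrite Rminus_0_r in A2. apply Rabs_def2 in A1.
    assert (He := envelope_pos alpha x). assert (HeL := HK0 x ltac:(lra)).
    set (E := envelope alpha x) in *.
    assert (Eu : u x = u x / E * E) by (field; lra).
    assert (Ed : d x / u x = (d x / E) / (u x / E)).
    { field. split; [lra|]. rewrite Eu. apply Rmult_integral_contrapositive; split; lra. }
    split.
    - rewrite Eu. generalize (Rle_abs K0). unfold L. intros. split; [apply Rmult_lt_0_compat; lra|].
      apply Rmult_le_compat; lra.
    - rewrite Ed. unfold Rdiv at 1. rewrite Rabs_mult, Rabs_inv, (Rabs_pos_eq (u x / E)) by lra.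
      rewrite Rmult_comm. apply Rmult_le_compat; [left; apply Rinv_0_lt_compat; lra|apply Rabs_pos| |lra].
      replace 2 with (/ (1 / 2)) by field. apply Rinv_le_contravar; lra. }
  assert (Hq : forall x, 0 < x -> u x <> 0 -> is_derive (fun x => d x / u x) x (- om / (u x * u x))).
  { intros x Hx Hux. evar_last.
    - apply (is_derive_div d u); [now apply Hd|now apply Hu|exact Hux].
    - rewrite <- (Hom x Hx). field. exact Hux. }
  assert (Hom0 : om = 0).
  { apply NNPP. intros Hne. assert (Hpos : 0 < Rabs om) by now apply Rabs_pos_lt.
    (* chosen so that [4 eta (2 L)^2 = |om| / 2] *)
    set (eta := Rabs om / (L * L * 32)).
    assert (Heta : 0 < eta) by (apply Rdiv_lt_0_compat; nra).
    destruct (Hnear eta Heta) as [X [HX1 HX]].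
    destruct (mvt_is_derive (fun x => d x / u x) (fun x => - om / (u x * u x)) (X + 1) (X + 2))
      as [xi [Hxi E]].
    { intros x. rewrite Rmin_left, Rmax_right by lra. intros Hx.
      apply Hq; [lra|]. generalize (proj1 (HX x ltac:(lra))). lra. }
    rewrite Rmin_left, Rmax_right in Hxi by lra.
    destruct (HX xi ltac:(lra)) as [[U1 U2] _].
    assert (B1 := proj2 (HX (X + 1) ltac:(lra))). assert (B2 := proj2 (HX (X + 2) ltac:(lra))).
    replace (X + 2 - (X + 1)) with 1 in E by ring. rewrite Rmult_1_r in E.
    assert (B3 : Rabs (- om / (u xi * u xi)) <= 4 * eta).
    { rewrite <- E. unfold Rminus. eapply Rle_trans; [apply Rabs_triang|]. rewrite Rabs_Ropp. lra. }
    unfold Rdiv in B3. rewrite Rabs_mult, Rabs_Ropp, Rabs_inv in B3.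
    rewrite (Rabs_pos_eq (u xi * u xi)) in B3 by nra.
    assert (B4 : Rabs om <= 4 * eta * (u xi * u xi)).
    { apply Rmult_le_reg_r with (/ (u xi * u xi)); [apply Rinv_0_lt_compat; nra|].
      rewrite Rmult_assoc, Rinv_r, Rmult_1_r by nra. exact B3. }
    assert (B5 : u xi * u xi <= 2 * L * (2 * L)) by (apply Rmult_le_compat; lra).
    assert (B6 : 4 * eta * (u xi * u xi) <= 4 * eta * (2 * L * (2 * L)))
      by (apply Rmult_le_compat_l; lra).
    replace (4 * eta * (2 * L * (2 * L))) with (Rabs om / 2) in B6 by (unfold eta; field; lra).
    lra. }
  destruct (Hnear 1 Rlt_0_1) as [X [HX1 HX]].
  assert (Hdinf : forall x, X < x -> d x = 0).
  { intros x Hx. apply NNPP. intros Hne.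
    assert (Hux : 0 < u x) by apply (HX x Hx).
    assert (Hk : d x / u x <> 0).
    { intros Z. apply Hne. replace (d x) with (d x / u x * u x) by (field; lra). rewrite Z. ring. }
    assert (Hpos : 0 < Rabs (d x / u x)) by now apply Rabs_pos_lt.
    destruct (Hnear (Rabs (d x / u x) / 4) ltac:(lra)) as [Y [HY1 HY]].
    set (z := Rmax x Y + 1). assert (Z1 := Rmax_l x Y). assert (Z2 := Rmax_r x Y).
    destruct (mvt_is_derive (fun x => d x / u x) (fun x => - om / (u x * u x)) x z) as [xi [Hxi E]].
    { intros t. unfold z. rewrite Rmin_left by lra. intros Ht. apply Hq; [lra|].
      generalize (proj1 (HX t ltac:(lra))). lra. }
    rewrite Hom0 in E. unfold Rdiv at 3 in E. rewrite Ropp_0, !Rmult_0_l in E.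
    assert (B := proj2 (HY z ltac:(unfold z; lra))).
    replace (d z / u z) with (d x / u x) in B by lra. lra. }
  intros x Hx. destruct (Rlt_dec X x) as [H|H]; [now apply Hdinf|].
  apply (wh_zero_backward alpha tau d d1 d2 x (X + 1) Hd); [lra|apply Hdinf; lra|].
  assert (D1 : is_derive d (X + 1) 0).
  { apply (is_derive_ext_loc (fun _ => 0)).
    - apply (locally_of_interval X (X + 2)); [lra|]. intros t Ht. symmetry. apply Hdinf. lra.
    - apply (is_derive_const (K := R_AbsRing) (V := R_NormedModule)). }
  apply is_derive_unique in D1.
  destruct (Hd (X + 1) ltac:(lra)) as [D2 _]. apply is_derive_unique in D2. lra.
Qed.

Section WhittakerIntegral.

Variables alpha tau c eps : R.
Hypothesis Hc : 0 < c.
Hypothesis Heps : 0 <= eps.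

Let V (j : nat) (w : R) : R :=
  conf_int (1 - 2 * alpha) ((1 / 2 - alpha) ^ 2 + tau ^ 2) c eps j w.

Definition wh_int (x : R) : R := envelope alpha x * V 0 (/ x).

Definition wh_int1 (x : R) : R :=
  envelope alpha x * ((alpha / x - 1 / 2) * V 0 (/ x) - V 1 (/ x) / (x * x)).

(** Substituting [w = 1 / x] and multiplying by the envelope turns the confluent equation
    into Whittaker's. *)
Lemma wh_int_sol : wh_sol alpha tau wh_int wh_int1
  (fun x => - ((alpha / x - 1 / 4 + (1 / 4 + tau * tau) / (x * x)) * wh_int x)).
Proof.
  intros x Hx.
  assert (HE : is_derive (envelope alpha) x (envelope alpha x * (alpha / x - 1 / 2))).
  { unfold envelope. evar_last.
    - apply (is_derive_mult (fun x => Rpower x alpha) (fun x => exp (- x / 2)));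
        [| |intros; apply Rmult_comm].
      + now apply is_derive_Rpower.
      + auto_derive; [exact I|reflexivity].
    - unfold plus, mult; simpl. change (- x * / 2) with (- x / 2). rewrite Rpower_minus1 by exact Hx. field. lra. }
  assert (HV : forall j, is_derive (fun x => V j (/ x)) x (- V (S j) (/ x) / (x * x))).
  { intros j.
    assert (HD : is_derive (V j) (/ x) (V (S j) (/ x))).
    { apply conf_int_derive; [exact Hc|exact Heps|]. now apply Rinv_0_lt_compat. }
    evar_last.
    - apply (is_derive_comp (V j) Rinv); [exact HD|]. auto_derive; [lra|reflexivity].
    - unfold scal; simpl; unfold mult; simpl. field. lra. }
  split; [|split].
  - unfold wh_int, wh_int1. evar_last.
    + apply (is_derive_mult (envelope alpha) (fun x => V 0 (/ x)));
        [exact HE|apply HV|intros; apply Rmult_comm].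
    + unfold plus, mult; simpl. field. lra.
  - unfold wh_int1. evar_last.
    + apply (is_derive_mult (envelope alpha)
         (fun x => (alpha / x - 1 / 2) * V 0 (/ x) - V 1 (/ x) / (x * x)));
        [exact HE| |intros; apply Rmult_comm].
      apply (is_derive_minus (V := R_NormedModule)).
      * apply (is_derive_mult (fun x => alpha / x - 1 / 2) (fun x => V 0 (/ x)));
          [|apply HV|intros; apply Rmult_comm].
        auto_derive; [lra|reflexivity].
      * apply (is_derive_div (fun x => V 1 (/ x)) (fun x => x * x)); [apply HV| |nra].
        auto_derive; [exact I|reflexivity].
    + assert (E := conf_int_equation (1 - 2 * alpha) ((1 / 2 - alpha) ^ 2 + tau ^ 2) c eps
        Hc Heps (/ x) ltac:(now apply Rinv_0_lt_compat)).
      fold (V 0 (/ x)) (V 1 (/ x)) (V 2 (/ x)) in E.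
      unfold wh_int, minus, plus, mult, opp; simpl.
      set (v0 := V 0 (/ x)) in *. set (v1 := V 1 (/ x)) in *. set (v2 := V 2 (/ x)) in *.
      replace v2 with (- (((1 - 2 * alpha + 1) * / x + 1) * v1
          + ((1 / 2 - alpha) ^ 2 + tau ^ 2) * v0) * (x * x)).
      2:{ replace v2 with ((/ x) ^ 2 * v2 * (x * x)) by (field; lra).
          replace ((/ x) ^ 2 * v2) with (- (((1 - 2 * alpha + 1) * / x + 1) * v1
          + ((1 / 2 - alpha) ^ 2 + tau ^ 2) * v0)) by lra. ring. }
      field. lra.
  - ring.
Qed.

Lemma wh_int_limit :
  filterlim (fun x => wh_int x / envelope alpha x) (Rbar_locally p_infty) (locally (V 0 0)).
Proof.
  apply (filterlim_ext (fun x => V 0 (/ x))).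
  { intros x. unfold wh_int. field. apply Rgt_not_eq, envelope_pos. }
  destruct (conf_int_lipschitz (1 - 2 * alpha) ((1 / 2 - alpha) ^ 2 + tau ^ 2) c eps Hc Heps)
    as [K HK].
  assert (L : filterlim (fun x => V 0 (/ x) - V 0 0) (Rbar_locally p_infty) (locally 0)).
  { apply (squeeze_0 (Rbar_locally p_infty) _ (fun t => K * / t)).
    - exists 1. intros t Ht. apply HK. split; [left; apply Rinv_0_lt_compat; lra|].
      rewrite <- Rinv_1. apply Rinv_le_contravar; lra.
    - replace (locally 0) with (locally (K * 0)) by (f_equal; ring).
      apply (filterlim_comp _ _ _ Rinv (fun y => K * y) _ (locally 0));
        [|apply (filterlim_scal_r K 0)].
      eapply filterlim_filter_le_2; [|apply filterlim_inv_infty].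
      apply filter_le_within. }
  apply (filterlim_ext (fun x => (V 0 (/ x) - V 0 0) + V 0 0)); [intros; ring|].
  replace (locally (V 0 0)) with (locally (0 + V 0 0)) by (f_equal; ring).
  apply (filterlim_comp_2 (F := Rbar_locally p_infty) (G := locally 0)
           (H := locally (V 0 0)) (fun x => V 0 (/ x) - V 0 0) (fun _ => V 0 0) Rplus).
  - exact L.
  - apply filterlim_const.
  - apply (filterlim_plus 0 (V 0 0)).
Qed.

End WhittakerIntegral.

(** * The product formula over the reals *)

Lemma Gamma_is (c : R) : 0 < c ->
  is_RInt_gen (fun t => Rpower t (c - 1) * exp (- t))
    (at_right 0) (Rbar_locally p_infty) (Gamma c).
Proof.
  intros Hc. apply (dominated_is c); [exact Hc|]. split.
  - intros t Ht. apply (continuous_mult (K := R_AbsRing)); [now apply continuous_Rpower|].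
    eapply continuous_of_derive. auto_derive; [exact I|reflexivity].
  - destruct (exp_beats_powers c 0 Hc) as [K [HK HK2]].
    exists K. intros t Ht. assert (X := HK2 t Ht). rewrite pow_O, Rmult_1_r in X.
    assert (Hp := Rpower_pos t (c - 1)). assert (He := exp_pos (- t)).
    rewrite Rabs_pos_eq by nra. unfold majorant.
    replace (K * (Rpower t (c - 1) * Rpower (1 + t) (- c - 1)))
      with (Rpower t (c - 1) * (K * Rpower (1 + t) (- c - 1))) by ring.
    apply Rmult_le_compat_l; lra.
Qed.

Lemma Gamma_pos (c : R) : 0 < c -> 0 < Gamma c.
Proof.
  intros Hc. apply (half_line_pos (fun t => Rpower t (c - 1) * exp (- t))); [| |now apply Gamma_is].
  - intros t Ht. apply (continuous_mult (K := R_AbsRing)); [now apply continuous_Rpower|].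
    eapply continuous_of_derive. auto_derive; [exact I|reflexivity].
  - intros t Ht. apply Rmult_lt_0_compat; [apply Rpower_pos|apply exp_pos].
Qed.

Lemma Rpower_1_base (p : R) : Rpower 1 p = 1.
Proof. unfold Rpower. now rewrite ln_1, Rmult_0_r, exp_0. Qed.

Lemma conf_int_0_0 A B c : 0 < c -> conf_int A B c 0 0 0 = Gamma c.
Proof.
  intros Hc. unfold conf_int, laplace. rewrite <- (half_line_int_unique _ _ (Gamma_is c Hc)).
  symmetry. apply half_line_int_ext; [|exists (Gamma c); now apply Gamma_is].
  intros t Ht. unfold kernel, weight, arg.
  replace ((1 + t * 0) * (1 + 0 * t) - 1) with 0 by ring.
  replace (1 + 0 * t) with 1 by ring.
  rewrite hyp_fun_0, Rpower_1_base by exact Hc. simpl. ring.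
Qed.

(** Euler's transformation exchanges the limit [w -> 0] of the integral with
    parameter [eps] and the integral with parameter [0] at [w = eps]. *)
Lemma conf_int_euler A B c p eps : 0 < c -> 0 <= eps -> A + p = c ->
  conf_int A B c eps 0 0 = conf_int (A + 2 * p) (B + p * c) c 0 0 eps.
Proof.
  intros Hc Heps HA.
  apply half_line_int_ext.
  2:{ exists (conf_int A B c eps 0 0). apply conf_int_is; (assumption || lra). }
  intros t Ht. unfold kernel, weight.
  assert (H0 : 0 <= eps * t) by (apply Rmult_le_pos; lra).
  replace (arg eps 0 t) with (eps * t) by (unfold arg; ring).
  replace (arg 0 eps t) with (eps * t) by (unfold arg; ring).
  rewrite (euler_transform A B c p (eps * t) Hc HA H0).
  replace (1 + 0 * t) with 1 by ring. rewrite Rpower_1_base.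
  replace (A - c) with (- p) by lra. rewrite Rpower_Ropp.
  simpl. field. apply Rgt_not_eq, Rpower_pos.
Qed.

(** The normalised solution for any value of the auxiliary parameter [c]; taking
    [c = 1 - alpha - beta] for both factors is what makes Euler's transformation apply. *)
Definition wh_real (alpha tau c x : R) : R := wh_int alpha tau c 0 x / Gamma c.

Definition wh_normalised (alpha tau : R) (u : R -> R) : Prop :=
  (exists u1 u2, wh_sol alpha tau u u1 u2) /\
  filterlim (fun x => u x / envelope alpha x) (Rbar_locally p_infty) (locally 1).

Lemma wh_sol_scal alpha tau k u u1 u2 : wh_sol alpha tau u u1 u2 ->
  wh_sol alpha tau (fun x => k * u x) (fun x => k * u1 x) (fun x => k * u2 x).
Proof.
  intros H x Hx. destruct (H x Hx) as [H0 [H1 E]].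
  split; [now apply is_derive_scal|]. split; [now apply is_derive_scal|].
  set (q := alpha / x - 1 / 4 + (1 / 4 + tau * tau) / (x * x)) in *.
  replace (k * u2 x + q * (k * u x)) with (k * (u2 x + q * u x)) by ring.
  rewrite E. ring.
Qed.

Lemma wh_sol_minus alpha tau u u1 u2 v v1 v2 :
  wh_sol alpha tau u u1 u2 -> wh_sol alpha tau v v1 v2 ->
  wh_sol alpha tau (fun x => u x - v x) (fun x => u1 x - v1 x) (fun x => u2 x - v2 x).
Proof.
  intros H H' x Hx. destruct (H x Hx) as [H0 [H1 E]]. destruct (H' x Hx) as [H0' [H1' E']].
  split; [now apply (is_derive_minus (V := R_NormedModule))|].
  split; [now apply (is_derive_minus (V := R_NormedModule))|].
  set (q := alpha / x - 1 / 4 + (1 / 4 + tau * tau) / (x * x)) in *.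
  replace (u2 x - v2 x + q * (u x - v x)) with ((u2 x + q * u x) - (v2 x + q * v x)) by ring.
  rewrite E, E'. ring.
Qed.

(** [wh_recessive_unique] applied to [v - k u]. *)
Lemma wh_proportional alpha tau u v v1 v2 k :
  wh_normalised alpha tau u -> wh_sol alpha tau v v1 v2 ->
  filterlim (fun x => v x / envelope alpha x) (Rbar_locally p_infty) (locally k) ->
  forall x, 0 < x -> v x = k * u x.
Proof.
  intros [[u1 [u2 Hu]] Lu] Hv Lv x Hx. apply Rminus_diag_uniq.
  apply (wh_recessive_unique alpha tau u u1 u2 (fun x => v x - k * u x)
           (fun x => v1 x - k * u1 x) (fun x => v2 x - k * u2 x) Hu); [|exact Lu| |exact Hx].
  - apply (wh_sol_minus _ _ _ _ _ (fun x => k * u x)); [exact Hv|now apply wh_sol_scal].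
  - apply (filterlim_ext (fun x => v x / envelope alpha x + (- k) * (u x / envelope alpha x))).
    { intros t. field. apply Rgt_not_eq, envelope_pos. }
    replace (locally 0) with (locally (k + (- k) * 1)) by (f_equal; ring).
    apply (filterlim_comp_2 (F := Rbar_locally p_infty) (G := locally k)
           (H := locally ((- k) * 1)) (fun x => v x / envelope alpha x)
           (fun x => (- k) * (u x / envelope alpha x)) Rplus).
    + exact Lv.
    + apply (filterlim_comp _ _ _ (fun x => u x / envelope alpha x) (fun y => (- k) * y)
               _ (locally 1)); [exact Lu|apply (filterlim_scal_r (- k) 1)].
    + apply (filterlim_plus k ((- k) * 1)).
Qed.

Lemma wh_real_normalised alpha tau c : 0 < c -> wh_normalised alpha tau (wh_real alpha tau c).
Proof.
  intros Hc. assert (HG := Gamma_pos c Hc). split.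
  - assert (H := wh_sol_scal alpha tau (/ Gamma c) _ _ _
       (wh_int_sol alpha tau c 0 Hc (Rle_refl 0))).
    eexists; eexists. intros x Hx. destruct (H x Hx) as [H0 [H1 E]].
    split; [|split].
    + apply (is_derive_ext (fun x => / Gamma c * wh_int alpha tau c 0 x)); [|exact H0].
      intros t. unfold wh_real, Rdiv. apply Rmult_comm.
    + exact H1.
    + eapply eq_trans; [|exact E]. unfold wh_real. field. lra.
  - assert (L := wh_int_limit alpha tau c 0 Hc (Rle_refl 0)).
    rewrite conf_int_0_0 in L by exact Hc.
    apply (filterlim_ext (fun x => / Gamma c * (wh_int alpha tau c 0 x / envelope alpha x))).
    { intros x. unfold wh_real. field. split; [lra|]. apply Rgt_not_eq, envelope_pos. }
    replace (locally 1) with (locally (/ Gamma c * Gamma c)) by (f_equal; field; lra).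
    apply (filterlim_comp _ _ _ (fun x => wh_int alpha tau c 0 x / envelope alpha x)
             (fun y => / Gamma c * y) _ (locally (Gamma c)));
      [exact L|apply (filterlim_scal_r (/ Gamma c) (Gamma c))].
Qed.

Definition product_integrand (alpha beta x y tau t : R) : R :=
  exp (- t) * Rpower t (- alpha - beta) * Rpower (t + y) (beta - alpha)
  * hyp_fun (1 - 2 * alpha) ((1 / 2 - alpha) ^ 2 + tau ^ 2) (1 - alpha - beta) 0
      (t * (1 / x + 1 / y) + t ^ 2 / (x * y)).

(** As a function of [x] the right-hand side is a multiple of the recessive solution; the
    multiple is read off as [x -> +oo] and is the recessive solution in [y]. *)
Lemma product_formula_real alpha beta x y tau : alpha + beta < 1 -> 0 < x -> 0 < y ->
  exists J, is_RInt_gen (product_integrand alpha beta x y tau)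
      (at_right 0) (Rbar_locally p_infty) J /\
    wh_real alpha tau (1 - alpha - beta) x * wh_real beta tau (1 - alpha - beta) y
    = Rpower (x * y) alpha * exp (- (x + y) / 2) / Gamma (1 - alpha - beta) * J.
Proof.
  intros Hab Hx Hy. set (c := 1 - alpha - beta).
  assert (Hc : 0 < c) by (unfold c; lra).
  set (A := 1 - 2 * alpha). set (B := (1 / 2 - alpha) ^ 2 + tau ^ 2).
  assert (Hy' : 0 < / y) by now apply Rinv_0_lt_compat.
  assert (Hx' : 0 < / x) by now apply Rinv_0_lt_compat.
  exists (Rpower y (beta - alpha) * conf_int A B c (/ y) 0 (/ x)). split.
  - assert (H := conf_int_is A B c (/ y) Hc ltac:(lra) 0 (/ x) ltac:(lra)).
    apply (is_RInt_gen_scal (V := R_NormedModule) _ (Rpower y (beta - alpha))) in H.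
    revert H. apply (is_RInt_gen_ext (V := R_NormedModule)).
    apply (half_line_prod _ 1 1); [lra|]. simpl. intros a b Ha Hb t.
    rewrite Rmin_left, Rmax_right by lra. intros Ht.
    unfold scal; simpl; unfold mult; simpl.
    unfold kernel, weight, product_integrand. fold A B c.
    replace (arg (/ y) (/ x) t) with (t * (1 / x + 1 / y) + t ^ 2 / (x * y))
      by (unfold arg; field; lra).
    replace (c - 1) with (- alpha - beta) by (unfold c; ring).
    replace (A - c) with (beta - alpha) by (unfold A, c; ring).
    replace (t + y) with (y * (1 + / y * t)) by (field; lra).
    rewrite <- (Rpower_mult_distr y) by nra. ring.
  - assert (E1 : wh_int alpha tau c (/ y) x = conf_int A B c (/ y) 0 0 * wh_real alpha tau c x).
    { apply (wh_proportional alpha tau (wh_real alpha tau c) _ _ _ _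
         (wh_real_normalised alpha tau c Hc)
         (wh_int_sol alpha tau c (/ y) Hc ltac:(lra))); [|exact Hx].
      apply wh_int_limit; lra. }
    rewrite (conf_int_euler A B c (alpha - beta) (/ y)) in E1
      by ((unfold A, c; ring) || lra).
    unfold wh_int in E1. fold A B in E1.
    replace (A + 2 * (alpha - beta)) with (1 - 2 * beta) in E1 by (unfold A; ring).
    replace (B + (alpha - beta) * c) with ((1 / 2 - beta) ^ 2 + tau ^ 2) in E1
      by (unfold B, c; field).
    unfold wh_real at 2. unfold wh_int.
    set (W := conf_int (1 - 2 * beta) _ _ _ _ _) in *.
    replace (wh_real alpha tau c x * (envelope beta y * W / Gamma c))
      with (envelope beta y / Gamma c * (W * wh_real alpha tau c x))
      by (field; apply Rgt_not_eq, Gamma_pos, Hc).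
    rewrite <- E1. unfold envelope.
    rewrite <- Rpower_mult_distr by assumption.
    replace (- (x + y) / 2) with (- x / 2 + - y / 2) by field. rewrite exp_plus.
    replace beta with (alpha + (beta - alpha)) at 1 by ring. rewrite Rpower_plus.
    field. apply Rgt_not_eq, Gamma_pos, Hc.
Qed.

(** * Transfer to complex-valued functions *)

Lemma is_derive_RC_components (f : R -> C) (x : R) (l : C) : is_derive_RC f x l ->
  is_derive (fun t => fst (f t)) x (fst l) /\ is_derive (fun t => snd (f t)) x (snd l).
Proof.
  intros H. split.
  - apply (filterdiff_ext_lin _ (fun y => fst (@scal R_AbsRing C_R_NormedModule y l))).
    + apply (filterdiff_comp' (U := R_NormedModule) (V := C_R_NormedModule) (W := R_NormedModule)
        f fst x _ fst H). apply filterdiff_linear, is_linear_fst.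
    + reflexivity.
  - apply (filterdiff_ext_lin _ (fun y => snd (@scal R_AbsRing C_R_NormedModule y l))).
    + apply (filterdiff_comp' (U := R_NormedModule) (V := C_R_NormedModule) (W := R_NormedModule)
        f snd x _ snd H). apply filterdiff_linear, is_linear_snd.
    + reflexivity.
Qed.

Lemma is_derive_RtoC (u : R -> R) (x l : R) :
  is_derive u x l -> is_derive_RC (fun t => RtoC (u t)) x (RtoC l).
Proof.
  intros H. unfold is_derive_RC.
  assert (X := is_derive_scal_l (V := C_R_NormedModule) u x l (RtoC 1) H).
  assert (E : forall y, @scal R_AbsRing C_R_NormedModule y (RtoC 1) = RtoC y).
  { intros y. apply injective_projections; simpl; unfold scal; simpl; unfold mult; simpl; ring. }
  rewrite E in X.
  eapply is_derive_ext; [|exact X]. intros t. apply E.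
Qed.

Lemma whittaker_potential (alpha tau x : R) : x <> 0 ->
  (alpha / x - 1 / 4 + (1 / 4 - (Ci * tau) * (Ci * tau)) / (x * x))%C
  = RtoC (alpha / x - 1 / 4 + (1 / 4 + tau * tau) / (x * x)).
Proof.
  intros E.
  rewrite RtoC_plus, RtoC_minus, !RtoC_div, RtoC_plus, !RtoC_mult, RtoC_div
    by (try apply Rmult_integral_contrapositive; lra).
  replace (Ci * tau * (Ci * tau))%C with ((Ci * Ci) * (tau * tau))%C by ring.
  replace (Ci * Ci)%C with (- RtoC 1)%C.
  - field. apply RtoC_neq_0. exact E.
  - apply injective_projections; simpl; ring.
Qed.

(** Real and imaginary parts of any normalised complex solution solve the real equation,
    with leading coefficients [1] and [0]. *)
Lemma WhittakerW_real (alpha tau : R) (u : R -> R) : wh_normalised alpha tau u ->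
  forall x, 0 < x -> WhittakerW alpha (Ci * tau) x = RtoC (u x).
Proof.
  intros Hu. assert (Hu' := Hu). destruct Hu' as [[u1 [u2 Hs]] Lu].
  assert (X : is_WhittakerW alpha (Ci * tau) (WhittakerW alpha (Ci * tau))).
  { unfold WhittakerW. apply epsilon_spec. exists (fun x => RtoC (u x)). split.
    - exists (fun x => RtoC (u1 x)), (fun x => RtoC (u2 x)). intros x Hx.
      destruct (Hs x Hx) as [H0 [H1 E]].
      split; [now apply is_derive_RtoC|]. split; [now apply is_derive_RtoC|].
      rewrite (whittaker_potential alpha tau x) by lra.
      rewrite <- RtoC_mult, <- RtoC_plus. now rewrite E.
    - apply (filterlim_C (Rbar_locally p_infty)). split; simpl.
      + eapply filterlim_ext; [|exact Lu]. intros x. unfold envelope. simpl.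
        field. split; apply Rgt_not_eq; [apply exp_pos|apply Rpower_pos].
      + apply (filterlim_ext (fun _ => 0)); [|apply filterlim_const].
        intros x. simpl. unfold Rdiv. ring. }
  destruct X as [[d [dd Hd]] Ld].
  set (W := WhittakerW alpha (Ci * tau)) in *.
  apply (filterlim_C (Rbar_locally p_infty)) in Ld. destruct Ld as [L1 L2].
  assert (Hcomp : wh_sol alpha tau (fun x => fst (W x)) (fun x => fst (d x)) (fun x => fst (dd x))
     /\ wh_sol alpha tau (fun x => snd (W x)) (fun x => snd (d x)) (fun x => snd (dd x))).
  { split; intros x Hx; destruct (Hd x Hx) as [H0 [H1 E]];
    apply is_derive_RC_components in H0; apply is_derive_RC_components in H1;
    (split; [apply H0|split; [apply H1|]]);
    rewrite (whittaker_potential alpha tau x) in E by lra.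
    - apply (f_equal fst) in E. simpl in E. rewrite <- E. ring.
    - apply (f_equal snd) in E. simpl in E. rewrite <- E. ring. }
  destruct Hcomp as [S1 S2]. intros x Hx.
  assert (Hdiv : forall (z : C) (r : R), r <> 0 ->
     fst (z / RtoC r)%C = fst z / r /\ snd (z / RtoC r)%C = snd z / r).
  { intros [z1 z2] r Hr. simpl. split; field; exact Hr. }
  assert (Hne : forall x, envelope alpha x <> 0) by (intros; apply Rgt_not_eq, envelope_pos).
  apply injective_projections; simpl.
  - rewrite (wh_proportional alpha tau u _ _ _ 1 Hu S1); [ring| |exact Hx].
    eapply filterlim_ext; [|exact L1]. intros t. exact (proj1 (Hdiv (W t) _ (Hne t))).
  - rewrite (wh_proportional alpha tau u _ _ _ 0 Hu S2); [ring| |exact Hx].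
    eapply filterlim_ext; [|exact L2]. intros t. exact (proj2 (Hdiv (W t) _ (Hne t))).
Qed.

Lemma int_0_infty_RtoC (g : R -> R) (f : R -> C) (l : R) :
  (forall t, 0 < t -> f t = RtoC (g t)) ->
  is_RInt_gen g (at_right 0) (Rbar_locally p_infty) l ->
  ex_int_0_infty f /\ int_0_infty f = RtoC l.
Proof.
  intros E H.
  assert (X : @is_RInt_gen C_R_NormedModule f (at_right 0) (Rbar_locally p_infty) (RtoC l)).
  { apply (is_RInt_gen_ext (V := C_R_NormedModule) (fun t => RtoC (g t))).
    - apply (half_line_prod _ 1 1); [lra|]. simpl. intros a b Ha Hb t.
      rewrite Rmin_left, Rmax_right by lra. intros Ht. symmetry. apply E. lra.
    - intros P HP.
      assert (L : filterlim RtoC (locally l) (locally (T := C_R_NormedModule) (RtoC l))).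
      { apply (filterlim_C (locally l)). split; simpl; [intros S HS; exact HS|apply filterlim_const]. }
      assert (Q : filter_prod (at_right 0) (Rbar_locally p_infty)
         (fun ab => exists y, is_RInt g (fst ab) (snd ab) y /\ P (RtoC y))) by exact (H _ (L P HP)).
      refine (filter_imp _ _ _ Q). intros [a b] [y [Hy HPy]]; simpl in *.
      exists (RtoC y). split; [|exact HPy].
      apply (is_RInt_fct_extend_pair (U := R_NormedModule) (V := R_NormedModule)); simpl.
      + exact Hy.
      + assert (Z := is_RInt_const (V := R_NormedModule) a b 0).
        change (is_RInt (V := R_NormedModule) (fun _ => 0) a b ((b - a) * 0)) in Z.
        rewrite Rmult_0_r in Z. exact Z. }
  split; [now exists (RtoC l)|].
  exact (@is_RInt_gen_unique C_R_CompleteNormedModule _ _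
           (Proper_StrongProper _ (at_right_proper_filter 0))
           (Proper_StrongProper _ (Rbar_locally_filter p_infty)) f (RtoC l) X).
Qed.

Lemma integrand_real (alpha beta x y tau t : R) :
  alpha + beta < 1 -> 0 < x -> 0 < y -> 0 < t ->
  (RtoC (exp (- t) * Rpower t (- alpha - beta) * Rpower (t + y) (beta - alpha))
   * hyp2F1 (1 / 2 - alpha + Ci * tau) (1 / 2 - alpha - Ci * tau)
       (RtoC (1 - alpha - beta)) (- t * (1 / x + 1 / y) - t ^ 2 / (x * y))%R)%C
  = RtoC (product_integrand alpha beta x y tau t).
Proof.
  intros Hab Hx Hy Ht.
  assert (H1 : 0 < 1 / x + 1 / y).
  { apply Rplus_lt_0_compat; apply Rdiv_lt_0_compat; lra. }
  assert (H2 : 0 < t ^ 2 / (x * y)).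
  { apply Rdiv_lt_0_compat; [apply pow_lt; exact Ht|now apply Rmult_lt_0_compat]. }
  assert (H3 : 0 < t * (1 / x + 1 / y)) by now apply Rmult_lt_0_compat.
  rewrite (hyp2F1_conjugate _ _ (1 - 2 * alpha) ((1 / 2 - alpha) ^ 2 + tau ^ 2)).
  - rewrite <- RtoC_mult. f_equal. unfold product_integrand, hyp_real.
    replace (- (- t * (1 / x + 1 / y) - t ^ 2 / (x * y)))
      with (t * (1 / x + 1 / y) + t ^ 2 / (x * y)) by ring. reflexivity.
  - lra.
  - apply injective_projections; simpl; field.
  - apply injective_projections; simpl; field.
  - lra.
Qed.

Theorem mainTheorem3 (alpha beta x y tau : R)
  (Hab : alpha + beta < 1) (Hx : 0 < x) (Hy : 0 < y) :
  let integrand1 := fun t : R =>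
    (RtoC (exp (- t) * Rpower t (- alpha - beta) * Rpower (t + y) (beta - alpha))
     * hyp2F1 (1 / 2 - alpha + Ci * tau) (1 / 2 - alpha - Ci * tau)
         (RtoC (1 - alpha - beta))
         (- t * (1 / x + 1 / y) - t ^ 2 / (x * y))%R)%C in
  let integrand2 := fun t : R =>
    (RtoC (exp (- t) * Rpower t (- alpha - beta) * Rpower (t + x) (alpha - beta))
     * hyp2F1 (1 / 2 - beta + Ci * tau) (1 / 2 - beta - Ci * tau)
         (RtoC (1 - alpha - beta))
         (- t * (1 / x + 1 / y) - t ^ 2 / (x * y))%R)%C in
  ex_int_0_infty integrand1 /\
  ex_int_0_infty integrand2 /\
  (WhittakerW alpha (Ci * tau) x * WhittakerW beta (Ci * tau) y
   = RtoC (Rpower (x * y) alpha * exp (- (x + y) / 2) / Gamma (1 - alpha - beta))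
     * int_0_infty integrand1)%C /\
  (WhittakerW alpha (Ci * tau) x * WhittakerW beta (Ci * tau) y
   = RtoC (Rpower (x * y) beta * exp (- (x + y) / 2) / Gamma (1 - alpha - beta))
     * int_0_infty integrand2)%C.
Proof.
  intros integrand1 integrand2.
  assert (Hc : 0 < 1 - alpha - beta) by lra.
  destruct (product_formula_real alpha beta x y tau Hab Hx Hy) as [J1 [I1 E1]].
  destruct (product_formula_real beta alpha y x tau) as [J2 [I2 E2]]; try assumption; [lra|].
  replace (1 - beta - alpha) with (1 - alpha - beta) in E2 by ring.
  destruct (int_0_infty_RtoC _ integrand1 J1
    (fun t => integrand_real alpha beta x y tau t Hab Hx Hy) I1) as [X1 V1].
  assert (H2 : forall t, 0 < t ->
     integrand2 t = RtoC (product_integrand beta alpha y x tau t)).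
  { intros t Ht. rewrite <- integrand_real by (assumption || lra). unfold integrand2.
    replace (- alpha - beta) with (- beta - alpha) by ring.
    replace (1 - alpha - beta) with (1 - beta - alpha) by ring.
    replace (1 / x + 1 / y) with (1 / y + 1 / x) by ring.
    replace (x * y) with (y * x) by ring. reflexivity. }
  destruct (int_0_infty_RtoC _ integrand2 J2 H2 I2) as [X2 V2].
  split; [exact X1|]. split; [exact X2|].
  rewrite V1, V2.
  rewrite (WhittakerW_real alpha tau _ (wh_real_normalised alpha tau (1 - alpha - beta) Hc) x Hx).
  rewrite (WhittakerW_real beta tau _ (wh_real_normalised beta tau (1 - alpha - beta) Hc) y Hy).
  rewrite <- !RtoC_mult. split; f_equal.
  - exact E1.
  - rewrite Rmult_comm, E2, (Rmult_comm y x), (Rplus_comm y x). reflexivity.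
Qed.
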